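(* Let $\mathbf{k}=\mathbb{C}$. For every $A\in\mathbb{R}_{\ge 0}$ there exists a cotriangular Hopf algebra $\Gamma$ over $\mathbb{C}$ with a finite dimensional $\Gamma$-corepresentation (comodule) $V$ such that $$\beta^{\Gamma,V}+A<\dim V.$$
   Context: $b_n^{\Gamma,V}$ is the number of indecomposable direct summands of the $\Gamma$-comodule $V^{\otimes n}$ counted with multiplicity, and $\beta^{\Gamma,V}=\lim_{n\to\infty}\sqrt[n]{b_n^{\Gamma,V}}$ (the limit exists by Fekete's lemma). *)

(* Defs.v *)
From HB Require Import structures.
From mathcomp Require Import all_boot all_order all_algebra.
From mathcomp Require Import sesquilinear generic_quotient.
From mathcomp Require Import all_classical all_reals all_analysis.
From mathcomp Require Import complex.

Set Implicit Arguments.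
Unset Strict Implicit.
Unset Printing Implicit Defensive.

Import Order.TTheory GRing.Theory Num.Theory.
Import numFieldNormedType.Exports.
Local Open Scope classical_set_scope.
Local Open Scope ring_scope.
Local Open Scope quotient_scope.

Reserved Notation "V \ox W" (at level 40, left associativity).
Reserved Notation "v \ot w" (at level 40, left associativity).
Reserved Notation "\sw_ ( a , b <- t ) E"
  (at level 41, a name, b name, t at level 200, E at level 41, right associativity).

(* A finite sequence of pairs [:: (v_1, w_1); ...; (v_n, w_n)] stands for the
   tensor \sum_i v_i (x) w_i.  Two sequences are identified when no bilinear map
   (into any space) separates them, so that the quotient is universal for
   bilinear maps; see [tsum_pure] and [tsum_is_linear] below. *)
Section TensorProduct.
Variables (K : fieldType) (V W : lmodType K).

Definition seq_eval (U : lmodType K) (f : V -> W -> U) (s : seq (V * W)) : U :=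
  \sum_(p <- s) f p.1 p.2.

Definition tens_eqv (s t : seq (V * W)) : bool :=
  `[< forall (U : lmodType K) (f : V -> W -> U),
        bilinear_for *:%R *:%R f -> seq_eval f s = seq_eval f t >].

Lemma tens_eqv_is_equiv : equiv_class_of tens_eqv.
Proof.
split.
- by move=> s; apply/asboolP.
- by move=> s t; apply/asboolP/asboolP => h U f hf; rewrite h.
- move=> t s u /asboolP h1 /asboolP h2; apply/asboolP => U f hf.
  by rewrite h1 // h2.
Qed.

Canonical tens_eqv_equiv := EquivRelPack tens_eqv_is_equiv.

Definition tensor : Type := {eq_quot tens_eqv}.

HB.instance Definition _ := Choice.on tensor.
HB.instance Definition _ := EqQuotient.on tensor.

Definition tens (v : V) (w : W) : tensor := \pi_tensor [:: (v, w)].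

(* Evaluation of a bilinear expression on the tensor t; this is Sweedler's
   notation.  It goes through an arbitrary representative of t, hence is only
   meaningful when f is bilinear. *)
Definition tsum (U : lmodType K) (t : tensor) (f : V -> W -> U) : U :=
  seq_eval f (repr t).

Lemma tsum_pi (U : lmodType K) (f : V -> W -> U) s :
  bilinear_for *:%R *:%R f -> tsum (\pi_tensor s) f = seq_eval f s.
Proof.
move=> hf; rewrite /tsum.
have : \pi_tensor (repr (\pi_tensor s)) == \pi_tensor s by rewrite reprK.
by rewrite eqmodE => /asboolP/(_ U f hf).
Qed.

Lemma tens_piP s t :
  (forall (U : lmodType K) (f : V -> W -> U),
     bilinear_for *:%R *:%R f -> seq_eval f s = seq_eval f t) ->
  \pi_tensor s = \pi_tensor t.
Proof. by move=> h; apply/eqP; rewrite eqmodE; apply/asboolP. Qed.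

Lemma tensor_ext (x y : tensor) :
  (forall (U : lmodType K) (f : V -> W -> U),
     bilinear_for *:%R *:%R f -> tsum x f = tsum y f) -> x = y.
Proof. by move=> h; rewrite -[x]reprK -[y]reprK; apply: tens_piP. Qed.

Definition tens_add (x y : tensor) : tensor := \pi_tensor (repr x ++ repr y).
Definition tens_scale (a : K) (x : tensor) : tensor :=
  \pi_tensor [seq (a *: p.1, p.2) | p <- repr x].
Definition tens_zero : tensor := \pi_tensor [::].
Definition tens_opp (x : tensor) : tensor := tens_scale (-1) x.

Lemma tsum_add (U : lmodType K) (f : V -> W -> U) x y :
  bilinear_for *:%R *:%R f -> tsum (tens_add x y) f = tsum x f + tsum y f.
Proof. by move=> hf; rewrite tsum_pi // /seq_eval big_cat. Qed.

Lemma tsum_zero (U : lmodType K) (f : V -> W -> U) :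
  bilinear_for *:%R *:%R f -> tsum tens_zero f = 0.
Proof. by move=> hf; rewrite tsum_pi // /seq_eval big_nil. Qed.

Lemma tsum_scale (U : lmodType K) (f : V -> W -> U) a x :
  bilinear_for *:%R *:%R f -> tsum (tens_scale a x) f = a *: tsum x f.
Proof.
move=> hf; rewrite tsum_pi // /seq_eval big_map scaler_sumr.
by apply: eq_bigr => p _ /=; exact: (scalable_linear (hf.1 p.2)).
Qed.

Lemma tsum_opp (U : lmodType K) (f : V -> W -> U) x :
  bilinear_for *:%R *:%R f -> tsum (tens_opp x) f = - tsum x f.
Proof. by move=> hf; rewrite tsum_scale // scaleN1r. Qed.

Lemma tens_addA : associative tens_add.
Proof. by move=> x y z; apply: tensor_ext => U f h; rewrite !tsum_add // addrA. Qed.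
Lemma tens_addC : commutative tens_add.
Proof. by move=> x y; apply: tensor_ext => U f h; rewrite !tsum_add // addrC. Qed.
Lemma tens_add0 : left_id tens_zero tens_add.
Proof.
by move=> x; apply: tensor_ext => U f h; rewrite tsum_add // tsum_zero // add0r.
Qed.
Lemma tens_addN : left_inverse tens_zero tens_opp tens_add.
Proof.
move=> x; apply: tensor_ext => U f h.
by rewrite tsum_add // tsum_zero // tsum_opp // addNr.
Qed.

HB.instance Definition _ :=
  GRing.isZmodule.Build tensor tens_addA tens_addC tens_add0 tens_addN.

Lemma tens_scaleA a b x : tens_scale a (tens_scale b x) = tens_scale (a * b) x.
Proof. by apply: tensor_ext => U f h; rewrite !tsum_scale // scalerA. Qed.
Lemma tens_scale1 : left_id 1 tens_scale.
Proof. by move=> x; apply: tensor_ext => U f h; rewrite tsum_scale // scale1r. Qed.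
Lemma tens_scaleDr : right_distributive tens_scale +%R.
Proof.
move=> a x y; apply: tensor_ext => U f h.
by rewrite tsum_scale // !tsum_add // !tsum_scale // scalerDr.
Qed.
Lemma tens_scaleDl x : {morph tens_scale^~ x : a b / a + b}.
Proof.
move=> a b; apply: tensor_ext => U f h.
by rewrite tsum_scale // tsum_add // !tsum_scale // scalerDl.
Qed.

HB.instance Definition _ := GRing.Zmodule_isLmodule.Build K tensor
  tens_scaleA tens_scale1 tens_scaleDr tens_scaleDl.

Lemma tsum_pure (U : lmodType K) (f : V -> W -> U) v w :
  bilinear_for *:%R *:%R f -> tsum (tens v w) f = f v w.
Proof. by move=> hf; rewrite tsum_pi // /seq_eval big_seq1. Qed.

Lemma tsum_is_linear (U : lmodType K) (f : V -> W -> U) :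
  bilinear_for *:%R *:%R f -> linear (fun x => tsum x f).
Proof. by move=> hf a x y; rewrite [LHS]tsum_add // tsum_scale. Qed.

Lemma tens_bilinear : bilinear_for *:%R *:%R tens.
Proof.
split=> [w|v] a x y; apply: tensor_ext => U f h.
  by rewrite tsum_pure // (tsum_is_linear h) !tsum_pure // h.1.
by rewrite tsum_pure // (tsum_is_linear h) !tsum_pure // h.2.
Qed.

Lemma tsum_tens (x : tensor) : tsum x tens = x.
Proof.
apply: tensor_ext => U f h; rewrite /tsum /seq_eval.
have := tsum_is_linear h => L.
pose g := GRing.isLinear.Build K tensor U *:%R (fun x => tsum x f) L.
pose G : {linear tensor -> U} := HB.pack (fun x => tsum x f) g.
rewrite -[LHS]/(G _) raddf_sum; apply: eq_bigr => p _.
by rewrite /= tsum_pure.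
Qed.

End TensorProduct.

Notation "V \ox W" := (tensor V W) : type_scope.
Notation "v \ot w" := (tens v w) : ring_scope.
Notation "\sw_ ( a , b <- t ) E" := (tsum t (fun a b => E)) : ring_scope.

Section TensorTheory.
Variable K : fieldType.
Implicit Types U V W X Y : lmodType K.

Lemma lin_id U : linear (fun u : U => u).
Proof. by []. Qed.

Lemma lin_comp U V W (G : {linear V -> W}) (g : U -> V) :
  linear g -> linear (fun u => G (g u)).
Proof. by move=> hg a x y; rewrite hg linearP. Qed.

Lemma lin_tensl U V W (g : U -> V) (w : W) :
  linear g -> linear (fun u => g u \ot w).
Proof. by move=> hg a x y; rewrite hg (@tens_bilinear K V W).1. Qed.

Lemma lin_tensr U V W (g : U -> W) (v : V) :
  linear g -> linear (fun u => v \ot g u).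
Proof. by move=> hg a x y; rewrite hg (@tens_bilinear K V W).2. Qed.

Lemma lin_scalel U W (g : U -> K^o) (w : W) :
  linear g -> linear (fun u => g u *: w).
Proof. by move=> hg a x y; rewrite hg scalerDl scalerA. Qed.

Lemma lin_scaler U W (g : U -> W) (b : K) :
  linear g -> linear (fun u => b *: g u).
Proof. by move=> hg a x y; rewrite hg scalerDr !scalerA mulrC. Qed.

Lemma lin_mull U (H : algType K) (g : U -> H) (h : H) :
  linear g -> linear (fun u => g u * h).
Proof. by move=> hg a x y; rewrite hg mulrDl scalerAl. Qed.

Lemma lin_mulr U (H : algType K) (g : U -> H) (h : H) :
  linear g -> linear (fun u => h * g u).
Proof. by move=> hg a x y; rewrite hg mulrDr scalerAr. Qed.

Lemma lin_tsuml U V W X (g : U -> V \ox W) (f : V -> W -> X) :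
    (forall w, linear (f^~ w)) -> (forall v, linear (f v)) ->
  linear g -> linear (fun u => tsum (g u) f).
Proof. by move=> h1 h2 hg a x y; rewrite hg tsum_is_linear. Qed.

Lemma lin_tsumr U V W X (t : V \ox W) (F : U -> V -> W -> X) :
  (forall v w, linear (fun u => F u v w)) -> linear (fun u => tsum t (F u)).
Proof.
move=> hF a x y; rewrite /tsum /seq_eval scaler_sumr -big_split /=.
by apply: eq_bigr => p _; rewrite hF.
Qed.

Lemma eq_tsum V W X (t : V \ox W) (f g : V -> W -> X) :
  (forall v w, f v w = g v w) -> tsum t f = tsum t g.
Proof. by move=> h; apply: eq_bigr => p _. Qed.

Lemma lin_tsum V W X Y (G : X -> Y) (t : V \ox W) (f : V -> W -> X) :
  linear G -> G (tsum t f) = tsum t (fun v w => G (f v w)).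
Proof.
move=> L; pose G' : {linear X -> Y} := HB.pack G (GRing.isLinear.Build K X Y *:%R G L).
by rewrite -[LHS]/(G' _) raddf_sum.
Qed.

Lemma exchange_tsum V W X Y U (s : V \ox W) (t : X \ox Y)
    (f : V -> W -> X -> Y -> U) :
  \sw_(v, w <- s) \sw_(x, y <- t) f v w x y =
  \sw_(x, y <- t) \sw_(v, w <- s) f v w x y.
Proof. exact: exchange_big. Qed.

Lemma lin_ext V W X (f g : V \ox W -> X) : linear f -> linear g ->
  (forall v w, f (v \ot w) = g (v \ot w)) -> forall t, f t = g t.
Proof.
move=> hf hg h t; rewrite -(tsum_tens t) (lin_tsum _ _ hf) (lin_tsum _ _ hg).
exact: eq_tsum.
Qed.

End TensorTheory.

Ltac lin := repeat first
  [ exact: lin_id | apply: lin_tensl | apply: lin_tensr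
  | apply: lin_mull | apply: lin_mulr | apply: lin_scalel | apply: lin_scaler
  | apply: lin_tsuml | apply: lin_tsumr | exact: linearP | apply: lin_comp
  | lazymatch goal with
    | |- GRing.linear_for _ _ => fail
    | |- bilinear_for _ _ _ => split
    | |- forall _, _ => move=> ?
    end
  | solve [eauto] ].

Definition tens_mul (K : fieldType) (H : algType K) (x y : H \ox H) : H \ox H :=
  \sw_(a, b <- x) \sw_(c, d <- y) (a * c) \ot (b * d).

Record hopfAlgebra (K : fieldType) := HopfAlgebra {
  hopf_alg :> algType K;
  comul : {linear hopf_alg -> hopf_alg \ox hopf_alg};
  counit : {lrmorphism hopf_alg -> K^o};
  antipode : {linear hopf_alg -> hopf_alg};
  comulA : forall x,
    \sw_(a, b <- comul x) \sw_(a1, a2 <- comul a) a1 \ot (a2 \ot b) =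
    \sw_(a, b <- comul x) a \ot comul b;
  counitl : forall x, \sw_(a, b <- comul x) counit a *: b = x;
  counitr : forall x, \sw_(a, b <- comul x) counit b *: a = x;
  comul1 : comul 1 = 1 \ot 1;
  comulM : forall x y, comul (x * y) = tens_mul (comul x) (comul y);
  antipodel : forall x, \sw_(a, b <- comul x) antipode a * b = (counit x)%:A;
  antipoder : forall x, \sw_(a, b <- comul x) a * antipode b = (counit x)%:A
}.

(* Convention for right comodules: the symmetric braiding induced by the form r
   is v (x) w |-> r(v_1, w_1) w_0 (x) v_0.  By [cotri_sym], r is
   convolution-invertible with inverse (x, y) |-> r y x; exchanging x and y in
   it shows that this inverse is two-sided. *)
Record cotriangular_structure (K : fieldType) (H : hopfAlgebra K) := Cotriangular {
  cotri_form :> {bilinear H -> H -> K^o};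
  cotri_mull : forall x y z, cotri_form (x * y) z =
    \sw_(z1, z2 <- comul H z) cotri_form x z1 * cotri_form y z2 :> K^o;
  cotri_mulr : forall x y z, cotri_form x (y * z) =
    \sw_(x1, x2 <- comul H x) cotri_form x1 z * cotri_form x2 y :> K^o;
  cotri_comm : forall x y,
    \sw_(x1, x2 <- comul H x) \sw_(y1, y2 <- comul H y)
       cotri_form x2 y2 *: (y1 * x1) =
    \sw_(x1, x2 <- comul H x) \sw_(y1, y2 <- comul H y)
       cotri_form x1 y1 *: (x2 * y2);
  cotri_sym : forall x y,
    \sw_(x1, x2 <- comul H x) \sw_(y1, y2 <- comul H y)
       (cotri_form x1 y1 * cotri_form y2 x2 : K^o) = counit H x * counit H y
}.

Section Comodules.
Variables (K : fieldType) (H : hopfAlgebra K).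

Record coaction (V : lmodType K) := Coaction {
  coact :> {linear V -> V \ox H};
  coactA : forall v,
    \sw_(v0, v1 <- coact v) \sw_(w0, w1 <- coact v0) w0 \ot (w1 \ot v1) =
    \sw_(v0, v1 <- coact v) v0 \ot comul H v1;
  coact_counit : forall v, \sw_(v0, v1 <- coact v) counit H v1 *: v0 = v
}.

Lemma coactA_trilinear (V : lmodType K) (rho : coaction V) (U : lmodType K)
    (F : V -> H -> H -> U) (v : V) :
    (forall h k, linear (fun v => F v h k)) ->
    (forall v k, linear (fun h => F v h k)) ->
    (forall v h, linear (F v h)) ->
  \sw_(v0, v1 <- rho v) \sw_(w0, w1 <- rho v0) F w0 w1 v1 =
  \sw_(v0, v1 <- rho v) \sw_(a, b <- comul H v1) F v0 a b.
Proof.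
move=> h1 h2 h3.
pose E (t : V \ox (H \ox H)) := \sw_(v, y <- t) \sw_(h, k <- y) F v h k.
have EL : linear E by rewrite /E; lin.
have Ep v' y : E (v' \ot y) = \sw_(h, k <- y) F v' h k.
  rewrite /E tsum_pure //; lin.
have Epp v' h k : E (v' \ot (h \ot k)) = F v' h k.
  by rewrite Ep tsum_pure //; lin.
have := congr1 E (coactA rho v); rewrite !(lin_tsum _ _ EL) => e.
transitivity (\sw_(v0, v1 <- rho v)
   E (\sw_(w0, w1 <- rho v0) w0 \ot (w1 \ot v1))).
  apply: eq_tsum => v0 v1; rewrite (lin_tsum _ _ EL).
  by apply: eq_tsum => w0 w1; rewrite Epp.
by rewrite e; apply: eq_tsum => v0 v1; rewrite Ep.
Qed.

Definition trivial_coact (x : K^o) : K^o \ox H := x \ot (1 : H).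

Lemma trivial_coact_linear : linear trivial_coact.
Proof. by rewrite /trivial_coact; lin. Qed.

HB.instance Definition _ :=
  GRing.isLinear.Build K K^o (K^o \ox H) *:%R trivial_coact trivial_coact_linear.

Lemma trivial_coactA (x : K^o) :
  \sw_(v0, v1 <- trivial_coact x) \sw_(w0, w1 <- trivial_coact v0)
     w0 \ot (w1 \ot v1) =
  \sw_(v0, v1 <- trivial_coact x) v0 \ot comul H v1.
Proof.
rewrite /trivial_coact tsum_pure; last by lin.
by rewrite !tsum_pure ?comul1 //; lin.
Qed.

Lemma trivial_coact_counit (x : K^o) :
  \sw_(v0, v1 <- trivial_coact x) counit H v1 *: v0 = x.
Proof. by rewrite tsum_pure ?rmorph1 ?scale1r //; lin. Qed.

Definition trivial_coaction : coaction K^o :=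
  Coaction (coact := trivial_coact) trivial_coactA trivial_coact_counit.

Section TensorCoaction.
Variables (V W : lmodType K) (rho : coaction V) (sigma : coaction W).

Definition tens_coact (t : V \ox W) : (V \ox W) \ox H :=
  \sw_(v, w <- t) \sw_(v0, v1 <- rho v) \sw_(w0, w1 <- sigma w)
    (v0 \ot w0) \ot (v1 * w1).

Lemma tens_coact_linear : linear tens_coact.
Proof. rewrite /tens_coact; lin. Qed.

HB.instance Definition _ :=
  GRing.isLinear.Build K (V \ox W) ((V \ox W) \ox H) *:%R tens_coact tens_coact_linear.

Lemma tens_coact_pure v w : tens_coact (v \ot w) =
  \sw_(v0, v1 <- rho v) \sw_(w0, w1 <- sigma w) (v0 \ot w0) \ot (v1 * w1).
Proof. by rewrite /tens_coact tsum_pure //; lin. Qed.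

Lemma tens_coactA t :
  \sw_(v0, v1 <- tens_coact t) \sw_(w0, w1 <- tens_coact v0) w0 \ot (w1 \ot v1) =
  \sw_(v0, v1 <- tens_coact t) v0 \ot comul H v1.
Proof.
pose L u := \sw_(v0, v1 <- tens_coact u)
  \sw_(w0, w1 <- tens_coact v0) w0 \ot (w1 \ot v1).
pose R u := \sw_(v0, v1 <- tens_coact u) v0 \ot comul H v1.
rewrite -/(L t) -/(R t).
apply: lin_ext t => [||v w]; rewrite /L /R; [by lin|by lin|].
rewrite tens_coact_pure.
pose L2 (x : (V \ox W) \ox H) := \sw_(v0, v1 <- x) \sw_(w0, w1 <- tens_coact v0) w0 \ot (w1 \ot v1).
have L2L : linear L2 by rewrite /L2; lin.
pose R2 (x : (V \ox W) \ox H) := \sw_(v0, v1 <- x) v0 \ot comul H v1.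
have R2L : linear R2 by rewrite /R2; lin.
rewrite -[LHS]/(L2 _) -[RHS]/(R2 _) (lin_tsum _ _ L2L) (lin_tsum _ _ R2L).
transitivity (\sw_(v0, v1 <- rho v) \sw_(w0, w1 <- sigma w)
  \sw_(v00, v01 <- rho v0) \sw_(w00, w01 <- sigma w0)
    (v00 \ot w00) \ot ((v01 * w01) \ot (v1 * w1))).
  apply: eq_tsum => v0 v1; rewrite (lin_tsum _ _ L2L).
  apply: eq_tsum => w0 w1; rewrite /L2 tsum_pure; last by lin.
  rewrite tens_coact_pure.
  pose L3 (x : (V \ox W) \ox H) := \sw_(z0, z1 <- x) z0 \ot (z1 \ot (v1 * w1)).
  have L3L : linear L3 by rewrite /L3; lin.
  rewrite -[LHS]/(L3 _) (lin_tsum _ _ L3L); apply: eq_tsum => a b.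
  rewrite (lin_tsum _ _ L3L); apply: eq_tsum => c d.
  by rewrite /L3 tsum_pure //; lin.
transitivity (\sw_(v0, v1 <- rho v) \sw_(w0, w1 <- sigma w)
  \sw_(a, b <- comul H v1) \sw_(c, d <- comul H w1)
    (v0 \ot w0) \ot ((a * c) \ot (b * d))); last first.
  apply: eq_tsum => v0 v1; rewrite (lin_tsum _ _ R2L).
  apply: eq_tsum => w0 w1; rewrite /R2 tsum_pure; last by lin.
  rewrite comulM /tens_mul.
  have TL : linear (fun x : H \ox H => (v0 \ot w0) \ot x) by lin.
  rewrite (lin_tsum _ _ TL); apply: eq_tsum => a b.
  by rewrite (lin_tsum _ _ TL).
under eq_tsum => v0 v1 do rewrite exchange_tsum.
rewrite (coactA_trilinear rho (F := fun v00 v01 v1 =>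
  \sw_(w0, w1 <- sigma w) \sw_(w00, w01 <- sigma w0)
    (v00 \ot w00) \ot ((v01 * w01) \ot (v1 * w1)))); try by lin.
apply: eq_tsum => v0 v1.
rewrite [RHS]exchange_tsum; apply: eq_tsum => a b.
by rewrite (coactA_trilinear sigma (F := fun w00 w01 w1 =>
    (v0 \ot w00) \ot ((a * w01) \ot (b * w1)))) //; lin.
Qed.

Lemma tens_coact_counit t :
  \sw_(v0, v1 <- tens_coact t) counit H v1 *: v0 = t.
Proof.
pose L (x : (V \ox W) \ox H) := \sw_(v0, v1 <- x) counit H v1 *: v0.
have LL : linear L by rewrite /L; lin.
have hL : linear (fun t => L (tens_coact t)).
  by move=> a x y; rewrite tens_coact_linear LL.
rewrite -[LHS]/(L _); apply: (lin_ext hL (@lin_id _ _)) t => v w.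
rewrite tens_coact_pure (lin_tsum _ _ LL).
rewrite -[in RHS](coact_counit rho v) -[in RHS](coact_counit sigma w).
have hl x : linear (fun v : V => v \ot x) by move=> ?; lin.
have hr y : linear (fun w : W => y \ot w) by move=> ?; lin.
rewrite (lin_tsum _ _ (hl _ _)); apply: eq_tsum => v0 v1.
rewrite (lin_tsum _ _ LL) (lin_tsum _ _ (hr _ _)); apply: eq_tsum => w0 w1.
rewrite /L tsum_pure; last by lin.
rewrite rmorphM -scalerA.
have [bl br] := @tens_bilinear K V W.
have el := scalable_linear (bl w0); have er := scalable_linear (br (counit H v1 *: v0)).
by rewrite [RHS]er el /= scalerA [RHS]scalerA mulrC.
Qed.

Definition tens_coaction : coaction (V \ox W) :=
  Coaction (coact := tens_coact) tens_coactA tens_coact_counit.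

End TensorCoaction.

Section TensorPower.
Variables (V : lmodType K) (rho : coaction V).

Fixpoint tpow (n : nat) : lmodType K :=
  if n is m.+1 then (tpow m \ox V : lmodType K) else K^o.

Fixpoint tpow_coaction (n : nat) : coaction (tpow n) :=
  if n is m.+1 then tens_coaction (tpow_coaction m) rho else trivial_coaction.

End TensorPower.

Section Summands.
Variables (W : lmodType K) (rho : coaction W).

Definition subspace (U : set W) : Prop :=
  U 0 /\ forall (a : K) (u v : W), U u -> U v -> U (a *: u + v).

(* The second clause says that rho maps U into the image of U (x) H. *)
Definition subcomodule (U : set W) : Prop :=
  subspace U /\
  forall u, U u -> exists2 s : seq (W * H),
    (forall p, p \in s -> U p.1) & rho u = \sum_(p <- s) p.1 \ot p.2.

Definition indecomposable (U : set W) : Prop :=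
  U <> [set 0] /\
  forall U1 U2 : set W, subcomodule U1 -> subcomodule U2 ->
    U1 `&` U2 = [set 0] ->
    [set u1 + u2 | u1 in U1 & u2 in U2] = U ->
    U1 = [set 0] \/ U2 = [set 0].

Definition indec_decomposition (k : nat) (U : 'I_k -> set W) : Prop :=
  (forall i, subcomodule (U i) /\ indecomposable (U i)) /\
  forall w : W, exists! u : {ffun 'I_k -> W},
    (forall i, U i (u i)) /\ w = \sum_i u i.

(* For W finite dimensional such a k exists, and it is unique by the
   Krull-Schmidt theorem, so the choice made by [xget] is irrelevant. *)
Definition num_indec : nat :=
  xget 0%N [set k | exists U : 'I_k -> set W, indec_decomposition U].

End Summands.

Definition num_summands (V : lmodType K) (rho : coaction V) (n : nat) : nat :=
  num_indec (tpow_coaction rho n).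

End Comodules.

Section Growth.
Variables (R : realType) (K : fieldType) (H : hopfAlgebra K).
Variables (V : lmodType K) (rho : coaction H V).

Definition root_summands : R^nat :=
  fun n => (num_summands rho n)%:R `^ (n%:R)^-1.

Definition growth_rate : R := limn root_summands.

End Growth.

(* Main.v *)
Require Import Defs.
From HB Require Import structures.
From mathcomp Require Import all_boot all_order all_algebra.
From mathcomp Require Import all_classical all_reals all_analysis.
From mathcomp Require Import complex.
From mathcomp Require Import sesquilinear generic_quotient zify ring lra.

(* The Hopf algebra is that of a nondegenerate bilinear form on a space of dimension d
   (Dubois-Violette and Launer): its generators are the matrix coefficients a_ij of the
   fundamental comodule V, and its relations say that the form [cap] and its copairing
   [cup] are morphisms of comodules. If the value of the loop [cap o cup] is -2, then
   [id + cup o cap] is a symmetric braiding on V, whence a cotriangular structure.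

   Planar diagrams made of cups and caps act on the tensor powers of every such V, and
   neither their composition nor their Gram matrix depends on the form. For the symplectic
   plane, the diagrams are linearly independent and their Gram matrix is invertible. Hence
   in general the projection of the n-th tensor power V^n onto the span of its diagrams,
   along the common kernel of the dual diagrams, commutes with all cups and caps, so it is
   the action of a linear functional on the Hopf algebra (its Haar functional); this shows
   that the diagrams span all invariants, and by duality all endomorphisms of the comodule
   V^n. So End(V^n) is isomorphic to the corresponding star-closed algebra of matrices of size 2^n, which has
   the Catalan dimension C_n. A decomposition of V^n into b indecomposables is a
   decomposition of 1 into b primitive orthogonal idempotents of that algebra, so
   C_n <= b^2 and b <= 2^n. The growth rate is therefore 2, whereas d is arbitrarily
   large: orthogonal and symplectic planes contribute 2 and -2 to the loop value. *)

Set Implicit Arguments.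
Unset Strict Implicit.
Unset Printing Implicit Defensive.

Import Order.TTheory GRing.Theory Num.Theory.
Import numFieldNormedType.Exports.
Local Open Scope classical_set_scope.
Local Open Scope ring_scope.
Local Open Scope quotient_scope.

(** * Words, forms and diagrams *)

(** With e = cup o cap, the square of id + e is id + (2 + loop) e, so the braiding is symmetric
    exactly for the loop value -2. This is the value of the symplectic plane, whose Hopf algebra is
    that of functions on SL_2: whatever d is, V behaves like the two-dimensional representation of
    SL_2, and 2 is the growth rate of that representation. Positivity is visible only in the plane,
    where diagrams have real coordinates and dual diagrams agree with them up to sign; a form mixing
    symmetric and antisymmetric pieces has neither property. So whatever rests on positivity
    (inverse Gram matrix, adjoints, semisimplicity) is proved for the plane and carried to the other
    forms by comparing coefficients of diagrams. The square in C_n <= b^2 counts pairs: for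
    primitive idempotents e_i of an algebra B of this kind, each e_i B e_j is at most a line, by
    Schur's lemma. *)

Fixpoint words (I : finType) n : seq (seq I) :=
  if n is m.+1 then [seq i :: w | i <- enum I, w <- words I m] else [:: [::]].

Section Words.
Variable I : finType.
Implicit Types w : seq I.

Lemma mem_words n w : (w \in words I n) = (size w == n).
Proof.
elim: n w => [|n IH] [|i w] //=; first by apply/negbTE/negP => /allpairsP[[? ?] []].
rewrite eqSS -IH; apply/allpairsP/idP => [[[j v] /= [_ hv [_ ->]]] //|hw].
by exists (i, w); rewrite /= mem_enum hw.
Qed.

Lemma words_uniq n : uniq (words I n).
Proof.
elim: n => //= n IH; apply: allpairs_uniq; rewrite ?enum_uniq //.
by move=> [i v] [j u] _ _ [-> ->].
Qed.

Lemma size_words n : size (words I n) = (#|I| ^ n)%N.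
Proof. by elim: n => //= n IH; rewrite size_allpairs IH -cardE expnS. Qed.

Variable U : nmodType.

Lemma big_words0 (F : seq I -> U) : \sum_(w <- words I 0) F w = F [::].
Proof. by rewrite /= big_seq1. Qed.

Lemma big_wordsS n (F : seq I -> U) :
  \sum_(w <- words I n.+1) F w = \sum_i \sum_(w <- words I n) F (i :: w).
Proof. by rewrite /= big_allpairs_dep big_enum. Qed.

Lemma eq_big_words n (F G : seq I -> U) :
  (forall w, size w = n -> F w = G w) ->
  \sum_(w <- words I n) F w = \sum_(w <- words I n) G w.
Proof.
by move=> h; apply: eq_big_seq => w; rewrite mem_words => /eqP; exact: h.
Qed.

Lemma big_words_cat m n (F : seq I -> U) :
  \sum_(w <- words I (m + n)) F w =
  \sum_(a <- words I m) \sum_(b <- words I n) F (a ++ b).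
Proof.
elim: m F => [|m IH] F; first by rewrite big_words0.
by rewrite addSn !big_wordsS; apply: eq_bigr => i _; rewrite IH.
Qed.

Lemma big_words_delta n (F : seq I -> U) w : size w = n ->
  \sum_(v <- words I n) (if v == w then F v else 0) = F w.
Proof.
move=> hw; rewrite -big_mkcond /= (big_rem w) ?mem_words ?hw //= eqxx.
rewrite big1_seq ?addr0 // => v /andP[/eqP -> ].
by rewrite mem_rem_uniq ?words_uniq // inE eqxx.
Qed.

End Words.

Arguments words : simpl never.

Lemma sum_delta (J : finType) (U : nmodType) (G : J -> U) i :
  \sum_k (if k == i then G k else 0) = G i.
Proof. by rewrite -big_mkcond /= big_pred1_eq. Qed.

(* A nondegenerate bilinear form that is monomial with signs in the basis [tl_idx]: [tau]
   pairs the basis vectors. Below, [cup] is the matrix of its copairing and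
   [cup (f := dual f)] that of the form itself; [tl_loop] says that the loop has the value
   it has for a symplectic plane. *)
Record tlForm (K : fieldType) := TLForm {
  tl_idx :> finType;
  tau : tl_idx -> tl_idx;
  sgn : tl_idx -> K;
  tauK : involutive tau;
  sgn_sqr : forall i, sgn i * sgn i = 1;
  tl_loop : \sum_i sgn i * sgn (tau i) = - 2%:R
}.

Arguments tau {K f} : rename.
Arguments sgn {K f} : rename.
Arguments tauK {K f} : rename.
Arguments sgn_sqr {K f} : rename.

Section TLForm.
Variable K : fieldType.
Implicit Types f : tlForm K.

Lemma dual_loop f : \sum_(i : f) sgn (tau i) * sgn (tau (tau i)) = - 2%:R.
Proof.
by rewrite -(tl_loop f); apply: eq_bigr => i _; rewrite tauK mulrC.
Qed.

Definition dual f : tlForm K :=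
  @TLForm K f (@tau K f) (fun i : f => sgn (tau i)) (@tauK K f)
    (fun i : f => sgn_sqr (tau i)) (dual_loop f).

Definition cup f (i j : f) : K := if j == tau i then sgn j else 0.

Lemma tau_eq f (i j : f) : (i == tau j) = (j == tau i).
Proof. by apply/eqP/eqP => ->; rewrite tauK. Qed.

Lemma cup_dual_dual f (i j : f) : cup (f := dual (dual f)) i j = cup i j.
Proof. by rewrite /cup /= tauK. Qed.

Lemma cup_dual f (i j : f) : cup (f := dual f) i j = if j == tau i then sgn i else 0.
Proof. by rewrite /cup /=; case: eqP => // ->; rewrite tauK. Qed.

Lemma cup_dualC f (i j : f) : cup (f := dual f) i j = cup j i.
Proof. by rewrite cup_dual /cup tau_eq. Qed.

(** A planar diagram is a bracket word: [true] opens a strand, [false] joins it to the last one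
    opened. [ev D [::] w] is the coordinate at the basis word [w] of the vector that [D] draws; [st]
    holds the letters of the strands still open. A length mismatch gives 0. *)
Fixpoint ev f (D : seq bool) (st w : seq f) : K :=
  match D, w with
  | [::], [::] => (st == [::])%:R
  | true :: D', x :: w' => ev D' (x :: st) w'
  | false :: D', y :: w' => if st is x :: st' then cup x y * ev D' st' w' else 0
  | _, _ => 0
  end.

Lemma ev_ins f D1 D2 (st w1 w2 : seq f) x y : size w1 = size D1 ->
  ev (D1 ++ true :: false :: D2) st (w1 ++ x :: y :: w2) =
  cup x y * ev (D1 ++ D2) st (w1 ++ w2).
Proof.
elim: D1 st w1 => [|b D1 IH] st [|u w1] //= [hs]; case: b; first exact: IH.
by case: st => [|v st]; rewrite ?mulr0 // IH // mulrCA.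
Qed.

Lemma ev_dual_dual f D (st w : seq f) :
  ev (f := dual (dual f)) D st w = ev D st w.
Proof.
elim: D st w => [|b D IH] st [|u w] //=; case: b; first exact: IH.
by case: st => [|v st] //; rewrite cup_dual_dual IH.
Qed.

Fixpoint dyck (h : nat) (D : seq bool) : bool :=
  match D with
  | [::] => h == 0%N
  | true :: D' => dyck h.+1 D'
  | false :: D' => (0 < h)%N && dyck h.-1 D'
  end.

Lemma dyck_ins h D1 D2 :
  dyck h (D1 ++ true :: false :: D2) = dyck h (D1 ++ D2).
Proof. by elim: D1 h => [|[] D1 IH] h //=; rewrite IH. Qed.

Lemma dyck_split h D : dyck h (true :: D) ->
  exists D1 D2, true :: D = D1 ++ true :: false :: D2.
Proof.
elim: D h => [|[] D IH] h //=; last by exists [::], D.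
by move=> /(IH h.+1)[D1 [D2 ->]]; exists (true :: D1), D2.
Qed.

(** An adjacent opening and closing can always be removed. This induction fits [ev], because
    inserting such a pair multiplies it by a single entry of [cup]. *)
Lemma dyck_ind (P : seq bool -> Prop) : P [::] ->
  (forall D1 D2, dyck 0 (D1 ++ D2) -> P (D1 ++ D2) ->
    P (D1 ++ true :: false :: D2)) ->
  forall D, dyck 0 D -> P D.
Proof.
move=> P0 PS D; have [n hn] := ubnP (size D).
elim: n D hn => // n IH [|[] D] // hn hD.
have [D1 [D2 e]] := dyck_split hD; rewrite e in hn hD *.
rewrite dyck_ins in hD; apply: PS => //; apply: IH => //.
by move: hn; rewrite !size_cat /=; lia.
Qed.

Lemma split_pair (T : Type) (w : seq T) n : (n.+2 <= size w)%N ->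
  exists w1 x y w2, w = w1 ++ x :: y :: w2 /\ size w1 = n.
Proof.
move=> hn; have h1 : size (take n w) = n by rewrite size_takel //; lia.
have h2 : (2 <= size (drop n w))%N by rewrite size_drop; lia.
case e: (drop n w) h2 => [|x [|y w2]] // _.
by exists (take n w), x, y, w2; rewrite -e cat_take_drop.
Qed.

(** A cap on strands i and i+1 turns a diagram into a multiple of a diagram. Relative to the
    innermost cup removed by the induction it is disjoint, shares one strand (a zigzag, factor 1),
    or shares both (a loop, factor -2). The scalar and the new diagram are chosen before the form:
    composition of diagrams does not see it. *)
Lemma cap_ev D i : dyck 0 D -> (i.+2 <= size D)%N ->
  exists z D', [/\ dyck 0 D', (size D').+2 = size D &
    forall f (a b : seq f), size a = i -> (size b + i.+2)%N = size D ->
      \sum_k sgn k * ev D [::] (a ++ k :: tau k :: b) = z * ev D' [::] (a ++ b)].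
Proof.
move=> hD; elim/dyck_ind: D / hD i => // D1 D2 hD IH i.
rewrite size_cat /= => hi.
(* The cap lies to the left of the cup: contract the shorter diagram, then put the cup back two
   places further left. *)
have [lt_ij|] := ltnP i.+1 (size D1).
  have [|z [D' [h1 h2 h3]]] := IH i; rewrite ?size_cat; try lia.
  rewrite size_cat in h2.
  have h4 : size (take (size D1 - 2) D') = (size D1 - 2)%N.
    by rewrite size_take; case: ltnP; lia.
  exists z, (take (size D1 - 2) D' ++ true :: false :: drop (size D1 - 2) D').
  split; first by rewrite dyck_ins cat_take_drop.
    by rewrite size_cat /= h4 size_drop; lia.
  move=> f a b ha hb.
  have [|b1 [x [y [b2 [eb hb1]]]]] := @split_pair _ b (size D1 - i.+2); first lia.
  have eb' := congr1 size eb; rewrite size_cat /= in eb'.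
  subst b; rewrite [in RHS]catA ev_ins ?cat_take_drop; last by rewrite size_cat; lia.
  rewrite mulrCA -catA -h3 //; last by rewrite !size_cat; lia.
  rewrite mulr_sumr; apply: eq_bigr => k _.
  rewrite -[k :: _ :: b1 ++ _]/([:: k; tau k] ++ (b1 ++ _)) !catA.
  rewrite ev_ins; last by rewrite !size_cat /=; lia.
  by rewrite -!catA mulrCA.
(* Cap and cup share one strand: the zigzag straightens because signs square to 1. *)
have [e1 _|ne1 h1] := eqVneq (size D1) i.+1.
  exists 1, (D1 ++ D2); split => //; first by rewrite !size_cat /=; lia.
  move=> f a [|y b] ha hb; first by move: hb => /=; lia.
  under eq_bigr => k _.
    rewrite -[k :: _]/([:: k] ++ _) catA ev_ins; last by rewrite size_cat /= ha; lia.
    rewrite /cup tauK -catA /=.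
    rewrite (_ : _ * _ = if k == y then sgn k * (sgn y * ev (D1 ++ D2) [::] (a ++ k :: b)) else 0).
      over.
    by rewrite eq_sym; case: eqP => //; rewrite mul0r mulr0.
  by rewrite sum_delta mulrA sgn_sqr.
(* Cap and cup share both strands and close up to a loop. *)
have [ei|ne2] := eqVneq (size D1) i.
  exists (- 2%:R), (D1 ++ D2); split => //; first by rewrite !size_cat /=; lia.
  move=> f a b ha hb; rewrite -(tl_loop f) mulr_suml; apply: eq_bigr => k _.
  by rewrite ev_ins ?ha // /cup eqxx mulrA.
have [ei|ne3] := eqVneq (size D1).+1 i.
  exists 1, (D1 ++ D2); split => //; first by rewrite !size_cat /=; lia.
  move=> f a b ha hb; case/lastP: a ha => [|a x]; first by rewrite -ei.
  rewrite size_rcons => ha.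
  under eq_bigr => k _.
    rewrite cat_rcons ev_ins; last by move: ha ei; lia.
    rewrite /cup.
    rewrite (_ : _ * _ = if k == tau x then sgn k * (sgn k * ev (D1 ++ D2) [::] (a ++ tau k :: b)) else 0).
      over.
    by case: eqP => //; rewrite mul0r mulr0.
  by rewrite sum_delta mulrA sgn_sqr tauK cat_rcons.
(* The cap lies to the right of the cup, so its position drops by 2 once the cup is removed. *)
have [|z [D' [h2 h3 h4]]] := IH (i - 2)%N; rewrite ?size_cat; try lia.
rewrite size_cat in h3.
have h5 : size (take (size D1) D') = size D1 by rewrite size_take; case: ltnP; lia.
exists z, (take (size D1) D' ++ true :: false :: drop (size D1) D').
split; first by rewrite dyck_ins cat_take_drop.
  by rewrite size_cat /= h5 size_drop; lia.
move=> f a b ha hb.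
have [|a1 [x [y [a2 [ea ha1]]]]] := @split_pair _ a (size D1); first lia.
have ea' := congr1 size ea; rewrite size_cat /= in ea'.
subst a; rewrite -catA ev_ins ?cat_take_drop; last by rewrite ha1.
rewrite mulrCA catA -h4; [|by rewrite size_cat; lia|by rewrite size_cat; lia].
rewrite mulr_sumr; apply: eq_bigr => k _.
by rewrite -!catA ev_ins // mulrCA.
Qed.

Definition dycks n : seq (seq bool) := [seq D <- words bool n | dyck 0 D].

Lemma mem_dycks n D : (D \in dycks n) = dyck 0 D && (size D == n).
Proof. by rewrite mem_filter mem_words. Qed.

Lemma dycks_uniq n : uniq (dycks n).
Proof. by rewrite filter_uniq // words_uniq. Qed.

(** Each innermost cup of the dual diagram acts on the other one as a cap, so [cap_ev] consumes both
    diagrams and leaves a scalar that no form enters. *)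
Lemma gram_uniform n D D' : D \in dycks n -> D' \in dycks n ->
  exists z : K, forall f,
    \sum_(w <- words f n) ev (f := dual f) D [::] w * ev D' [::] w = z.
Proof.
rewrite !mem_dycks => /andP[hD /eqP <-{n}].
elim/dyck_ind: D / hD D' => [|D1 D2 hD IH] D'.
  case: D' => [|b D' /andP[_ /eqP]] // _.
  by exists 1 => f; rewrite big_words0 /= mulr1.
case/andP => hD' /eqP; rewrite size_cat /= => hs.
have [|z1 [D'' [h1 h2 h3]]] := @cap_ev D' (size D1) hD'; first by rewrite hs; lia.
have [|z2 hz2] := IH D''; first by rewrite h1 size_cat /=; apply/eqP; lia.
exists (z1 * z2) => f; rewrite -(hz2 f) size_cat !big_words_cat mulr_sumr.
apply: eq_big_words => a ha; rewrite mulr_sumr.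
rewrite big_wordsS; under eq_bigr => i _ do rewrite big_wordsS.
under eq_bigr => i _ do rewrite exchange_big /=.
rewrite exchange_big /=; apply: eq_big_words => b hb.
rewrite mulrCA -h3 //; last by lia.
rewrite mulr_sumr; apply: eq_bigr => i _.
rewrite (bigD1 (tau i)) //= big1 ?addr0 => [|j /negPf hj].
  by rewrite ev_ins ?ha // cup_dual eqxx mulrAC mulrC mulrA [_ * sgn i]mulrC.
by rewrite ev_ins ?ha // cup_dual hj !mul0r.
Qed.

End TLForm.

(** * Maps compatible with the defining relations, and the invariance of diagrams *)

Section Naturality.
Variable K : fieldType.
Implicit Types f : tlForm K.

(* Words in pairs (i, j) stand for monomials in the matrix coefficients of the
   comodule with basis [f]; a map on words is natural when its linear extension
   to the free algebra kills the defining relations of the Hopf algebra of the form. *)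
Definition natural f (U : lmodType K) (x : seq (f * f) -> U) : Prop :=
  (forall p q i j, \sum_k sgn (tau k) *: x (p ++ (i, k) :: (j, tau k) :: q) =
     cup i j *: x (p ++ q)) /\
  (forall p q i j, \sum_k sgn k *: x (p ++ (k, i) :: (tau k, j) :: q) =
     cup (f := dual f) i j *: x (p ++ q)).

Definition wtr f (w : seq (f * f)) : seq (dual f * dual f) :=
  [seq (p.2, p.1) | p <- w].

Lemma wtrK f (w : seq (f * f)) : wtr (wtr w : seq (f * f)) = w.
Proof. by rewrite /wtr -map_comp map_id_in // => -[]. Qed.

(** Transposing the letters exchanges the cup relations with the cap relations, so a statement about
    one family yields the other by duality. *)
Lemma natural_dual f (U : lmodType K) (x : seq (f * f) -> U) :
  natural x -> natural (f := dual f) (fun w => x (wtr (f := dual f) w)).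
Proof.
case=> h1 h2; split=> p q i j.
  rewrite /wtr map_cat -h2; apply: eq_bigr => k _ /=.
  by rewrite tauK !map_cat.
rewrite /wtr map_cat cup_dual_dual -h1; apply: eq_bigr => k _ /=.
by rewrite map_cat.
Qed.

Lemma natural_slice f (U : lmodType K) (x : seq (f * f) -> U) a b :
  natural x -> natural (fun w => x (a ++ w ++ b)).
Proof.
have e u v : a ++ (u ++ v) ++ b = (a ++ u) ++ (v ++ b) by rewrite !catA.
case=> h1 h2; split=> p q i j; rewrite e.
  by rewrite -h1; apply: eq_bigr => k _; rewrite e.
by rewrite -h2; apply: eq_bigr => k _; rewrite e.
Qed.

Lemma big_words_ins f (U : lmodType K) D1 D2 n (G : seq f -> U) :
  n = size (D1 ++ true :: false :: D2) ->
  \sum_(w <- words f n) ev (D1 ++ true :: false :: D2) [::] w *: G w =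
  \sum_(a <- words f (size D1)) \sum_(b <- words f (size D2))
     ev (D1 ++ D2) [::] (a ++ b) *:
       \sum_k sgn (tau k) *: G (a ++ k :: tau k :: b).
Proof.
move=> ->; rewrite size_cat big_words_cat /=; apply: eq_big_words => a ha.
rewrite big_wordsS; under [LHS]eq_bigr => i _ do rewrite big_wordsS exchange_big /=.
rewrite exchange_big /=; apply: eq_big_words => b hb.
rewrite scaler_sumr; apply: eq_bigr => k _.
rewrite (bigD1 (tau k)) //= big1 ?addr0 => [|j /negPf hj].
  by rewrite ev_ins // /cup eqxx scalerA mulrC.
by rewrite ev_ins // /cup hj mul0r scale0r.
Qed.

(** The relations say that a single cup is invariant, and diagrams arise by inserting cups. With the
    class of a monomial as [x], this is the invariance of the vector of [D] under the coaction. *)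
Lemma ev_inv f (U : lmodType K) (x : seq (f * f) -> U) D p q w :
  natural x -> dyck 0 D -> size w = size D ->
  \sum_(v <- words f (size D)) ev D [::] v *: x (p ++ zip w v ++ q) =
  ev D [::] w *: x (p ++ q).
Proof.
move=> hx hD; elim/dyck_ind: D / hD p q w => [|D1 D2 hD IH] p q w.
  by move/size0nil ->; rewrite big_words0.
move=> hw; have [|a [i [j [b [ew ha]]]]] := @split_pair _ w (size D1).
  by rewrite hw size_cat /=; lia.
have hb : size b = size D2 by move: hw; rewrite ew !size_cat /=; lia.
rewrite ew ev_ins // -scalerA -(IH p q (a ++ b)); last by rewrite !size_cat ha hb.
rewrite (big_words_ins _ (erefl _)) size_cat big_words_cat scaler_sumr.
apply: eq_big_words => a' ha'; rewrite scaler_sumr; apply: eq_big_words => b' hb'.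
rewrite [in RHS]scalerA [in RHS]mulrC -[in RHS]scalerA; congr (_ *: _).
rewrite zip_cat ?ha ?ha' // -[in RHS]catA catA -hx.1; apply: eq_bigr => k _.
by rewrite zip_cat ?ha ?ha' //= -!catA.
Qed.

End Naturality.

(** * The Haar functional *)

Section Haar.
Variable K : fieldType.
Implicit Types f : tlForm K.

Lemma ev_coinv f (U : lmodType K) (x : seq (f * f) -> U) D p q v :
  natural x -> dyck 0 D -> size v = size D ->
  \sum_(w <- words f (size D)) ev (f := dual f) D [::] w *: x (p ++ zip w v ++ q) =
  ev (f := dual f) D [::] v *: x (p ++ q).
Proof.
move=> hx hD hv.
have zipC (s t : seq f) : zip t s = wtr (zip s t).
  by elim: s t => [|a s IH] [|b t] //=; rewrite IH.
have := @ev_inv K (dual f) U _ D (wtr p) (wtr q) v (natural_dual hx) hD hv.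
rewrite /wtr map_cat -/(wtr (wtr p)) -/(wtr (wtr q)) !wtrK => <-.
apply: eq_bigr => w _; rewrite !map_cat -/(wtr (wtr p)) -/(wtr (wtr q)) !wtrK.
by rewrite zipC.
Qed.

Variable f : tlForm K.
Variables gr gi : seq bool -> seq bool -> K.
Hypothesis grP : forall n D D', D \in dycks n -> D' \in dycks n ->
  \sum_(w <- words f n) ev (f := dual f) D [::] w * ev D' [::] w = gr D D'.
Hypothesis gil : forall n D D', D \in dycks n -> D' \in dycks n ->
  \sum_(E <- dycks n) gi D E * gr E D' = (D == D')%:R.
Hypothesis gir : forall n D D', D \in dycks n -> D' \in dycks n ->
  \sum_(E <- dycks n) gr D E * gi E D' = (D == D')%:R.

(** Entry [(w, v)] of the projection; [gi] is the inverse Gram matrix. [haar] takes this entry as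
    its value on the monomial in the a_ij whose first indices form [w] and whose second indices form
    [v]. *)
Definition tlproj n (w v : seq f) : K :=
  \sum_(D <- dycks n) \sum_(D' <- dycks n)
    ev D [::] w * gi D D' * ev (f := dual f) D' [::] v.

Definition haar (w : seq (f * f)) : K :=
  tlproj (size w) (unzip1 w) (unzip2 w).

Lemma big_dycks_delta n (G : seq bool -> K) D : D \in dycks n ->
  \sum_(E <- dycks n) (D == E)%:R * G E = G D.
Proof.
move=> hD; rewrite (big_rem D) //= eqxx mul1r big1_seq ?addr0 // => E /andP[_].
by rewrite mem_rem_uniq ?dycks_uniq // inE eq_sym => /andP[/negPf -> _]; rewrite mul0r.
Qed.

Lemma tlproj_dual n D v : D \in dycks n ->
  \sum_(w <- words f n) ev (f := dual f) D [::] w * tlproj n w v =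
  ev (f := dual f) D [::] v.
Proof.
move=> hD; under eq_bigr => w _ do rewrite mulr_sumr.
rewrite exchange_big /=.
rewrite -[RHS](big_dycks_delta (fun E => ev (f := dual f) E [::] v) hD).
under eq_bigr => w _ do under eq_bigr => E _ do rewrite mulr_sumr.
under eq_bigr => E _ do rewrite exchange_big /=.
rewrite exchange_big /=; apply: eq_big_seq => D' hD'.
rewrite -(gir hD hD') mulr_suml; apply: eq_big_seq => E hE.
by rewrite -(grP hD hE) mulr_suml mulr_suml; apply: eq_bigr => w _; rewrite !mulrA.
Qed.

Lemma tlproj_span n (c : seq bool -> K) w :
  \sum_(v <- words f n) tlproj n w v * \sum_(D <- dycks n) c D * ev D [::] v =
  \sum_(D <- dycks n) c D * ev D [::] w.
Proof.
under eq_bigr => v _ do rewrite mulr_sumr.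
rewrite exchange_big /=; apply: eq_big_seq => D hD.
under eq_bigr => v _ do rewrite mulrCA.
rewrite -mulr_sumr; congr (_ * _).
under eq_bigr => v _ do rewrite mulr_suml.
rewrite exchange_big /= -[RHS](big_dycks_delta (fun E => ev E [::] w) hD).
apply: eq_big_seq => E hE.
under eq_bigr => v _ do rewrite mulr_suml.
rewrite exchange_big /= eq_sym -(gil hE hD) mulr_suml; apply: eq_big_seq => E' hE'.
by rewrite -(grP hE' hD) mulr_sumr mulr_suml; apply: eq_bigr => v _; ring.
Qed.

(** With P_n the projection in degree n, this is P_(n+2) o ins = ins o P_n, where ins inserts a cup
    at place [m]. The vector ins (P_n x) lies in the span of diagrams, so P_(n+2) fixes it; and it
    has the same pairings with dual diagrams as ins x, hence the same image under P_(n+2). *)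
Lemma haar_cup p q i j :
  \sum_k sgn (tau k) * haar (p ++ (i, k) :: (j, tau k) :: q) =
  cup i j * haar (p ++ q).
Proof.
set m := size p; set n := (m + size q)%N.
set a' := unzip2 p; set b' := unzip2 q.
have sa' : size a' = m by rewrite size_map.
have sb' : size b' = size q by rewrite size_map.
pose ins D0 := take m D0 ++ true :: false :: drop m D0.
pose c D0 := \sum_(D' <- dycks n) gi D0 D' * ev (f := dual f) D' [::] (a' ++ b').
(* The cup inserted into the projection of the basis vector [a' ++ b'], whose coefficients are
   [c]. *)
pose V (w : seq f) := \sum_(D0 <- dycks n) c D0 * ev (ins D0) [::] w.
have insD D0 : D0 \in dycks n -> ins D0 \in dycks n.+2.
  rewrite !mem_dycks dyck_ins cat_take_drop => /andP[-> /eqP h] /=.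
  by rewrite !size_cat /= addnS addnS -size_cat cat_take_drop h.
have [c' hc'] : exists c', forall w, V w = \sum_(D <- dycks n.+2) c' D * ev D [::] w.
  exists (fun D => \sum_(D0 <- dycks n) (D == ins D0)%:R * c D0) => w.
  rewrite /V; under [RHS]eq_bigr => D _ do rewrite mulr_suml.
  rewrite exchange_big /=; apply: eq_big_seq => D0 hD0.
  rewrite -[LHS](big_dycks_delta (fun D => c D0 * ev D [::] w) (insD _ hD0)).
  by apply: eq_bigr => D _; rewrite eq_sym mulrA.
have sV w : size w = n.+2 -> V w = \sum_k sgn (tau k) * tlproj n.+2 w (a' ++ k :: tau k :: b').
  move=> hw; rewrite hc' -tlproj_span.
  under eq_bigr => v _ do rewrite -hc' mulr_suml.
  rewrite exchange_big /=.
  under [RHS]eq_bigr => k _ do rewrite mulr_sumr.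
  rewrite [RHS]exchange_big /=; apply: eq_big_seq => D hD.
  under eq_bigr => v _ do rewrite mulr_suml.
  rewrite exchange_big /=.
  under [RHS]eq_bigr => k _ do rewrite mulr_sumr.
  rewrite [RHS]exchange_big /=; apply: eq_big_seq => D' hD'.
  transitivity (ev D [::] w * gi D D' * \sum_(v <- words f n.+2)
     ev (f := dual f) D' [::] v * V v).
    by rewrite mulr_sumr; apply: eq_bigr => v _; rewrite !mulrA.
  transitivity (ev D [::] w * gi D D' * \sum_k sgn (tau k) *
     ev (f := dual f) D' [::] (a' ++ k :: tau k :: b')); last first.
    by rewrite mulr_sumr; apply: eq_bigr => k _; ring.
  congr (_ * _); move: (hD'); rewrite mem_dycks => /andP[dD' /eqP sD'].
  (* A dual diagram meets the inserted cup as a cap would: what remains is a multiple of a shorter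
     dual diagram, and that does not see the projection. *)
  have [|z [D'' [h1 h2 h3]]] := @cap_ev K D' m dD'; first by rewrite sD'; lia.
  rewrite sD' in h2; rewrite (h3 (dual f) a' b') //; last by rewrite sD' sb'; lia.
  have hD'' : D'' \in dycks n by rewrite mem_dycks h1 -eqSS -eqSS h2 eqxx.
  rewrite -(tlproj_dual (a' ++ b') hD'') /V.
  under eq_bigr => v _ do rewrite mulr_sumr.
  rewrite exchange_big /= mulr_sumr.
  under [RHS]eq_bigr => v _ do rewrite !mulr_sumr.
  rewrite [RHS]exchange_big /=; apply: eq_big_seq => D0 hD0.
  move: (hD0); rewrite mem_dycks => /andP[dD0 /eqP sD0].
  have hm : (m <= size D0)%N by rewrite sD0; lia.
  have ht : size (take m D0) = m by rewrite size_takel.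
  have hdr : size (drop m D0) = size q by rewrite size_drop sD0; lia.
  transitivity (c D0 * \sum_(v <- words f n.+2) ev (ins D0) [::] v *:
      (ev (f := dual f) D' [::] v : K^o)).
    by rewrite mulr_sumr; apply: eq_bigr => v _; rewrite mulrCA [X in _ * X]mulrC.
  rewrite (big_words_ins (U := K^o)); last first.
    by rewrite size_cat /= ht hdr; lia.
  rewrite cat_take_drop ht hdr {1}/n big_words_cat mulr_sumr.
  apply: eq_big_words => a ha; rewrite mulr_sumr; apply: eq_big_words => b hb.
  rewrite -[\sum_k _]/(\sum_k sgn (f := dual f) k * ev (f := dual f) D' [::] (a ++ k :: tau k :: b)).
  rewrite (h3 (dual f) a b) //; last by rewrite sD' hb; lia.
  rewrite -[_ *: _]/(_ * _) /c mulr_suml !mulr_sumr.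
  by apply: eq_bigr => E' _; ring.
have -> : haar (p ++ q) = \sum_(D0 <- dycks n) c D0 * ev D0 [::] (unzip1 p ++ unzip1 q).
  rewrite /haar /tlproj size_cat -/m -/n; apply: eq_bigr => D _.
  rewrite /c mulr_suml; apply: eq_bigr => D' _.
  by rewrite /unzip1 /unzip2 !map_cat -/(unzip1 _); ring.
transitivity (V (unzip1 p ++ i :: j :: unzip1 q)).
  rewrite sV; last by rewrite size_cat /= !size_map; lia.
  apply: eq_bigr => k _; rewrite /haar size_cat /= !addnS.
  by rewrite /unzip1 /unzip2 !map_cat.
rewrite /V mulr_sumr; apply: eq_big_seq => D0 hD0.
rewrite mulrCA; congr (_ * _).
move: hD0; rewrite mem_dycks => /andP[_ /eqP sD0].
rewrite /ins ev_ins ?cat_take_drop // size_map size_takel // sD0; exact: leq_addr.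
Qed.

End Haar.

Section HaarNatural.
Variables (K : fieldType) (f : tlForm K).
Variables gr gi : seq bool -> seq bool -> K.
Hypothesis grP : forall n D D', D \in dycks n -> D' \in dycks n ->
  \sum_(w <- words f n) ev (f := dual f) D [::] w * ev D' [::] w = gr D D'.
Hypothesis gil : forall n D D', D \in dycks n -> D' \in dycks n ->
  \sum_(E <- dycks n) gi D E * gr E D' = (D == D')%:R.
Hypothesis gir : forall n D D', D \in dycks n -> D' \in dycks n ->
  \sum_(E <- dycks n) gr D E * gi E D' = (D == D')%:R.

(** This derives the cap relations for [haar] from the cup relations of the dual form. *)
Lemma haar_tr (w : seq (f * f)) :
  haar (f := dual f) (fun D D' => gi D' D) (wtr w) = haar gi w.
Proof.
rewrite /haar /tlproj /wtr size_map /unzip1 /unzip2 -!map_comp exchange_big /=.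
by apply: eq_bigr => D _; apply: eq_bigr => D' _; rewrite ev_dual_dual; ring.
Qed.

Lemma haar_natural : natural (f := f) (U := K^o) (haar (f := f) gi).
Proof.
split=> p q i j; first exact: (haar_cup grP gil gir).
rewrite -[RHS]/(_ * _) -haar_tr /wtr map_cat -(@haar_cup K (dual f) (fun D D' => gr D' D)).
- by apply: eq_bigr => k _; rewrite /= tauK -haar_tr /wtr map_cat.
- move=> n D D' hD hD'; rewrite -(grP hD' hD); apply: eq_bigr => w _.
  by rewrite ev_dual_dual mulrC.
- move=> n D D' hD hD'; rewrite eq_sym -(gir hD' hD); apply: eq_bigr => w _.
  by rewrite mulrC.
- move=> n D D' hD hD'; rewrite eq_sym -(gil hD' hD); apply: eq_bigr => w _.
  by rewrite mulrC.
Qed.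

End HaarNatural.

(** * The symplectic plane: independence of diagrams and inversion of the Gram matrix *)

Section Plane.
Variable K : numClosedFieldType.

Definition plane_sgn (b : bool) : K := (-1) ^+ b.

Lemma plane_sgn_sqr b : plane_sgn b * plane_sgn b = 1.
Proof. by rewrite -expr2 sqrr_sign. Qed.

Lemma plane_loop : \sum_b plane_sgn b * plane_sgn (~~ b) = - 2%:R.
Proof. by rewrite big_bool /plane_sgn /= !expr0 !expr1 mulr1 mul1r mulr2n opprD. Qed.

Definition plane : tlForm K :=
  TLForm (tl_idx := bool) negbK plane_sgn_sqr plane_loop.

(** Transposing an antisymmetric form costs one sign per cup, and the closings count the cups. *)
Lemma ev_plane_dual D (st w : seq bool) :
  ev (f := dual plane) D st w = (-1) ^+ count negb D * ev (f := plane) D st w.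
Proof.
elim: D st w => [|b D IH] st [|u w]; rewrite ?mulr0 ?expr0 ?mul1r //=.
  by case: b; rewrite mulr0.
case: b; rewrite /= ?add0n ?IH //; case: st => [|v st]; rewrite ?mulr0 // IH.
rewrite add1n exprS /cup /= /plane_sgn; case: u => /=; case: eqP => _; ring.
Qed.

Lemma ev_plane_conj D (st w : seq bool) :
  (ev (f := plane) D st w)^* = ev (f := plane) D st w.
Proof.
elim: D st w => [|b D IH] st [|u w] /=; rewrite ?conjC0 //; first exact: conjC_nat.
by case: b; rewrite conjC0.
case: b => //; case: st => [|v st]; rewrite ?conjC0 // rmorphM /= IH; congr (_ * _).
by rewrite /cup; case: ifP; rewrite ?conjC0 //= /plane_sgn rmorphXn rmorphN1.
Qed.

Fixpoint binary (w : seq bool) : nat :=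
  if w is b :: w' then (b * 2 ^ size w' + binary w')%N else 0%N.

Lemma binary_lt w : (binary w < 2 ^ size w)%N.
Proof. by elim: w => //= b w IH; rewrite expnS; case: b; lia. Qed.

Lemma ev_size (f : tlForm K) D (st w : seq f) :
  ev D st w != 0 -> size w = size D.
Proof.
elim: D st w => [|b D IH] st [|u w]; rewrite /= ?eqxx //.
  by case: b; rewrite eqxx.
case: b => [/IH -> //|]; case: st => [|v st]; first by rewrite eqxx.
by rewrite mulf_eq0 negb_or => /andP[_ /IH ->].
Qed.

(* Along the prefix where [w] agrees with [D] the stack only contains [true], and the
   first disagreement must be at an opening. *)
Lemma ev_plane_lex h D (w : seq bool) :
  ev (f := plane) D (nseq h true) w != 0 -> w = D \/ (binary w < binary D)%N.
Proof.
elim: D h w => [|b D IH] h [|u w]; rewrite /= ?eqxx //; first by left.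
  by case: b; rewrite eqxx.
case: b.
  move=> nz; have hs := ev_size nz; case: u nz => nz.
    by case: (IH h.+1 w nz) => [->|lt]; [left|right; rewrite hs; lia].
  by right; have := binary_lt w; rewrite hs; lia.
case: h => [|h] /=; first by rewrite eqxx.
rewrite mulf_eq0 negb_or /cup; case: u => /=; first by rewrite eqxx.
by case/andP => _ /IH[->|]; [left|right].
Qed.

Lemma ev_plane_diag h D : dyck h D -> ev (f := plane) D (nseq h true) D != 0.
Proof.
elim: D h => [|[] D IH] h /=; first by move/eqP->; rewrite eqxx oner_eq0.
  by move/(IH h.+1).
case: h => // h /= /IH hD; rewrite mulf_neq0 // /cup /=.
by rewrite /plane_sgn expr0 oner_eq0.
Qed.

(** Triangularity, by downward induction on [binary D]: at the word [D] itself only [D] and diagrams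
    of larger binary value can be nonzero, and the coefficients of the latter already vanish. *)
Lemma ev_plane_free n (c : seq bool -> K) :
  (forall w, size w = n -> \sum_(D <- dycks n) c D * ev (f := plane) D [::] w = 0) ->
  forall D, D \in dycks n -> c D = 0.
Proof.
move=> h D; have [m hm] := ubnP (2 ^ n - binary D)%N.
elim: m D hm => // m IH D hm hD.
have sD : size D = n by move: hD; rewrite mem_dycks => /andP[_ /eqP].
have := h D sD; rewrite (big_rem D) //= big1_seq ?addr0 => [|E /andP[_]].
  move/eqP; rewrite mulf_eq0 => /orP[/eqP //|].
  rewrite (negPf (@ev_plane_diag 0 D _)) //.
  by move: hD; rewrite mem_dycks => /andP[].
rewrite mem_rem_uniq ?dycks_uniq // inE => /andP[hE hE'].
have [->|/eqP nz] := eqVneq (ev (f := plane) E [::] D) 0; first by rewrite mulr0.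
move/eqP: nz => /(@ev_plane_lex 0)[e|lt]; first by rewrite e eqxx in hE.
rewrite IH ?mul0r //; have := binary_lt D; rewrite sD; lia.
Qed.

Definition tlgram (D D' : seq bool) : K :=
  \sum_(w <- words bool (size D)) ev (f := dual plane) D [::] w * ev (f := plane) D' [::] w.

Lemma tlgramE (f : tlForm K) n D D' : D \in dycks n -> D' \in dycks n ->
  \sum_(w <- words f n) ev (f := dual f) D [::] w * ev D' [::] w = tlgram D D'.
Proof.
move=> hD hD'; have [z hz] := gram_uniform K hD hD'.
move: (hD); rewrite mem_dycks => /andP[_ /eqP sD].
by rewrite hz -(hz plane) /tlgram sD.
Qed.

(** Up to signs of rows, this is the Gram matrix of the real vectors of the diagrams for the
    Hermitian inner product. A kernel vector gives a combination [u] of norm zero, and the diagrams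
    are independent. *)
Lemma tlgram_nondeg n (c : seq bool -> K) :
  (forall D, D \in dycks n -> \sum_(D' <- dycks n) tlgram D D' * c D' = 0) ->
  forall D, D \in dycks n -> c D = 0.
Proof.
move=> h; pose u w := \sum_(D <- dycks n) c D * ev (f := plane) D [::] w.
have hu D : D \in dycks n -> \sum_(w <- words bool n) ev (f := plane) D [::] w * u w = 0.
  move=> hD; have := h D hD; under eq_big_seq => D' hD'.
    rewrite -(tlgramE plane hD hD') mulr_suml.
    under eq_bigr => w _ do rewrite ev_plane_dual -!mulrA.
    rewrite -mulr_sumr; over.
  rewrite -mulr_sumr => /eqP; rewrite mulf_eq0 signr_eq0 /= => /eqP e.
  rewrite -[RHS]e exchange_big /=; apply: eq_bigr => w _.
  rewrite /u mulr_sumr; apply: eq_bigr => D' _.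
  by rewrite [c D' * _]mulrC.
apply: ev_plane_free => w hw.
(* [u] is orthogonal to every diagram, hence to itself. *)
have : \sum_(w <- words bool n) (u w)^* * u w = 0.
  rewrite {1}/u; under eq_bigr => v _ do rewrite rmorph_sum mulr_suml.
  rewrite exchange_big big1_seq //= => D hD.
  under eq_bigr => v _ do rewrite rmorphM /= ev_plane_conj -mulrA.
  by rewrite -mulr_sumr hu // mulr0.
move/eqP; rewrite psumr_eq0 => [|v _]; last by rewrite mulrC mul_conjC_ge0.
move/allP => /(_ w); rewrite mem_words hw eqxx => /(_ isT) /=.
by rewrite mulf_eq0 conjC_eq0 orbb => /eqP.
Qed.

Lemma kernel_inverse (T : eqType) (s : seq T) (G : T -> T -> K) : uniq s ->
  (forall c : T -> K, (forall x, x \in s -> \sum_(y <- s) G x y * c y = 0) ->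
     forall x, x \in s -> c x = 0) ->
  exists H : T -> T -> K,
    (forall x y, x \in s -> y \in s -> \sum_(z <- s) H x z * G z y = (x == y)%:R) /\
    (forall x y, x \in s -> y \in s -> \sum_(z <- s) G x z * H z y = (x == y)%:R).
Proof.
case: s => [_ _|x0 s0]; first by exists (fun _ _ => 0).
set s := x0 :: s0 => us nd; set n := size s.
pose M := \matrix_(i < n, j < n) G (nth x0 s i) (nth x0 s j).
have uM : M \in unitmx.
  rewrite -unitmx_tr -row_free_unit; apply: inj_row_free => v hv.
  have idx (x : T) : x \in s -> (index x s < n)%N by rewrite index_mem.
  pose c x := v 0 (inord (index x s)).
  have hc : forall x, x \in s -> c x = 0.
    apply: nd => x hx.
    have := congr1 (fun A : 'rV_n => A 0 (Ordinal (idx x hx))) hv.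
    rewrite !mxE => e; rewrite -[RHS]e (big_nth x0) big_mkord.
    apply: eq_bigr => j _; rewrite !mxE /= nth_index // mulrC; congr (_ * _).
    by rewrite /c index_uniq //; congr (v 0 _); apply: val_inj; rewrite /= inordK.
  apply/rowP => j; rewrite !mxE -(hc (nth x0 s j)) ?mem_nth //.
  by rewrite /c index_uniq //; congr (v 0 _); apply: val_inj; rewrite /= inordK.
pose ix x : 'I_n := inord (index x s).
exists (fun x y => invmx M (ix x) (ix y)).
have hs x : x \in s -> nth x0 s (ix x) = x.
  by move=> hx; rewrite /ix inordK ?index_mem // nth_index.
have ixn (i : 'I_n) : ix (nth x0 s i) = i.
  by rewrite /ix index_uniq // inord_val.
have ixeq x y : x \in s -> y \in s -> (ix x == ix y) = (x == y).
  move=> hx hy; apply/eqP/eqP => [e|-> //].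
  by rewrite -(hs x) // e hs.
split=> x y hx hy.
  have := congr1 (fun A : 'M[K]_n => A (ix x) (ix y)) (mulVmx uM).
  rewrite !mxE ixeq // => <-; rewrite (big_nth x0) big_mkord; apply: eq_bigr => i _.
  by rewrite ixn mxE hs.
have := congr1 (fun A : 'M[K]_n => A (ix x) (ix y)) (mulmxV uM).
rewrite !mxE ixeq // => <-; rewrite (big_nth x0) big_mkord; apply: eq_bigr => i _.
by rewrite ixn mxE hs.
Qed.

Lemma tlgram_inverse : exists gi : seq bool -> seq bool -> K,
  (forall n D D', D \in dycks n -> D' \in dycks n ->
     \sum_(E <- dycks n) gi D E * tlgram E D' = (D == D')%:R) /\
  (forall n D D', D \in dycks n -> D' \in dycks n ->
     \sum_(E <- dycks n) tlgram D E * gi E D' = (D == D')%:R).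
Proof.
have /choice[g hg] : forall n, exists g : seq bool -> seq bool -> K,
    (forall D D', D \in dycks n -> D' \in dycks n ->
     \sum_(E <- dycks n) g D E * tlgram E D' = (D == D')%:R) /\
    (forall D D', D \in dycks n -> D' \in dycks n ->
     \sum_(E <- dycks n) tlgram D E * g E D' = (D == D')%:R).
  by move=> n; apply: (kernel_inverse (dycks_uniq n)); exact: tlgram_nondeg.
exists (fun D D' => g (size D) D D').
split=> n D D' hD hD'; have [h1 h2] := hg n.
  rewrite -(h1 _ _ hD hD'); apply: eq_bigr => E _.
  by move: hD; rewrite mem_dycks => /andP[_ /eqP ->].
rewrite -(h2 _ _ hD hD'); apply: eq_big_seq => E.
by rewrite mem_dycks => /andP[_ /eqP ->].
Qed.

End Plane.

(** * Endomorphisms of tensor powers *)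

Section Kernels.
Variable K : fieldType.
Implicit Types (f : tlForm K) (D E : seq bool).

(** Bending a bundle of strands reverses their order and applies [tau] to each letter; [sgnw] is the
    sign this costs. *)
Definition taurev f (w : seq f) : seq f := rev (map tau w).
Definition sgnw f (w : seq f) : K := \prod_(i <- w) sgn i.

Lemma taurevK f : involutive (@taurev f).
Proof.
move=> w; rewrite /taurev map_rev revK -map_comp map_id_in // => i _ /=.
exact: tauK.
Qed.

Lemma size_taurev f (w : seq f) : size (taurev w) = size w.
Proof. by rewrite size_rev size_map. Qed.

Lemma sgnw_sqr f (w : seq f) : sgnw w * sgnw w = 1.
Proof.
by rewrite -big_split big1 //= => i _; rewrite sgn_sqr.
Qed.

Lemma sgnw_taurev f (w : seq f) : sgnw (taurev w) = \prod_(i <- w) sgn (tau i).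
Proof. by rewrite /sgnw /taurev (perm_big _ (permEl (perm_rev _))) big_map. Qed.

Definition nest n := nseq n true ++ nseq n false.

Lemma size_nest n : size (nest n) = (n + n)%N.
Proof. by rewrite size_cat !size_nseq. Qed.

Lemma nest_dyck n : dyck 0 (nest n).
Proof.
have h m k E : dyck k (nseq m true ++ E) = dyck (m + k) E.
  by elim: m k => //= m IH k; rewrite IH addnS.
rewrite /nest h addn0.
by elim: n.
Qed.

Lemma ev_opens f n D (st s t : seq f) : size s = n ->
  ev (nseq n true ++ D) st (s ++ t) = ev D (catrev s st) t.
Proof. by elim: n st s => [|n IH] st [|i s] //= [/IH ->]. Qed.

Lemma ev_closes f n (st t : seq f) : size st = n -> size t = n ->
  ev (nseq n false) st t = (t == map tau st)%:R * sgnw t.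
Proof.
elim: n st t => [|n IH] [|i st] [|j t] //=; first by rewrite /sgnw big_nil mulr1.
move=> [h1] [h2]; rewrite IH // eqseq_cons /cup /sgnw big_cons.
by case: eqP => _ /=; rewrite ?mul0r // mulrCA.
Qed.

Lemma ev_nest f n (s t : seq f) : size s = n -> size t = n ->
  ev (nest n) [::] (s ++ t) = (t == taurev s)%:R * sgnw t.
Proof.
move=> hs ht.
by rewrite ev_opens // catrevE cats0 ev_closes ?size_rev // map_rev.
Qed.

Lemma ev_nest_dual f n (s t : seq f) : size s = n -> size t = n ->
  ev (f := dual f) (nest n) [::] (s ++ t) = (s == taurev t)%:R * sgnw s.
Proof.
move=> hs ht; rewrite ev_nest //.
have -> : taurev (f := dual f) s = taurev s by [].
have -> : (t == taurev s) = (s == taurev t).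
  by apply/eqP/eqP => ->; rewrite taurevK.
case: eqP => [->|_]; last by rewrite !mul0r.
by rewrite !mul1r sgnw_taurev.
Qed.

Lemma sum_nest_dual f (U : lmodType K) n (G : seq f -> U) u : size u = n ->
  \sum_(t <- words f n) ev (f := dual f) (nest n) [::] (t ++ u) *: G t =
  sgnw (taurev u) *: G (taurev u).
Proof.
move=> hu; have ht : size (taurev u) = n by rewrite size_taurev.
rewrite -[RHS](@big_words_delta _ _ n (fun t => sgnw t *: G t)) //.
apply: eq_big_words => t h; rewrite ev_nest_dual //.
by case: eqP => _; rewrite ?mul1r // mul0r scale0r.
Qed.

Lemma sum_nest f (U : lmodType K) n (G : seq f -> U) t : size t = n ->
  \sum_(u <- words f n) ev (nest n) [::] (u ++ t) *: G u = sgnw t *: G (taurev t).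
Proof.
move=> hu; have ht : size (taurev t) = n by rewrite size_taurev.
rewrite -[RHS](@big_words_delta _ _ n (fun u => sgnw t *: G u)) //.
apply: eq_big_words => u h; rewrite ev_nest //.
have -> : (t == taurev u) = (u == taurev t).
  by apply/eqP/eqP => ->; rewrite taurevK.
by case: eqP => _; rewrite ?mul1r // mul0r scale0r.
Qed.

(* The endomorphism of the n-th tensor power obtained by bending down the last n
   strands of the diagram [D]. *)
Definition kf f D (s u : seq f) : K := ev D [::] (s ++ taurev u) * sgnw (taurev u).

(** A snake argument on words of length 3n. In the sum over [v], [t'], [t] and [r] of
    [x (zip s v ++ zip (t ++ r) (t' ++ u))], weighted by [D] and by the dual of [nest n], summing
    first over [v] and [t'] uses the invariance of [D] and gives the right-hand side; summing first
    over [t] and [r] uses that of the dual [nest n] and gives the left-hand side. *)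
Lemma kf_natural f (U : lmodType K) (x : seq (f * f) -> U) n D s u :
  natural x -> D \in dycks (n + n) -> size s = n -> size u = n ->
  \sum_(v <- words f n) kf D v u *: x (zip s v) =
  \sum_(v <- words f n) kf D s v *: x (zip v u).
Proof.
move=> hx; rewrite mem_dycks => /andP[dD /eqP sD] hs hu.
transitivity (\sum_(t <- words f n) \sum_(r <- words f n)
  ev (f := dual f) (nest n) [::] (t ++ r) *:
    (ev D [::] (s ++ t) *: x (zip r u))); last first.
  rewrite exchange_big /=; apply: eq_big_words => r hr.
  by rewrite sum_nest_dual // scalerA mulrC.
transitivity (\sum_(t <- words f n) \sum_(r <- words f n)
  ev (f := dual f) (nest n) [::] (t ++ r) *:
    \sum_(v <- words f n) \sum_(t' <- words f n) ev D [::] (v ++ t') *: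
      x (zip s v ++ zip (t ++ r) (t' ++ u))); last first.
  apply: eq_big_words => t ht; apply: eq_big_words => r hr; congr (_ *: _).
  have := @ev_inv K f U x D [::] (zip r u) (s ++ t) hx dD.
  rewrite size_cat hs ht sD => /(_ erefl) /= <-; rewrite big_words_cat.
  apply: eq_big_words => v hv; apply: eq_big_words => t' ht'; congr (_ *: x _).
  by rewrite !zip_cat ?hs ?ht ?hv ?ht' // catA.
under [RHS]eq_bigr => t _ do (under eq_bigr => r _ do rewrite scaler_sumr; rewrite exchange_big /=).
rewrite [RHS]exchange_big /=; apply: eq_big_words => v hv.
under [RHS]eq_bigr => t _ do (under eq_bigr => r _ do rewrite scaler_sumr; rewrite exchange_big /=).
rewrite [RHS]exchange_big /=.
transitivity (\sum_(t' <- words f n) ev (f := dual f) (nest n) [::] (t' ++ u) *: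
  (ev D [::] (v ++ t') *: x (zip s v))).
  by rewrite sum_nest_dual // scalerA mulrC.
apply: eq_big_words => t' ht'.
have := @ev_coinv K f U x (nest n) (zip s v) [::] (t' ++ u) hx (nest_dyck n).
rewrite size_nest size_cat ht' hu => /(_ erefl); rewrite big_words_cat !cats0.
rewrite scalerA mulrC -scalerA => <-; rewrite scaler_sumr; apply: eq_bigr => t _.
rewrite scaler_sumr; apply: eq_bigr => r _.
by rewrite cats0 !scalerA mulrC.
Qed.

Lemma kf_nest f n (s u : seq f) : size s = n -> size u = n ->
  kf (nest n) s u = (s == u)%:R.
Proof.
move=> hs hu; rewrite /kf ev_nest ?size_taurev // (can_eq (@taurevK f)) eq_sym.
by rewrite -mulrA sgnw_sqr mulr1.
Qed.

Lemma ev_cat f D1 D2 (st w1 w2 : seq f) : dyck (size st) D1 -> size w1 = size D1 ->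
  ev (D1 ++ D2) st (w1 ++ w2) = ev D1 st w1 * ev D2 [::] w2.
Proof.
elim: D1 st w1 => [|b D1 IH] st [|i w1] //=.
  by move/eqP/size0nil ->; rewrite eqxx mul1r.
by case: b; case: st => [|j st] //= h [hs]; rewrite IH // mulrA.
Qed.

Lemma dyck_cat h D1 D2 : dyck h D1 -> dyck h (D1 ++ D2) = dyck 0 D2.
Proof.
elim: D1 h => [|[] D1 IH] h /=; [by move/eqP->|exact: IH|].
by case/andP => -> /IH.
Qed.

(** Nested caps are applied one at a time by [cap_ev], the innermost one first, at place [i + n]. *)
Lemma cap_nest n D i : dyck 0 D -> (i + (n + n) <= size D)%N ->
  exists z D', [/\ dyck 0 D', (size D' + (n + n))%N = size D &
    forall f (a b : seq f), size a = i -> (size b + (i + (n + n)))%N = size D ->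
      \sum_(u <- words f n) sgnw (taurev u) * ev D [::] (a ++ taurev u ++ u ++ b) =
      z * ev D' [::] (a ++ b)].
Proof.
elim: n D => [|n IH] D dD hi.
  exists 1, D; split => //; first by rewrite !addn0.
  by move=> f a b _ _; rewrite big_words0 /taurev /sgnw /= big_nil.
have [|z1 [D1 [h1 h2 h3]]] := @cap_ev K D (i + n) dD; first lia.
have [|z2 [D2 [h4 h5 h6]]] := IH D1 h1; first lia.
exists (z1 * z2), D2; split => //; first lia.
move=> f a b ha hb; rewrite -mulrA -h6 //; last lia.
rewrite big_wordsS exchange_big /= mulr_sumr; apply: eq_big_words => u hu.
rewrite mulrCA [in RHS]catA -h3; last 2 first.
- by rewrite size_cat size_taurev ha hu.
- by rewrite size_cat hu; lia.
rewrite mulr_sumr [RHS](reindex_inj (inv_inj (@tauK K f))) /=.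
apply: eq_bigr => k _; rewrite tauK mulrA; congr (_ * _).
  by rewrite !sgnw_taurev big_cons mulrC.
by rewrite /taurev /= rev_cons -cats1 -!catA.
Qed.

(** The product contracts the middle 2n strands of [D1 ++ D2] by nested caps. Scalar and diagram
    precede the form: all forms share one multiplication table. *)
Lemma kf_mul n (D1 D2 : seq bool) : D1 \in dycks (n + n) -> D2 \in dycks (n + n) ->
  exists z D3, D3 \in dycks (n + n) /\
    forall f (s t : seq f), size s = n -> size t = n ->
      \sum_(u <- words f n) kf D1 s u * kf D2 u t = z * kf D3 s t.
Proof.
rewrite !mem_dycks => /andP[d1 /eqP s1] /andP[d2 /eqP s2].
have [||z [D3 [h1 h2 h3]]] := @cap_nest n (D1 ++ D2) n.
- by rewrite dyck_cat.
- by rewrite size_cat s1 s2; lia.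
exists z, D3; split.
  by rewrite mem_dycks h1 /=; apply/eqP; move: h2; rewrite size_cat s1 s2; lia.
move=> f s t hs ht; rewrite /kf mulrA -h3 //; last first.
  by rewrite ?size_cat ?size_taurev ?s1 ?s2 ?hs ?ht ?hu; lia.
rewrite mulr_suml; apply: eq_big_words => u hu.
rewrite catA ev_cat //; last by rewrite ?size_cat ?size_taurev ?s1 ?s2 ?hs ?ht ?hu; lia.
ring.
Qed.

(** Commutation with the coaction, tested by all linear functionals on the Hopf algebra; these are
    the natural maps with values in [K]. *)
Definition comm f n (g : seq f -> seq f -> K) : Prop :=
  forall x : seq (f * f) -> K^o, natural x ->
  forall s u, size s = n -> size u = n ->
  \sum_(v <- words f n) g v u * x (zip s v) = \sum_(v <- words f n) g s v * x (zip v u).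

Definition kspan f n (c : seq bool -> K) (s u : seq f) : K :=
  \sum_(D <- dycks (n + n)) c D * kf D s u.

Lemma kspan_natural f (U : lmodType K) (x : seq (f * f) -> U) n c s u :
  natural x -> size s = n -> size u = n ->
  \sum_(v <- words f n) kspan n c v u *: x (zip s v) =
  \sum_(v <- words f n) kspan n c s v *: x (zip v u).
Proof.
move=> hx hs hu; under eq_bigr => v _ do rewrite scaler_suml.
under [RHS]eq_bigr => v _ do rewrite scaler_suml.
rewrite exchange_big [RHS]exchange_big /=; apply: eq_big_seq => D hD.
under eq_bigr => v _ do rewrite -scalerA.
under [RHS]eq_bigr => v _ do rewrite -scalerA.
by rewrite -!scaler_sumr (kf_natural hx hD hs hu).
Qed.

Lemma kspan_comm f n c : comm n (kspan (f := f) n c).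
Proof. by move=> x hx s u hs hu; exact: (@kspan_natural f K^o x). Qed.

(** Bending the last n strands of [g] up gives a vector [wg] of degree 2n. It is invariant, so the
    Haar functional acts on it as its value 1 at the empty monomial; but that action is the
    projection onto the span of diagrams. *)
Lemma comm_kspan f n gr gi (g : seq f -> seq f -> K) :
  (forall n D D', D \in dycks n -> D' \in dycks n ->
    \sum_(w <- words f n) ev (f := dual f) D [::] w * ev D' [::] w = gr D D') ->
  (forall n D D', D \in dycks n -> D' \in dycks n ->
    \sum_(E <- dycks n) gi D E * gr E D' = (D == D')%:R) ->
  (forall n D D', D \in dycks n -> D' \in dycks n ->
    \sum_(E <- dycks n) gr D E * gi E D' = (D == D')%:R) ->
  comm n g ->
  exists c, forall s u, size s = n -> size u = n -> g s u = kspan n c s u.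
Proof.
move=> grP gil gir hg.
have hh := haar_natural grP gil gir.
have h0 : haar (f := f) gi [::] = 1.
  have d0 : dycks 0 = [:: [::]] by [].
  have nil0 : [::] \in dycks 0 by rewrite d0.
  have := gil _ _ _ nil0 nil0; rewrite d0 big_seq1 -(grP _ _ _ nil0 nil0) big_words0.
  by rewrite /haar /tlproj d0 !big_seq1 /= !mulr1 mul1r.
pose wg v := g (take n v) (taurev (drop n v)) * sgnw (drop n v).
have wgE s t : size s = n -> size t = n -> wg (s ++ t) = g s (taurev t) * sgnw t.
  by move=> hs ht; rewrite /wg take_size_cat ?drop_size_cat.
(* The projection fixes [wg]: [g] passes through the first n letters because it commutes with a
   slice of [haar], and then the invariance of [nest n] removes all letters. *)
have key s t : size s = n -> size t = n ->
    \sum_(v <- words f (n + n)) haar (f := f) gi (zip (s ++ t) v) * wg v = wg (s ++ t).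
  move=> hs ht; rewrite big_words_cat exchange_big /=.
  transitivity (\sum_(t' <- words f n) \sum_(s' <- words f n)
    g s s' * (haar (f := f) gi (zip s' (taurev t') ++ zip t t')) * sgnw t').
    apply: eq_big_words => t' ht'.
    have hx := @natural_slice K f K^o _ [::] (zip t t') hh.
    have := hg _ hx s (taurev t') hs; rewrite size_taurev ht' => /(_ erefl) /= e.
    rewrite -[RHS]mulr_suml -e mulr_suml; apply: eq_big_words => s' hs'.
    by rewrite wgE // zip_cat ?hs ?hs' //; ring.
  rewrite exchange_big /=.
  transitivity (\sum_(s' <- words f n) g s s' * (ev (nest n) [::] (s' ++ t) * haar (f := f) gi [::])).
    apply: eq_big_words => s' hs'.
    have := @ev_inv K f K^o _ (nest n) [::] [::] (s' ++ t) hh (nest_dyck n).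
    rewrite size_nest size_cat hs' ht => /(_ erefl) /= e.
    rewrite -[ev _ _ _ * _]/(ev _ _ _ *: (_ : K^o)) -e.
    rewrite big_words_cat exchange_big mulr_sumr /=; apply: eq_big_words => t' ht'.
    have := @sum_nest f K^o n (fun u => haar (f := f) gi (zip (s' ++ t) (u ++ t'))) t' ht'.
    under eq_bigr => u _ do rewrite cats0.
    move=> ->; rewrite zip_cat ?size_taurev ?hs' ?ht' //; rewrite -[_ *: _]/(_ * _); ring.
  rewrite h0 wgE // -(@big_words_delta _ _ n (fun s' => g s s' * sgnw t) (taurev t)) ?size_taurev //.
  apply: eq_big_words => s' hs'; rewrite mulr1 ev_nest //.
  have -> : (t == taurev s') = (s' == taurev t).
    by apply/eqP/eqP => ->; rewrite taurevK.
  by case: eqP => _; rewrite ?mul1r // mul0r mulr0.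
exists (fun D => \sum_(v <- words f (n + n)) \sum_(D' <- dycks (n + n))
  gi D D' * ev (f := dual f) D' [::] v * wg v).
move=> s u hs hu.
have -> : g s u = wg (s ++ taurev u) * sgnw (taurev u).
  by rewrite wgE ?size_taurev // taurevK -mulrA sgnw_sqr mulr1.
rewrite -key ?size_taurev // mulr_suml /kspan.
under [RHS]eq_bigr => D _ do rewrite mulr_suml.
rewrite [RHS]exchange_big /=; apply: eq_big_words => v hv.
rewrite /haar /tlproj /unzip1 /unzip2.
have sv : size (s ++ taurev u) = size v by rewrite size_cat size_taurev hs hu hv.
rewrite -/(unzip1 _) -/(unzip2 _) unzip1_zip ?unzip2_zip ?sv // size_zip sv minnn hv.
rewrite !mulr_suml; apply: eq_bigr => D _; rewrite !mulr_suml.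
by apply: eq_bigr => D' _; rewrite /kf; ring.
Qed.

End Kernels.

(** * The Hopf algebra of a form *)

Section FormHopf.
Variables (K : fieldType) (f : tlForm K).
Notation mon := (seq (f * f)).

Lemma lin_sum (U V : lmodType K) (g : U -> V) (T : Type) (r : seq T) (F : T -> U) :
  linear g -> g (\sum_(i <- r) F i) = \sum_(i <- r) g (F i).
Proof.
move=> L; pose G : {linear U -> V} := HB.pack g (GRing.isLinear.Build K U V *:%R g L).
by rewrite -[LHS]/(G _) raddf_sum.
Qed.

Lemma scaleC (V : lmodType K) (a b : K) (v : V) : a *: (b *: v) = b *: (a *: v).
Proof. by rewrite !scalerA mulrC. Qed.

Lemma naturalZ (U : lmodType K) (x : mon -> U) c :
  natural x -> natural (fun w => c *: x w).
Proof.
case=> h1 h2; split=> p q i j.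
  rewrite scaleC -h1 scaler_sumr; apply: eq_bigr => k _.
  by rewrite !scalerA mulrC.
rewrite scaleC -h2 scaler_sumr; apply: eq_bigr => k _.
by rewrite !scalerA mulrC.
Qed.

Lemma natural_sum (U : lmodType K) (T : Type) (r : seq T) (x : T -> mon -> U) :
  (forall t, natural (x t)) -> natural (fun w => \sum_(t <- r) x t w).
Proof.
move=> h; split=> p q i j; under eq_bigr => k _ do rewrite scaler_sumr.
  rewrite exchange_big scaler_sumr; apply: eq_bigr => t _; exact: (h t).1.
rewrite exchange_big scaler_sumr; apply: eq_bigr => t _; exact: (h t).2.
Qed.

Lemma natural_lin (U V : lmodType K) (x : mon -> U) (g : U -> V) :
  linear g -> natural x -> natural (fun w => g (x w)).
Proof.
move=> L [h1 h2]; have gZ c u : g (c *: u) = c *: g u by exact: (scalable_linear L).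
split=> p q i j.
  by rewrite -gZ -h1 lin_sum //; apply: eq_bigr => k _; rewrite gZ.
by rewrite -gZ -h2 lin_sum //; apply: eq_bigr => k _; rewrite gZ.
Qed.

Definition mon_eval (U : lmodType K) (x : mon -> U) (s : seq (K * mon)) : U :=
  \sum_(p <- s) p.1 *: x p.2.

(** The quotient of the free algebra by the relations, encoded by its universal property:
    combinations of monomials are identified when no natural map separates them. *)
Definition mon_eqv (s t : seq (K * mon)) : bool :=
  `[< forall (U : lmodType K) (x : mon -> U),
        natural x -> mon_eval x s = mon_eval x t >].

Lemma mon_eqv_is_equiv : equiv_class_of mon_eqv.
Proof.
split.
- by move=> s; apply/asboolP.
- by move=> s t; apply/asboolP/asboolP => h U x hx; rewrite h.
- move=> t s u /asboolP h1 /asboolP h2; apply/asboolP => U x hx.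
  by rewrite h1 // h2.
Qed.

Canonical mon_eqv_equiv := EquivRelPack mon_eqv_is_equiv.

Definition fhopf : Type := {eq_quot mon_eqv}.

HB.instance Definition _ := Choice.on fhopf.
HB.instance Definition _ := EqQuotient.on fhopf.

Definition hmon (w : mon) : fhopf := \pi_fhopf [:: (1, w)].

Definition hlift (U : lmodType K) (x : mon -> U) (h : fhopf) : U :=
  mon_eval x (repr h).

Lemma hlift_pi (U : lmodType K) (x : mon -> U) s :
  natural x -> hlift x (\pi_fhopf s) = mon_eval x s.
Proof.
move=> hx; rewrite /hlift.
have : \pi_fhopf (repr (\pi_fhopf s)) == \pi_fhopf s by rewrite reprK.
by rewrite eqmodE => /asboolP/(_ U x hx).
Qed.

Lemma fhopf_ext (a b : fhopf) :
  (forall (U : lmodType K) (x : mon -> U), natural x -> hlift x a = hlift x b) ->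
  a = b.
Proof.
move=> h; rewrite -[a]reprK -[b]reprK; apply/eqP; rewrite eqmodE.
by apply/asboolP => U x; exact: h.
Qed.

Lemma hlift_mon (U : lmodType K) (x : mon -> U) w :
  natural x -> hlift x (hmon w) = x w.
Proof. by move=> hx; rewrite hlift_pi // /mon_eval big_seq1 scale1r. Qed.

Definition hadd (a b : fhopf) : fhopf := \pi_fhopf (repr a ++ repr b).
Definition hscale (c : K) (a : fhopf) : fhopf :=
  \pi_fhopf [seq (c * p.1, p.2) | p <- repr a].
Definition hzero : fhopf := \pi_fhopf [::].
Definition hopp (a : fhopf) : fhopf := hscale (-1) a.
Definition hmul (a b : fhopf) : fhopf :=
  \pi_fhopf [seq (p.1 * q.1, p.2 ++ q.2) | p <- repr a, q <- repr b].

Section Lift.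
Variables (U : lmodType K) (x : mon -> U) (hx : natural x).

Lemma hlift_add a b : hlift x (hadd a b) = hlift x a + hlift x b.
Proof. by rewrite hlift_pi // /mon_eval big_cat. Qed.

Lemma hlift_zero : hlift x hzero = 0.
Proof. by rewrite hlift_pi // /mon_eval big_nil. Qed.

Lemma hlift_scale c a : hlift x (hscale c a) = c *: hlift x a.
Proof.
rewrite hlift_pi // /mon_eval big_map scaler_sumr.
by apply: eq_bigr => p _; rewrite scalerA.
Qed.

Lemma hlift_opp a : hlift x (hopp a) = - hlift x a.
Proof. by rewrite hlift_scale scaleN1r. Qed.

Lemma hlift_mul a b : hlift x (hmul a b) = hlift (fun w => hlift (fun v => x (w ++ v)) b) a.
Proof.
rewrite hlift_pi // /mon_eval big_allpairs_dep; apply: eq_bigr => p _.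
by rewrite scaler_sumr; apply: eq_bigr => q _; rewrite scalerA.
Qed.

Lemma natural_hlift b : natural (fun w => hlift (fun v => x (w ++ v)) b).
Proof.
by apply: natural_sum => p; apply: naturalZ; exact: (natural_slice [::] p.2 hx).
Qed.

Lemma natural_catl w : natural (fun v => x (w ++ v)).
Proof.
have := natural_slice w [::] hx.
by congr natural; apply/funext => v; rewrite cats0.
Qed.

End Lift.

Lemma haddA : associative hadd.
Proof. by move=> a b c; apply: fhopf_ext => U x h; rewrite !hlift_add // addrA. Qed.
Lemma haddC : commutative hadd.
Proof. by move=> a b; apply: fhopf_ext => U x h; rewrite !hlift_add // addrC. Qed.
Lemma hadd0 : left_id hzero hadd.
Proof.
by move=> a; apply: fhopf_ext => U x h; rewrite hlift_add // hlift_zero // add0r.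
Qed.
Lemma haddN : left_inverse hzero hopp hadd.
Proof.
move=> a; apply: fhopf_ext => U x h.
by rewrite hlift_add // hlift_zero // hlift_opp // addNr.
Qed.

HB.instance Definition _ := GRing.isZmodule.Build fhopf haddA haddC hadd0 haddN.

Lemma hscaleA a b h : hscale a (hscale b h) = hscale (a * b) h.
Proof. by apply: fhopf_ext => U x hx; rewrite !hlift_scale // scalerA. Qed.
Lemma hscale1 : left_id 1 hscale.
Proof. by move=> h; apply: fhopf_ext => U x hx; rewrite !hlift_scale // scale1r. Qed.
Lemma hscaleDr : right_distributive hscale +%R.
Proof.
move=> a h k; apply: fhopf_ext => U x hx.
by rewrite hlift_scale // !hlift_add // !hlift_scale // scalerDr.
Qed.
Lemma hscaleDl h : {morph hscale^~ h : a b / a + b}.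
Proof.
move=> a b; apply: fhopf_ext => U x hx.
by rewrite hlift_scale // hlift_add // !hlift_scale // scalerDl.
Qed.

HB.instance Definition _ := GRing.Zmodule_isLmodule.Build K fhopf
  hscaleA hscale1 hscaleDr hscaleDl.

Lemma hlift_linear (U : lmodType K) (x : mon -> U) : natural x -> linear (hlift x).
Proof. by move=> hx a h k; rewrite [LHS]hlift_add // hlift_scale. Qed.

Lemma hmulA : associative hmul.
Proof.
move=> a b c; apply: fhopf_ext => U x hx.
rewrite !hlift_mul //; last exact: natural_hlift.
apply: eq_bigr => p _; congr (_ *: _).
rewrite hlift_mul; last exact: natural_catl.
by apply: eq_bigr => q _; congr (_ *: _); apply: eq_bigr => r _; rewrite catA.
Qed.

Lemma hmul1l : left_id (hmon [::]) hmul.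
Proof.
move=> a; apply: fhopf_ext => U x hx; rewrite hlift_mul // hlift_mon //.
exact: natural_hlift.
Qed.

Lemma hmul1r : right_id (hmon [::]) hmul.
Proof.
move=> a; apply: fhopf_ext => U x hx; rewrite hlift_mul //.
apply: eq_bigr => p _; rewrite hlift_mon ?cats0 //; exact: natural_catl.
Qed.

Lemma hmulDl : left_distributive hmul +%R.
Proof.
move=> a b c; apply: fhopf_ext => U x hx; rewrite hlift_add // !hlift_mul //.
by rewrite hlift_add //; exact: natural_hlift.
Qed.

Lemma hmulDr : right_distributive hmul +%R.
Proof.
move=> a b c; apply: fhopf_ext => U x hx; rewrite hlift_add // !hlift_mul //.
rewrite /hlift /mon_eval -big_split /=; apply: eq_bigr => p _.
by rewrite -scalerDr; congr (_ *: _);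
exact: (hlift_add (natural_catl hx p.2) b c).
Qed.

Definition eps (w : mon) : K^o := \prod_(p <- w) (p.1 == p.2)%:R.

Lemma eps_cat v w : eps (v ++ w) = eps v * eps w.
Proof. by rewrite /eps big_cat. Qed.

Lemma eps_cons p w : eps (p :: w) = (p.1 == p.2)%:R * eps w.
Proof. by rewrite /eps big_cons. Qed.

Lemma eps_natural : natural eps.
Proof.
split=> p q i j; rewrite eps_cat -[RHS]/(_ * _).
  rewrite (bigD1 i) //= big1 => [|k /negPf hk]; last first.
    by rewrite !eps_cat !eps_cons /= eq_sym hk mul0r mulr0 scaler0.
  rewrite addr0 !eps_cat !eps_cons /= eqxx mul1r -[LHS]/(_ * _) /cup.
  by case: eqP => [->|_]; rewrite ?mul1r // !mul0r !mulr0.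
rewrite (bigD1 i) //= big1 => [|k /negPf hk]; last first.
  by rewrite !eps_cat !eps_cons /= hk mul0r mulr0 scaler0.
rewrite addr0 !eps_cat !eps_cons /= eqxx mul1r -[LHS]/(_ * _) cup_dual [j == _]eq_sym.
by case: eqP => [_|_]; rewrite ?mul1r // !mul0r !mulr0.
Qed.

Lemma hone_neq0 : hmon [::] != 0.
Proof.
apply/eqP => /(congr1 (hlift eps)); rewrite hlift_mon; last exact: eps_natural.
rewrite hlift_zero; last exact: eps_natural.
by rewrite /eps big_nil => /eqP; rewrite oner_eq0.
Qed.

HB.instance Definition _ := GRing.Zmodule_isNzRing.Build fhopf
  hmulA hmul1l hmul1r hmulDl hmulDr hone_neq0.

Lemma hscaleAl c (a b : fhopf) : c *: (a * b) = (c *: a) * b.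
Proof.
apply: fhopf_ext => U x hx; rewrite [LHS]hlift_scale // !hlift_mul //.
by rewrite hlift_scale //; exact: natural_hlift.
Qed.

HB.instance Definition _ := GRing.Lmodule_isLalgebra.Build K fhopf hscaleAl.

Lemma hscaleAr c (a b : fhopf) : c *: (a * b) = a * (c *: b).
Proof.
apply: fhopf_ext => U x hx; rewrite [LHS]hlift_scale // !hlift_mul //.
rewrite /hlift /mon_eval scaler_sumr; apply: eq_bigr => p _.
rewrite scaleC; congr (_ *: _); apply: esym.
exact: (hlift_scale (natural_catl hx p.2) c b).
Qed.

HB.instance Definition _ := GRing.Lalgebra_isAlgebra.Build K fhopf hscaleAr.

Lemma hmon_natural : natural hmon.
Proof.
split=> p q i j; apply: fhopf_ext => U x hx; have L := hlift_linear hx.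
  rewrite lin_sum // [RHS](scalable_linear L) /= hlift_mon // -hx.1.
  by apply: eq_bigr => k _; rewrite [LHS](scalable_linear L) /= hlift_mon.
rewrite lin_sum // [RHS](scalable_linear L) /= hlift_mon // -hx.2.
by apply: eq_bigr => k _; rewrite [LHS](scalable_linear L) /= hlift_mon.
Qed.

Lemma hmon_cat v w : hmon (v ++ w) = hmon v * hmon w.
Proof.
apply: fhopf_ext => U x hx; rewrite hlift_mul // !hlift_mon //.
  exact: natural_catl.
exact: natural_hlift.
Qed.

Lemma hlift_hmon h : hlift hmon h = h.
Proof.
apply: fhopf_ext => U x hx; have L := hlift_linear hx.
rewrite -[LHS]/(hlift x (\sum_(p <- repr h) p.1 *: hmon p.2)) lin_sum //.
by apply: eq_bigr => p _; rewrite [LHS](scalable_linear L) /= hlift_mon.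
Qed.

Lemma fhopf_lin_ext (U : lmodType K) (g g' : fhopf -> U) : linear g -> linear g' ->
  (forall w, g (hmon w) = g' (hmon w)) -> forall h, g h = g' h.
Proof.
move=> L L' e h; rewrite -(hlift_hmon h) /hlift /mon_eval !lin_sum //.
by apply: eq_bigr => p _; rewrite [LHS](scalable_linear L) [RHS](scalable_linear L') /= e.
Qed.

End FormHopf.

Arguments hmon {K f}.

(** * The comultiplication on monomials *)

Section Splitting.
Variables (K : fieldType) (f : tlForm K).
Notation mon := (seq (f * f)).

Section Csum.
Variable U : lmodType K.
Implicit Types F : mon -> mon -> U.

(* The comultiplication of a monomial of degree n has one term per word of length n. *)
Definition csum (w : mon) F : U :=
  \sum_(u <- words f (size w)) F (zip (unzip1 w) u) (zip u (unzip2 w)).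

Lemma csum0 F : csum [::] F = F [::] [::].
Proof. by rewrite /csum big_words0. Qed.

Lemma csum_cons i j w F :
  csum ((i, j) :: w) F = \sum_k csum w (fun a b => F ((i, k) :: a) ((k, j) :: b)).
Proof. by rewrite /csum big_wordsS. Qed.

Lemma eq_csum w F G : (forall a b, F a b = G a b) -> csum w F = csum w G.
Proof. by move=> h; apply: eq_bigr => u _. Qed.

Lemma csumZ c w F : csum w (fun a b => c *: F a b) = c *: csum w F.
Proof. by rewrite /csum scaler_sumr. Qed.

Lemma csum_sum (T : Type) (r : seq T) w (F : T -> mon -> mon -> U) :
  csum w (fun a b => \sum_(t <- r) F t a b) = \sum_(t <- r) csum w (F t).
Proof. exact: exchange_big. Qed.

End Csum.

Lemma csum_cat (U : lmodType K) v w (F : mon -> mon -> U) :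
  csum (v ++ w) F =
  csum v (fun a b => csum w (fun a' b' => F (a ++ a') (b ++ b'))).
Proof.
elim: v F => [|[i j] v IH] F; first by rewrite csum0.
by rewrite /= !csum_cons; apply: eq_bigr => k _; rewrite IH.
Qed.

Lemma csumC (U : lmodType K) v w (F : mon -> mon -> mon -> mon -> U) :
  csum v (fun a b => csum w (F a b)) = csum w (fun c d => csum v (fun a b => F a b c d)).
Proof. exact: exchange_big. Qed.

Lemma csumA (U : lmodType K) w (F : mon -> mon -> mon -> U) :
  csum w (fun a b => csum a (fun c d => F c d b)) =
  csum w (fun a b => csum b (fun c d => F a c d)).
Proof.
elim: w F => [|[i j] w IH] F; first by rewrite !csum0.
rewrite !csum_cons; under eq_bigr => k _ do under eq_csum => a b do rewrite csum_cons.
under [RHS]eq_bigr => k _ do under eq_csum => a b do rewrite csum_cons.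
under eq_bigr => k _ do rewrite csum_sum.
under [RHS]eq_bigr => k _ do rewrite csum_sum.
rewrite exchange_big; apply: eq_bigr => k _; apply: eq_bigr => l _.
by rewrite (IH (fun a b c => F ((i, k) :: a) ((k, l) :: b) ((l, j) :: c))).
Qed.

Lemma csum_eps1 (U : lmodType K) w (F : mon -> U) :
  csum w (fun a b => eps a *: F b) = F w.
Proof.
elim: w F => [|[i j] w IH] F; first by rewrite csum0 /eps big_nil scale1r.
rewrite csum_cons (bigD1 i) //= big1 ?addr0 => [|k /negPf hk].
  rewrite -[RHS](IH (fun b => F ((i, j) :: b))); apply: eq_csum => a b.
  by rewrite eps_cons eqxx mul1r.
rewrite /csum big1 // => u _; by rewrite eps_cons /= eq_sym hk mul0r scale0r.
Qed.

Lemma csum_eps2 (U : lmodType K) w (F : mon -> U) :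
  csum w (fun a b => eps b *: F a) = F w.
Proof.
elim: w F => [|[i j] w IH] F; first by rewrite csum0 /eps big_nil scale1r.
rewrite csum_cons (bigD1 j) //= big1 ?addr0 => [|k /negPf hk].
  rewrite -[RHS](IH (fun b => F ((i, j) :: b))); apply: eq_csum => a b.
  by rewrite eps_cons eqxx mul1r.
rewrite /csum big1 // => u _; by rewrite eps_cons /= hk mul0r scale0r.
Qed.

Lemma csum_lin (U V : lmodType K) (g : U -> V) w (F : mon -> mon -> U) :
  linear g -> g (csum w F) = csum w (fun a b => g (F a b)).
Proof. by move=> L; rewrite /csum lin_sum. Qed.

(** The relations generate a coideal. A cup relation in the second factor turns the pair of inner
    indices into a cup, which the first factor then absorbs by the same relation; for caps the
    factors exchange roles. *)
Lemma csum_natural (U : lmodType K) (F : mon -> mon -> U) :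
  (forall b, natural (F^~ b)) -> (forall a, natural (F a)) ->
  natural (fun w => csum w F).
Proof.
move=> h1 h2; split=> p q i j.
  under eq_bigr => k _.
    rewrite csum_cat -csumZ; under eq_csum => a b.
      rewrite csum_cons; under eq_bigr => m _ do rewrite csum_cons.
      rewrite scaler_sumr; under eq_bigr => m _ do rewrite scaler_sumr.
      over.
    over.
  rewrite -csum_sum csum_cat -csumZ; apply: eq_csum => a b.
  transitivity (\sum_m \sum_n \sum_k sgn (tau k) *: csum q (fun a' b' =>
     F (a ++ [:: (i, m), (j, n) & a']) (b ++ [:: (m, k), (n, tau k) & b']))).
    by rewrite exchange_big; apply: eq_bigr => m _; rewrite exchange_big.
  transitivity (\sum_m \sum_n cup m n *: csum q (fun a' b' =>
     F (a ++ [:: (i, m), (j, n) & a']) (b ++ b'))).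
    apply: eq_bigr => m _; apply: eq_bigr => n _.
    under eq_bigr => k _ do rewrite -csumZ.
    rewrite -csum_sum -csumZ; apply: eq_csum => a' b'.
    exact: (h2 _).1.
  transitivity (\sum_m sgn (tau m) *: csum q (fun a' b' =>
     F (a ++ [:: (i, m), (j, tau m) & a']) (b ++ b'))).
    apply: eq_bigr => m _; rewrite (bigD1 (tau m)) //= /cup eqxx big1 ?addr0 //.
    by move=> n /negPf hn; rewrite hn scale0r.
  under eq_bigr => m _ do rewrite -csumZ.
  rewrite -csum_sum -csumZ; apply: eq_csum => a' b'.
  exact: (h1 _).1.
under eq_bigr => k _.
  rewrite csum_cat -csumZ; under eq_csum => a b.
    rewrite csum_cons; under eq_bigr => m _ do rewrite csum_cons.
    rewrite scaler_sumr; under eq_bigr => m _ do rewrite scaler_sumr.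
    over.
  over.
rewrite -csum_sum csum_cat -csumZ; apply: eq_csum => a b.
transitivity (\sum_m \sum_n \sum_k sgn k *: csum q (fun a' b' =>
   F (a ++ [:: (k, m), (tau k, n) & a']) (b ++ [:: (m, i), (n, j) & b']))).
  by rewrite exchange_big; apply: eq_bigr => m _; rewrite exchange_big.
transitivity (\sum_m \sum_n cup (f := dual f) m n *: csum q (fun a' b' =>
   F (a ++ a') (b ++ [:: (m, i), (n, j) & b']))).
  apply: eq_bigr => m _; apply: eq_bigr => n _.
  under eq_bigr => k _ do rewrite -csumZ.
  rewrite -csum_sum -csumZ; apply: eq_csum => a' b'.
  exact: (h1 _).2.
transitivity (\sum_m sgn m *: csum q (fun a' b' =>
   F (a ++ a') (b ++ [:: (m, i), (tau m, j) & b']))).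
  apply: eq_bigr => m _; rewrite (bigD1 (tau m)) //= cup_dual eqxx big1 ?addr0 //.
  by move=> n /negPf hn; rewrite cup_dual hn scale0r.
under eq_bigr => m _ do rewrite -csumZ.
rewrite -csum_sum -csumZ; apply: eq_csum => a' b'.
exact: (h2 _).2.
Qed.

End Splitting.

Section HopfStructure.
Variables (K : fieldType) (f : tlForm K).
Notation mon := (seq (f * f)).
Notation H := (fhopf f).
Implicit Types (x y : H) (v w : mon).

Definition mon_comul w : H \ox H := csum w (fun a b => hmon a \ot hmon b).

Lemma mon_comul_natural : natural mon_comul.
Proof.
have [b1 b2] := @tens_bilinear K H H.
apply: csum_natural => a.
  exact: (natural_lin (b1 (hmon a)) (@hmon_natural K f)).
exact: (natural_lin (b2 (hmon a)) (@hmon_natural K f)).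
Qed.

Definition fcomul : H -> H \ox H := hlift mon_comul.

HB.instance Definition _ := GRing.isLinear.Build K H (H \ox H) *:%R fcomul
  (hlift_linear mon_comul_natural).

Lemma fcomul_mon w : fcomul (hmon w) = csum w (fun a b => hmon a \ot hmon b).
Proof. exact: hlift_mon mon_comul_natural. Qed.

Lemma tsum_csum (V W U : lmodType K) (G : V -> W -> U) w (F1 : mon -> V) (F2 : mon -> W) :
  bilinear_for *:%R *:%R G ->
  tsum (csum w (fun a b => F1 a \ot F2 b)) G = csum w (fun a b => G (F1 a) (F2 b)).
Proof.
move=> hG; rewrite (csum_lin _ _ (tsum_is_linear hG)).
by apply: eq_csum => a b; rewrite tsum_pure.
Qed.

Lemma tsum_fcomul (U : lmodType K) (G : H -> H -> U) w : bilinear_for *:%R *:%R G ->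
  tsum (fcomul (hmon w)) G = csum w (fun a b => G (hmon a) (hmon b)).
Proof. by move=> hG; rewrite fcomul_mon tsum_csum. Qed.

Definition fcounit : H -> K^o := hlift (@eps K f).

Lemma fcounit_mon w : fcounit (hmon w) = eps w.
Proof. exact: hlift_mon (@eps_natural K f). Qed.

HB.instance Definition _ := GRing.isLinear.Build K H K^o *:%R fcounit
  (hlift_linear (@eps_natural K f)).

Lemma fcounit_monoid : monoid_morphism fcounit.
Proof.
split; first by rewrite -[1]/(hmon [::]) fcounit_mon /eps big_nil.
move=> x y; apply: (fhopf_lin_ext (g := fun x => fcounit (x * y))
  (g' := fun x => fcounit x * fcounit y : K^o)) x; [by lin|by lin|move=> v].
apply: (fhopf_lin_ext (g := fun y => fcounit (hmon v * y))
  (g' := fun y => fcounit (hmon v) * fcounit y : K^o)) y; [by lin|by lin|move=> w].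
by rewrite -hmon_cat !fcounit_mon eps_cat.
Qed.

HB.instance Definition _ := GRing.isMonoidMorphism.Build H K^o fcounit fcounit_monoid.

(** The antipode sends a_ij to [sgn (tau i) * sgn (tau j)] times the generator with indices [tau j],
    [tau i], which is the transposed coefficient matrix conjugated by the form, and it reverses
    products. [asgn] is its sign on a monomial, [arev] its word. *)
Definition asgn w : K := \prod_(p <- w) (sgn (tau p.1) * sgn (tau p.2)).
Definition arev w : mon := rev [seq (tau p.2, tau p.1) | p <- w].

Lemma asgn_cat v w : asgn (v ++ w) = asgn v * asgn w.
Proof. by rewrite /asgn big_cat. Qed.

Lemma asgn_cons p w : asgn (p :: w) = sgn (tau p.1) * sgn (tau p.2) * asgn w.
Proof. by rewrite /asgn big_cons. Qed.

Lemma arev_cat v w : arev (v ++ w) = arev w ++ arev v.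
Proof. by rewrite /arev map_cat rev_cat. Qed.

Lemma arev_cons p w : arev (p :: w) = arev w ++ [:: (tau p.2, tau p.1)].
Proof. by rewrite /arev /= rev_cons cats1. Qed.

Definition mon_antipode w : H := asgn w *: hmon (arev w).

(** Transposition and reversal turn a cup relation into a cap relation and conversely. *)
Lemma mon_antipode_natural : natural mon_antipode.
Proof.
split=> p q i j; rewrite /mon_antipode.
  transitivity ((asgn (p ++ q) * (sgn (tau i) * sgn (tau j))) *:
    (\sum_k sgn k *: hmon (arev q ++ (k, tau j) :: (tau k, tau i) :: arev p))).
    rewrite scaler_sumr; apply: eq_bigr => k _.
    rewrite arev_cat !arev_cons /= -!catA /= tauK !scalerA; congr (_ *: _).
    rewrite !asgn_cat !asgn_cons /= tauK.
    have e := sgn_sqr (tau k).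
    ring: e.
  rewrite (hmon_natural f).2 -arev_cat !scalerA; congr (_ *: _).
  rewrite cup_dual /cup tauK [tau i == j]eq_sym mulrC; case: eqP => [->|_]; last by rewrite !mul0r ?mulr0.
  have e := sgn_sqr i; rewrite tauK; ring: e.
transitivity ((asgn (p ++ q) * (sgn (tau i) * sgn (tau j))) *:
  (\sum_k sgn (tau k) *: hmon (arev q ++ (tau j, k) :: (tau i, tau k) :: arev p))).
  rewrite scaler_sumr; apply: eq_bigr => k _.
  rewrite arev_cat !arev_cons /= -!catA /= tauK !scalerA; congr (_ *: _).
  rewrite !asgn_cat !asgn_cons /= tauK.
  have e := sgn_sqr k; ring: e.
rewrite (hmon_natural f).1 -arev_cat !scalerA; congr (_ *: _).
rewrite cup_dual /cup tauK [tau i == j]eq_sym mulrC; case: eqP => [->|_]; last by rewrite !mul0r ?mulr0.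
have e := sgn_sqr (tau i); rewrite tauK; ring: e.
Qed.

Definition fantipode : H -> H := hlift mon_antipode.

HB.instance Definition _ := GRing.isLinear.Build K H H *:%R fantipode
  (hlift_linear mon_antipode_natural).

Lemma fantipode_mon w : fantipode (hmon w) = asgn w *: hmon (arev w).
Proof. exact: hlift_mon mon_antipode_natural. Qed.

Lemma fcomulA x :
  \sw_(a, b <- fcomul x) \sw_(a1, a2 <- fcomul a) a1 \ot (a2 \ot b) =
  \sw_(a, b <- fcomul x) a \ot fcomul b.
Proof.
apply: (fhopf_lin_ext (g := fun x =>
    \sw_(a, b <- fcomul x) \sw_(a1, a2 <- fcomul a) a1 \ot (a2 \ot b))
  (g' := fun x => \sw_(a, b <- fcomul x) a \ot fcomul b)) x; [by lin|by lin|move=> w].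
rewrite [LHS]tsum_fcomul; last by lin.
rewrite [RHS]tsum_fcomul; last by lin.
under eq_csum => a b do (rewrite tsum_fcomul; last by lin).
rewrite (csumA w (fun a b c => hmon a \ot (hmon b \ot hmon c))).
apply: eq_csum => a b; rewrite fcomul_mon csum_lin //; lin.
Qed.

Lemma fcounitl x : \sw_(a, b <- fcomul x) fcounit a *: b = x.
Proof.
apply: (fhopf_lin_ext (g := fun x => \sw_(a, b <- fcomul x) fcounit a *: b)
  (g' := fun x => x)) x; [by lin|by lin|move=> w].
rewrite tsum_fcomul; last by lin.
by under eq_csum => a b do rewrite fcounit_mon; rewrite csum_eps1.
Qed.

Lemma fcounitr x : \sw_(a, b <- fcomul x) fcounit b *: a = x.
Proof.
apply: (fhopf_lin_ext (g := fun x => \sw_(a, b <- fcomul x) fcounit b *: a)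
  (g' := fun x => x)) x; [by lin|by lin|move=> w].
rewrite tsum_fcomul; last by lin.
by under eq_csum => a b do rewrite fcounit_mon; rewrite csum_eps2.
Qed.

Lemma fcomul1 : fcomul 1 = 1 \ot 1.
Proof. by rewrite -[1]/(hmon [::]) fcomul_mon csum0. Qed.

Lemma fcomulM x y : fcomul (x * y) = tens_mul (fcomul x) (fcomul y).
Proof.
rewrite /tens_mul; apply: (fhopf_lin_ext (g := fun x => fcomul (x * y))
  (g' := fun x => \sw_(a, b <- fcomul x) \sw_(c, d <- fcomul y) (a * c) \ot (b * d))) x;
  [by lin|by lin|move=> v].
apply: (fhopf_lin_ext (g := fun y => fcomul (hmon v * y))
  (g' := fun y => \sw_(a, b <- fcomul (hmon v)) \sw_(c, d <- fcomul y)
    (a * c) \ot (b * d))) y; [by lin|by lin|move=> w].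
rewrite -hmon_cat fcomul_mon csum_cat tsum_fcomul; last by lin.
apply: eq_csum => a b; rewrite tsum_fcomul; last by lin.
by apply: eq_csum => c d; rewrite !hmon_cat.
Qed.

Lemma fantipodel x : \sw_(a, b <- fcomul x) fantipode a * b = (fcounit x : K) *: (1 : H).
Proof.
apply: (fhopf_lin_ext (g := fun x => \sw_(a, b <- fcomul x) fantipode a * b)
  (g' := fun x => (fcounit x : K) *: (1 : H))) x; [by lin|by lin|move=> w].
rewrite tsum_fcomul; last by lin.
rewrite fcounit_mon.
under eq_csum => a b do rewrite fantipode_mon -scalerAl -hmon_cat.
elim: w => [|[i j] w IH].
  by rewrite csum0 /asgn /eps !big_nil.
rewrite csum_cons eps_cons -scalerA -IH -csumZ -csum_sum; apply: eq_csum => a b.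
under eq_bigr => k _ do rewrite asgn_cons arev_cons -catA /= [_ * asgn a]mulrC -!scalerA.
rewrite -!scaler_sumr [RHS]scaleC; congr (_ *: _).
rewrite (reindex_inj (inv_inj (@tauK K f))) /=.
under eq_bigr => k _ do rewrite tauK -[(tau k, j)]/(tau k, j).
rewrite (hmon_natural f).2 cup_dual tauK scalerA [j == i]eq_sym.
by case: eqP => [->|_]; rewrite ?sgn_sqr ?mulr0.
Qed.

(** The antipode reverses words, so in a S(b) it is the contributions of the last letter that meet
    in the middle, where a cup relation collapses them: hence the induction from the end. *)
Lemma fantipoder x : \sw_(a, b <- fcomul x) a * fantipode b = (fcounit x : K) *: (1 : H).
Proof.
apply: (fhopf_lin_ext (g := fun x => \sw_(a, b <- fcomul x) a * fantipode b)
  (g' := fun x => (fcounit x : K) *: (1 : H))) x; [by lin|by lin|move=> w].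
rewrite tsum_fcomul; last by lin.
rewrite fcounit_mon.
under eq_csum => a b do rewrite fantipode_mon -scalerAr -hmon_cat.
elim/last_ind: w => [|w [i j] IH].
  by rewrite csum0 /asgn /eps !big_nil.
rewrite -cats1 csum_cat eps_cat mulrC -scalerA -IH -csumZ; apply: eq_csum => a b.
rewrite csum_cons.
under eq_bigr => k _ do rewrite csum0 asgn_cat asgn_cons arev_cat /= /asgn big_nil mulr1 -!scalerA.
rewrite -!scaler_sumr [RHS]scaleC; congr (_ *: _).
rewrite /arev /=.
under eq_bigr => k _ do rewrite -catA /= scaleC.
rewrite -!scaler_sumr (hmon_natural f).1 /cup scalerA eps_cons /eps big_nil mulr1 /=.
rewrite (inj_eq (inv_inj (@tauK K f))) [j == i]eq_sym.
by case: eqP => _; rewrite ?sgn_sqr ?mulr0.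
Qed.

Definition formHopf : hopfAlgebra K :=
  @HopfAlgebra K H fcomul fcounit fantipode fcomulA fcounitl fcounitr fcomul1
    fcomulM fantipodel fantipoder.

End HopfStructure.

(** * The cotriangular structure *)

Section Braiding.
Variables (K : fieldType) (f : tlForm K).

(* The matrix entries of the braiding [id + cup o cap]. *)
Definition r0 (i j k l : f) : K :=
  (k == j)%:R * (i == l)%:R + cup k i * cup l j.

Lemma r0_tr i j k l : r0 j i l k = r0 i j k l.
Proof. by rewrite /r0 [l == i]eq_sym [j == k]eq_sym; ring. Qed.

Lemma sum_eq (G : f -> K) a : \sum_i (i == a)%:R * G i = G a.
Proof.
rewrite -[RHS](sum_delta G a); apply: eq_bigr => i _.
by case: eqP => _; rewrite ?mul1r ?mul0r.
Qed.

Lemma sum_eqC (G : f -> K) a : \sum_i (a == i)%:R * G i = G a.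
Proof. by rewrite -[RHS](sum_eq G a); apply: eq_bigr => i _; rewrite eq_sym. Qed.

Lemma sum_cupr (G : f -> K) a : \sum_i cup a i * G i = sgn (tau a) * G (tau a).
Proof.
rewrite -[RHS](sum_delta (fun i => sgn i * G i)); apply: eq_bigr => i _.
by rewrite /cup; case: eqP => _; rewrite ?mul0r.
Qed.

Lemma sum_cupl (G : f -> K) a : \sum_i cup i a * G i = sgn a * G (tau a).
Proof.
rewrite -[RHS](sum_delta (fun i => sgn a * G i)); apply: eq_bigr => i _.
by rewrite /cup tau_eq; case: eqP => _; rewrite ?mul0r.
Qed.

Lemma cup_taul a b : cup (tau a : f) b = (b == a)%:R * sgn b.
Proof. by rewrite /cup tauK; case: eqP => _; rewrite ?mul1r ?mul0r. Qed.

Lemma r0_sum2 (G : f -> K) i k l :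
  \sum_j r0 i j k l * G j = (i == l)%:R * G k + cup k i * (sgn (tau l) * G (tau l)).
Proof.
rewrite -sum_cupr -(sum_eqC G k) !mulr_sumr -big_split; apply: eq_bigr => j _ /=.
by rewrite /r0; ring.
Qed.

(** Sliding a strand across a cup. Of the four products of [id] and [cup o cap] one gives the claim;
    the other three are 1, -2 and 1 times a common term, the -2 being the loop. *)
Lemma r0_cup m n i j :
  \sum_k sgn (tau k) * \sum_p r0 m p j (tau k) * r0 p n i k = cup i j * (m == n)%:R.
Proof.
under eq_bigr => k _ do rewrite (r0_sum2 (fun p => r0 p n i k)) tauK mulrDr.
rewrite big_split /= (eq_bigr (fun k => (k == tau m)%:R * (sgn (tau k) * r0 j n i k))); last first.
  by move=> k _; rewrite (tau_eq k m) mulrCA eq_sym.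
rewrite sum_eq tauK.
under [X in _ + X]eq_bigr => k _ do rewrite mulrCA.
rewrite -mulr_sumr.
have -> : \sum_k sgn (tau k) * (sgn k * r0 k n i k) =
    - 2%:R * (i == n)%:R + sgn i * cup (tau i) n.
  rewrite /r0; under eq_bigr => k _ do rewrite eqxx mulr1 !mulrDr.
  rewrite big_split /=; congr (_ + _).
    by rewrite -(tl_loop f) mulr_suml; apply: eq_bigr => k _; ring.
  transitivity (\sum_k cup i k * (sgn (tau k) * sgn k * cup k n)).
    by apply: eq_bigr => k _; ring.
  by rewrite sum_cupr tauK; have e := sgn_sqr (tau i); ring: e.
have h1 a : sgn a * ((n == a)%:R * sgn n) = (a == n)%:R.
  by rewrite eq_sym; case: eqP => [->|_]; rewrite ?mul1r ?sgn_sqr // mul0r mulr0.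
have h2 : sgn m * (j == tau m)%:R = cup j m.
  by rewrite /cup tau_eq; case: eqP => [->|_]; rewrite ?mulr1 // mulr0.
rewrite cup_taul h1 /r0 cup_taul mulrDr.
rewrite [X in X + _ + _]mulrCA h2 [sgn m * (cup _ _ * _)]mulrCA h1; ring.
Qed.

(** The coefficient of [cup o cap] in the square of the braiding is 1 + 1 + loop = 0. *)
Lemma r0_unitary p q k l :
  \sum_m \sum_n r0 p m k n * r0 n l m q = (p == q)%:R * (k == l)%:R.
Proof.
rewrite exchange_big /=; under eq_bigr => n _ do rewrite (r0_sum2 (fun m => r0 n l m q)).
rewrite big_split /= sum_eqC -mulr_sumr.
have -> : \sum_n sgn (tau n) * r0 n l (tau n) q = - cup q l.
  rewrite /r0; under eq_bigr => n _ do rewrite mulrDr.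
  rewrite big_split /=.
  rewrite (eq_bigr (fun n => (n == q)%:R * (sgn (tau n) * (tau n == l)%:R))); last first.
    by move=> n _; ring.
  rewrite sum_eq.
  have -> : \sum_(n : f) sgn (tau n) * (cup (tau n) n * cup q l) = - 2%:R * cup q l.
    by rewrite -(tl_loop f) mulr_suml; apply: eq_bigr => n _; rewrite cup_taul eqxx /=; ring.
  have -> : sgn (tau q) * (tau q == l)%:R = cup q l.
    by rewrite /cup eq_sym; case: eqP => [->|_]; rewrite ?mulr1 ?mulr0.
  ring.
rewrite /r0; ring.
Qed.

Notation mon := (seq (f * f)).

(** [r1 i j w] is the form at a_ij and [w], and [bichar v w] the form at two monomials, unfolded
    letter by letter along the two multiplicativity rules. The reversed order of the factors in [r1]
    is the one in [cotri_mulr]. *)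
Fixpoint r1 (i j : f) (w : mon) : K :=
  match w with
  | [::] => (i == j)%:R
  | (k, l) :: w' => \sum_m r1 i m w' * r0 m j k l
  end.

Fixpoint bichar (v w : mon) : K^o :=
  match v with
  | [::] => eps w
  | (i, j) :: v' => csum w (fun a b => r1 i j a * bichar v' b : K^o)
  end.

Lemma r1_cat i j v w : r1 i j (v ++ w) = \sum_m r1 i m w * r1 m j v.
Proof.
elim: v j => [|[k l] v IH] j /=.
  rewrite -[LHS](sum_eq (fun m => r1 i m w)); apply: eq_bigr => m _; exact: mulrC.
under eq_bigr => m _ do rewrite IH mulr_suml.
rewrite exchange_big /=; apply: eq_bigr => m _; rewrite mulr_sumr.
by apply: eq_bigr => n _; rewrite mulrA.
Qed.

Lemma csumMl w c (F : mon -> mon -> K^o) :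
  csum w (fun a b => c * F a b : K^o) = c * csum w F.
Proof. exact: (@csumZ K f K^o c w F). Qed.

Lemma csumMr w c (F : mon -> mon -> K^o) :
  csum w (fun a b => F a b * c : K^o) = csum w F * c.
Proof. by rewrite mulrC -csumMl; apply: eq_csum => a b; rewrite mulrC. Qed.

Lemma bichar_catl v v' w :
  bichar (v ++ v') w = csum w (fun a b => bichar v a * bichar v' b : K^o).
Proof.
elim: v w => [|[i j] v IH] w /=; first exact/esym/(csum_eps1 w (bichar v')).
under eq_csum => a b do rewrite IH -csumMl.
under [RHS]eq_csum => a b do rewrite -csumMr.
rewrite (csumA w (fun a b c => r1 i j a * bichar v b * bichar v' c : K^o)).
by apply: eq_csum => a b; apply: eq_csum => c d; rewrite mulrA.
Qed.

Lemma bichar1 i j w : bichar [:: (i, j)] w = r1 i j w.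
Proof.
rewrite /= -[RHS](csum_eps2 w (r1 i j : mon -> K^o)); apply: eq_csum => a b.
exact: mulrC.
Qed.

Lemma bichar_catr v w w' :
  bichar v (w ++ w') = csum v (fun a b => bichar a w' * bichar b w : K^o).
Proof.
elim: v w w' => [|[i j] v IH] w w' /=; first by rewrite csum0 /= eps_cat mulrC.
rewrite csum_cat csum_cons.
under eq_csum => a b do under eq_csum => c d do rewrite r1_cat IH.
transitivity (\sum_m csum w (fun a b => csum w' (fun c d => csum v (fun e g =>
   r1 i m c * r1 m j a * (bichar e d * bichar g b) : K^o)))).
  rewrite -csum_sum; apply: eq_csum => a b; rewrite -csum_sum; apply: eq_csum => c d.
  by rewrite mulr_suml; apply: eq_bigr => m _; rewrite csumMl.
apply: eq_bigr => m _.
under eq_csum => a b do rewrite csumC.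
rewrite csumC; apply: eq_csum => e g /=.
rewrite -csumMl; apply: eq_csum => a b; rewrite -csumMr; apply: eq_csum => c d; ring.
Qed.

Lemma r1_cup m n i j :
  \sum_k sgn (tau k) * r1 m n [:: (i, k); (j, tau k)] = cup i j * (m == n)%:R.
Proof.
rewrite -r0_cup; apply: eq_bigr => k _; congr (_ * _); apply: eq_bigr => p _ /=.
by rewrite sum_eqC.
Qed.

Lemma r1_cap m n i j :
  \sum_k sgn k * r1 m n [:: (k, i); (tau k, j)] =
  cup (f := dual f) i j * (m == n)%:R.
Proof.
rewrite cup_dualC eq_sym -r0_cup (reindex_inj (inv_inj (@tauK K f))) /=.
apply: eq_bigr => k _; congr (_ * _); apply: eq_bigr => p _.
by rewrite /= sum_eqC tauK mulrC -[r0 n p _ _]r0_tr -[r0 p m _ _]r0_tr.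
Qed.

End Braiding.

Section BraidingDual.
Variables (K : fieldType) (f : tlForm K).

Lemma r0_dual (i j k l : f) : r0 (f := dual f) i j k l = r0 k l i j.
Proof.
by rewrite /r0 !cup_dualC [k == j]eq_sym [i == l]eq_sym; ring.
Qed.

(** Passing to the dual form exchanges the two arguments of [r0], so the relations in the first
    argument follow from those in the second. *)
Lemma r0_cup2 (c d i j : f) :
  \sum_k sgn (tau k) * \sum_e r0 i k c e * r0 j (tau k) e d = cup i j * (c == d)%:R.
Proof.
have := @r0_cup K (dual f) c d j i; rewrite cup_dualC => <-.
rewrite [RHS](reindex_inj (inv_inj (@tauK K f))) /=; apply: eq_bigr => k _.
by rewrite !tauK; congr (_ * _); apply: eq_bigr => e _; rewrite !r0_dual.
Qed.

Lemma r0_cap2 (c d i j : f) :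
  \sum_k sgn k * \sum_e r0 k i c e * r0 (tau k) j e d =
  cup (f := dual f) i j * (c == d)%:R.
Proof.
rewrite cup_dualC eq_sym -r0_cup2 (reindex_inj (inv_inj (@tauK K f))) /=.
apply: eq_bigr => k _; congr (_ * _); apply: eq_bigr => e _.
by rewrite tauK mulrC -[r0 j k _ _]r0_tr -[r0 i _ _ _]r0_tr.
Qed.

End BraidingDual.

Section Cotriangular.
Variables (K : fieldType) (f : tlForm K).
Notation mon := (seq (f * f)).
Notation H := (fhopf f).

Lemma sum_cup2 (F : f -> f -> K) :
  \sum_m \sum_n cup m n * F m n = \sum_m sgn (tau m) * F m (tau m).
Proof. by apply: eq_bigr => m _; rewrite sum_cupr. Qed.

Lemma sum_cap2 (F : f -> f -> K) :
  \sum_(m : f) \sum_(n : f) cup (f := dual f) m n * F m n = \sum_m sgn m * F m (tau m).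
Proof.
apply: eq_bigr => m _; under eq_bigr => n _ do rewrite cup_dualC.
by rewrite sum_cupl.
Qed.

Lemma csum2 (U : lmodType K) (i j k l : f) (F : mon -> mon -> U) :
  csum [:: (i, k); (j, l)] F =
  \sum_m \sum_n F [:: (i, m); (j, n)] [:: (m, k); (n, l)].
Proof.
by rewrite csum_cons; apply: eq_bigr => m _; rewrite csum_cons;
  apply: eq_bigr => n _; rewrite csum0.
Qed.

Lemma bichar_cupr v (i j : f) :
  \sum_k sgn (tau k) * (bichar v [:: (i, k); (j, tau k)] : K) = cup i j * (eps v : K).
Proof.
elim: v i j => [|[m n] v IH] i j; first exact: (@eps_natural K f).1 [::] [::] i j.
rewrite eps_cons mulrA /= -r1_cup.
under eq_bigr => k _ do rewrite csum2 mulr_sumr.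
transitivity (\sum_k1 \sum_k2 cup k1 k2 * (r1 m n [:: (i, k1); (j, k2)] * eps v)).
  rewrite exchange_big; apply: eq_bigr => k1 _.
  under eq_bigr => k _ do rewrite mulr_sumr.
  rewrite exchange_big; apply: eq_bigr => k2 _ /=.
  rewrite mulrCA -IH mulr_sumr; apply: eq_bigr => k _; ring.
rewrite sum_cup2 mulr_suml; apply: eq_bigr => k _ /=; ring.
Qed.

Lemma bichar_capr v (i j : f) :
  \sum_k sgn k * (bichar v [:: (k, i); (tau k, j)] : K) = cup (f := dual f) i j * (eps v : K).
Proof.
elim: v i j => [|[m n] v IH] i j; first exact: (@eps_natural K f).2 [::] [::] i j.
rewrite eps_cons /=.
under eq_bigr => k _ do rewrite csum2 mulr_sumr.
transitivity (\sum_(k1 : f) \sum_(k2 : f) cup (f := dual f) k1 k2 *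
   ((m == n)%:R * bichar v [:: (k1, i); (k2, j)])).
  rewrite exchange_big; apply: eq_bigr => k1 _.
  under eq_bigr => k _ do rewrite mulr_sumr.
  rewrite exchange_big; apply: eq_bigr => k2 _ /=.
  rewrite mulrA -r1_cap mulr_suml; apply: eq_bigr => k _ /=; ring.
rewrite sum_cap2 mulrCA -IH mulr_sumr; apply: eq_bigr => k _; ring.
Qed.

Lemma bichar_nil (v : mon) : bichar v [::] = eps v.
Proof. by elim: v => [|[i j] v IH] //; rewrite eps_cons /= csum0 IH. Qed.

Lemma bichar_cupl w (i j : f) :
  \sum_k sgn (tau k) * (bichar [:: (i, k); (j, tau k)] w : K) = cup i j * (eps w : K).
Proof.
elim: w i j => [|[c d] w IH] i j; first by
  under eq_bigr => k _ do rewrite bichar_nil; exact: (@eps_natural K f).1 [::] [::] i j.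
rewrite eps_cons.
transitivity (\sum_k1 \sum_k2 cup k1 k2 *
   ((c == d)%:R * bichar [:: (i, k1); (j, k2)] w)).
  transitivity (\sum_k sgn (tau k) * \sum_k1 \sum_k2
    bichar [:: (i, k1); (j, k2)] w * bichar [:: (k1, k); (k2, tau k)] [:: (c, d)]).
    apply: eq_bigr => k _; congr (_ * _).
    by apply: etrans (bichar_catr _ [:: (c, d)] w) _; exact: csum2.
  under eq_bigr => k _ do rewrite mulr_sumr.
  rewrite exchange_big; apply: eq_bigr => k1 _.
  under eq_bigr => k _ do rewrite mulr_sumr.
  rewrite exchange_big; apply: eq_bigr => k2 _.
  rewrite mulrA -r0_cup2 mulr_suml; apply: eq_bigr => k _.
  rewrite mulrCA mulrC; congr (_ * _); congr (_ * _).
  rewrite -cat1s bichar_catl csum_cons.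
  by apply: eq_bigr => e _; rewrite csum0 !bichar1 /= !sum_eqC.
rewrite sum_cup2 mulrCA -IH mulr_sumr; apply: eq_bigr => k _; ring.
Qed.

Lemma bichar_capl w (i j : f) :
  \sum_k sgn k * (bichar [:: (k, i); (tau k, j)] w : K) = cup (f := dual f) i j * (eps w : K).
Proof.
elim: w i j => [|[c d] w IH] i j; first by
  under eq_bigr => k _ do rewrite bichar_nil; exact: (@eps_natural K f).2 [::] [::] i j.
rewrite eps_cons [X in _ = _ * (X * _)]/=.
transitivity (\sum_(k1 : f) \sum_(k2 : f) cup (f := dual f) k1 k2 *
   (eps w * bichar [:: (k1, i); (k2, j)] [:: (c, d)])).
  transitivity (\sum_k sgn k * \sum_k1 \sum_k2
    bichar [:: (k, k1); (tau k, k2)] w * bichar [:: (k1, i); (k2, j)] [:: (c, d)]).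
    apply: eq_bigr => k _; congr (_ * _).
    by apply: etrans (bichar_catr _ [:: (c, d)] w) _; exact: csum2.
  under eq_bigr => k _ do rewrite mulr_sumr.
  rewrite exchange_big; apply: eq_bigr => k1 _.
  under eq_bigr => k _ do rewrite mulr_sumr.
  rewrite exchange_big; apply: eq_bigr => k2 _.
  by rewrite mulrA -IH mulr_suml; apply: eq_bigr => k _; rewrite mulrA.
rewrite sum_cap2 [RHS]mulrA -r0_cap2 mulr_suml; apply: eq_bigr => k _.
rewrite mulrCA mulrC; congr (_ * _); congr (_ * _).
rewrite -cat1s bichar_catl csum_cons.
by apply: eq_bigr => e _; rewrite csum0 !bichar1 /= !sum_eqC.
Qed.

(** To treat a relation between [p] and [q], the comultiplication splits [v] in three. The middle
    part is paired with the bare relation, where it contributes only its counit. *)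
Lemma bichar_natr v : natural (bichar v : mon -> K^o).
Proof.
have key p q (X : mon) : bichar v (p ++ X ++ q) =
    csum v (fun a b => csum a (fun c d => bichar c q * bichar d X * bichar b p : K^o)).
  rewrite bichar_catr; apply: eq_csum => a b; rewrite bichar_catr csumMr; congr (_ * _).
have sumE (T : finType) (s : T -> K) (X : T -> mon) c p q :
    (forall u, \sum_k s k * (bichar u (X k) : K) = c * (eps u : K)) ->
    \sum_k s k *: bichar v (p ++ X k ++ q) = c *: bichar v (p ++ q).
  move=> h; under eq_bigr => k _ do rewrite key -csumZ.
  rewrite -csum_sum bichar_catr -csumZ; apply: eq_csum => a b.
  under eq_bigr => k _ do rewrite -csumZ.
  rewrite -csum_sum -(csum_eps2 a (fun c => bichar c q : K^o)).
  rewrite -[_ *: _]/(_ * _) -csumMr -csumMl; apply: eq_csum => u u'.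
  rewrite -[eps u' *: _]/(_ * _).
  transitivity (bichar u q * bichar b p * (c * eps u')); last by ring.
  rewrite -h mulr_sumr; apply: eq_bigr => k _; rewrite -[LHS]/(_ * _); ring.
split=> p q i j.
  exact: (sumE _ _ (fun k => [:: (i, k); (j, tau k)]) _ p q (fun u => bichar_cupr u i j)).
exact: (sumE _ _ (fun k => [:: (k, i); (tau k, j)]) _ p q (fun u => bichar_capr u i j)).
Qed.

Lemma bichar_natl (w : mon) : natural (fun v : mon => bichar v w : K^o).
Proof.
have key p q (X : mon) : bichar (p ++ X ++ q) w =
    csum w (fun a b => csum b (fun c d => bichar p a * bichar X c * bichar q d : K^o)).
  rewrite bichar_catl; apply: eq_csum => a b; rewrite bichar_catl -csumMl.
  by apply: eq_csum => c d; rewrite mulrA.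
have sumE (T : finType) (s : T -> K) (X : T -> mon) c p q :
    (forall u, \sum_k s k * (bichar (X k) u : K) = c * (eps u : K)) ->
    \sum_k s k *: bichar (p ++ X k ++ q) w = c *: bichar (p ++ q) w.
  move=> h; under eq_bigr => k _ do rewrite key -csumZ.
  rewrite -csum_sum bichar_catl -csumZ; apply: eq_csum => a b.
  under eq_bigr => k _ do rewrite -csumZ.
  rewrite -csum_sum -(csum_eps1 b (fun c => bichar q c : K^o)).
  rewrite -[_ *: _]/(_ * _) -csumMl -csumMl; apply: eq_csum => u u'.
  rewrite -[eps u *: _]/(_ * _).
  transitivity (bichar p a * bichar q u' * (c * eps u)); last by ring.
  rewrite -h mulr_sumr; apply: eq_bigr => k _; rewrite -[LHS]/(_ * _); ring.
split=> p q i j.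
  exact: (sumE _ _ (fun k => [:: (i, k); (j, tau k)]) _ p q (fun u => bichar_cupl u i j)).
exact: (sumE _ _ (fun k => [:: (k, i); (tau k, j)]) _ p q (fun u => bichar_capl u i j)).
Qed.

End Cotriangular.

Section CotriangularStructure.
Variables (K : fieldType) (f : tlForm K).
Notation mon := (seq (f * f)).
Notation H := (fhopf f).

Section VectorSums.
Variables (U : lmodType K) (G : f -> U).

Lemma sumv_eq a : \sum_i (i == a)%:R *: G i = G a.
Proof.
rewrite -[RHS](sum_delta G a); apply: eq_bigr => i _.
by case: eqP => _; rewrite ?scale1r ?scale0r.
Qed.

Lemma sumv_cupr a : \sum_i cup a i *: G i = sgn (tau a) *: G (tau a).
Proof.
rewrite -[RHS](sum_delta (fun i => sgn i *: G i)); apply: eq_bigr => i _.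
by rewrite /cup; case: eqP => _; rewrite ?scale0r.
Qed.

Lemma sumv_cupl a : \sum_i cup i a *: G i = sgn a *: G (tau a).
Proof.
rewrite -[RHS](sum_delta (fun i => sgn a *: G i)); apply: eq_bigr => i _.
by rewrite /cup tau_eq; case: eqP => _; rewrite ?scale0r.
Qed.

End VectorSums.

(** The commutation rule on two generators. The identity part of the braiding gives the same
    monomial on both sides; the other part collapses by a cup relation on the left and by a cap
    relation on the right, to the same multiple of [hmon q]. *)
Lemma hmon_r0 k m j l (q : mon) :
  \sum_n \sum_p r0 p j n l *: hmon ((k, n) :: (m, p) :: q) =
  \sum_n \sum_p r0 m p k n *: hmon ((p, j) :: (n, l) :: q).
Proof.
transitivity (hmon ((k, j) :: (m, l) :: q) + (cup l j * cup k m) *: hmon q).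
  under eq_bigr => n _.
    under eq_bigr => p _ do rewrite /r0 scalerDl -!scalerA.
    rewrite big_split /= -scaler_sumr (sumv_eq (fun p => hmon [:: (k, n), (m, p) & q])).
    under [X in _ + X]eq_bigr => p _ do rewrite scaleC.
    rewrite -scaler_sumr (sumv_cupr (fun p => hmon [:: (k, n), (m, p) & q])).
    over.
  rewrite big_split /= (sumv_eq (fun n => hmon [:: (k, n), (m, l) & q])).
  congr (_ + _); rewrite -scalerA -scaler_sumr; congr (_ *: _).
  exact: ((hmon_natural f).1 [::]).
under [RHS]eq_bigr => n _.
  under eq_bigr => p _ do rewrite /r0 [k == p]eq_sym [m == n]eq_sym scalerDl -!scalerA.
  rewrite big_split /= (sumv_eq (fun p => (n == m)%:R *: hmon [:: (p, j), (n, l) & q])).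
  rewrite -scaler_sumr; over.
rewrite big_split /= (sumv_eq (fun n => hmon [:: (k, j), (n, l) & q])).
congr (_ + _); rewrite -scaler_sumr mulrC -scalerA; congr (_ *: _).
rewrite exchange_big /=.
under eq_bigr => p _ do rewrite (sumv_cupl (fun n => hmon [:: (p, j), (n, l) & q])).
by rewrite ((hmon_natural f).2 [::]) cup_dualC.
Qed.

Lemma csum_scalel (U : lmodType K) w (F : mon -> mon -> K^o) (u : U) :
  (csum w F : K) *: u = csum w (fun a b => (F a b : K) *: u).
Proof. by rewrite /csum scaler_suml. Qed.

Lemma csum_hmull w (F : mon -> mon -> H) x :
  x * csum w F = csum w (fun a b => x * F a b).
Proof. by rewrite /csum mulr_sumr. Qed.

Lemma csum_hmulr w (F : mon -> mon -> H) x :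
  csum w F * x = csum w (fun a b => F a b * x).
Proof. by rewrite /csum mulr_suml. Qed.

Lemma letter_comm i j w :
  \sum_m csum w (fun c d => r1 m j d *: (hmon (c ++ [:: (i, m)]) : H)) =
  \sum_m csum w (fun c d => r1 i m c *: (hmon ((m, j) :: d) : H)).
Proof.
elim: w j => [|[k l] w IH] j.
  under eq_bigr => m _ do rewrite csum0.
  under [RHS]eq_bigr => m _ do rewrite csum0 /= eq_sym.
  by rewrite (sumv_eq (fun m => hmon [:: (i, m)])) (sumv_eq (fun m => hmon [:: (m, j)])).
transitivity (\sum_n \sum_p r0 p j n l *: (hmon [:: (k, n)] *
   \sum_m csum w (fun c d => r1 m p d *: (hmon (c ++ [:: (i, m)]) : H)))).
  under eq_bigr => m _ do rewrite csum_cons.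
  rewrite exchange_big; apply: eq_bigr => n _ /=.
  under [RHS]eq_bigr => p _ do rewrite mulr_sumr scaler_sumr.
  rewrite [RHS]exchange_big; apply: eq_bigr => m _ /=.
  under [RHS]eq_bigr => p _ do rewrite csum_hmull -csumZ.
  rewrite -csum_sum; apply: eq_csum => c d; rewrite scaler_suml.
  by apply: eq_bigr => p _; rewrite -scalerAr -hmon_cat scalerA mulrC.
under eq_bigr => n _ do under eq_bigr => p _ do rewrite IH.
transitivity (\sum_m csum w (fun c d => r1 i m c *:
   \sum_n \sum_p r0 p j n l *: (hmon ((k, n) :: (m, p) :: d) : H))).
  under eq_bigr => n _.
    under eq_bigr => p _ do rewrite mulr_sumr scaler_sumr.
    rewrite exchange_big /=; over.
  rewrite exchange_big; apply: eq_bigr => m _ /=.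
  under eq_csum => c d do rewrite scaler_sumr.
  rewrite csum_sum; apply: eq_bigr => n _.
  under eq_csum => c d do rewrite scaler_sumr.
  rewrite csum_sum; apply: eq_bigr => p _.
  rewrite csum_hmull -csumZ; apply: eq_csum => c d.
  by rewrite -scalerAr -hmon_cat scaleC.
under eq_bigr => m _ do under eq_csum => c d do rewrite hmon_r0.
under [RHS]eq_bigr => m _ do rewrite csum_cons.
transitivity (\sum_m \sum_n \sum_p csum w (fun c d => (r1 i m c * r0 m p k n) *:
   (hmon ((p, j) :: (n, l) :: d) : H))).
  apply: eq_bigr => m _; under [RHS]eq_bigr => n _ do rewrite -csum_sum.
  rewrite -[RHS]csum_sum; apply: eq_csum => c d.
  rewrite scaler_sumr; apply: eq_bigr => n _.
  by rewrite scaler_sumr; apply: eq_bigr => p _; rewrite scalerA.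
rewrite exchange_big /=; under eq_bigr => n _ do rewrite exchange_big /=.
rewrite exchange_big /=; apply: eq_bigr => p _; apply: eq_bigr => n _.
rewrite -csum_sum; apply: eq_csum => c d.
by rewrite -scaler_suml.
Qed.

Definition mon_comm (v : mon) := forall w,
  csum v (fun a b => csum w (fun c d => (bichar b d : K) *: (hmon (c ++ a) : H))) =
  csum v (fun a b => csum w (fun c d => (bichar a c : K) *: (hmon (b ++ d) : H))).

(** [w] is split in three and carried to the right past [v], then past [v']. *)
Lemma mon_comm_cat v v' : mon_comm v -> mon_comm v' -> mon_comm (v ++ v').
Proof.
move=> hv hv' w; rewrite !csum_cat.
transitivity (csum v (fun a b => csum v' (fun a' b' => csum w (fun c d =>
  csum c (fun c1 c2 => (bichar b c2 * bichar b' d : K) *: (hmon (c1 ++ a ++ a') : H)))))).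
  apply: eq_csum => a b; apply: eq_csum => a' b'; rewrite csumA.
  by apply: eq_csum => c d; rewrite bichar_catl csum_scalel.
transitivity (csum v (fun a b => csum v' (fun a' b' => csum w (fun c d =>
  csum c (fun c1 c2 => (bichar a c1 * bichar b' d : K) *: (hmon (b ++ c2 ++ a') : H)))))).
  rewrite csumC [RHS]csumC; apply: eq_csum => a' b'.
  rewrite csumC [RHS]csumC; apply: eq_csum => c d.
  transitivity ((bichar b' d : K) *: (csum v (fun a b => csum c (fun c1 c2 =>
     (bichar b c2 : K) *: (hmon (c1 ++ a) : H))) * hmon a')).
    rewrite csum_hmulr -csumZ; apply: eq_csum => a b.
    rewrite csum_hmulr -csumZ; apply: eq_csum => c1 c2.
    by rewrite -scalerAl -hmon_cat -catA scalerA mulrC.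
  rewrite hv csum_hmulr -csumZ; apply: eq_csum => a b.
  rewrite csum_hmulr -csumZ; apply: eq_csum => c1 c2.
  by rewrite -scalerAl -hmon_cat -catA scalerA mulrC.
apply: eq_csum => a b.
transitivity (csum w (fun c d => (bichar a c : K) *: (hmon b * csum v' (fun a' b' =>
  csum d (fun d1 d2 => (bichar b' d2 : K) *: (hmon (d1 ++ a') : H)))))).
  under eq_csum => a' b' do rewrite csumA.
  rewrite csumC; apply: eq_csum => c d.
  rewrite csum_hmull -csumZ; apply: eq_csum => a' b'.
  rewrite csum_hmull -csumZ; apply: eq_csum => d1 d2.
  by rewrite -scalerAr -hmon_cat scalerA.
under eq_csum => c d do rewrite hv'.
transitivity (csum v' (fun a' b' => csum w (fun c d => csum c (fun c1 c2 =>
   (bichar a c1 * bichar a' c2 : K) *: (hmon (b ++ b' ++ d) : H))))); last first.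
  apply: eq_csum => a' b'; apply: eq_csum => c d.
  by rewrite bichar_catl csum_scalel catA.
under [RHS]eq_csum => a' b' do rewrite csumA.
rewrite csumC; apply: eq_csum => c d.
rewrite csum_hmull -csumZ; apply: eq_csum => a' b'.
rewrite csum_hmull -csumZ; apply: eq_csum => d1 d2.
by rewrite -scalerAr -hmon_cat scalerA.
Qed.

Lemma mon_comm_all v : mon_comm v.
Proof.
elim: v => [|[i j] v IH].
  move=> w; rewrite !csum0.
  under eq_csum => c d do rewrite cats0.
  by rewrite /= (csum_eps2 w hmon) (csum_eps1 w hmon).
rewrite -cat1s; apply: mon_comm_cat => // w; rewrite !csum_cons.
transitivity (\sum_m csum w (fun c d => r1 m j d *: (hmon (c ++ [:: (i, m)]) : H))).
  by apply: eq_bigr => m _; rewrite csum0; apply: eq_csum => c d; rewrite bichar1.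
rewrite letter_comm.
by apply: eq_bigr => m _; rewrite csum0; apply: eq_csum => c d; rewrite bichar1.
Qed.

End CotriangularStructure.

Section Symmetry.
Variables (K : fieldType) (f : tlForm K).
Notation mon := (seq (f * f)).
Notation H := (fhopf f).

Lemma csum_sumK (T : Type) (r : seq T) w (F : T -> mon -> mon -> K) :
  \sum_(t <- r) (csum (U := K^o) w (F t) : K) =
  csum (U := K^o) w (fun a b => \sum_(t <- r) F t a b : K).
Proof. exact/esym/(@csum_sum K f K^o T r w F). Qed.

Lemma letter_sym i j (w : mon) :
  \sum_m (csum w (fun c d => r1 i m c * bichar d [:: (m, j)] : K^o) : K) =
  (i == j)%:R * (eps w : K).
Proof.
elim: w i j => [|[k l] w IH] i j.
  rewrite (eq_bigr (fun m => (i == m)%:R * (m == j)%:R)) => [|m _].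
    by rewrite sum_eqC /eps big_nil mulr1.
  by rewrite csum0 /= eps_cons /eps big_nil mulr1.
transitivity (\sum_p \sum_q (\sum_n \sum_m r0 p m k n * r0 n l m q) *
   (csum w (fun c d => r1 i p c * bichar d [:: (q, j)] : K^o) : K)).
  transitivity (\sum_m \sum_n \sum_p \sum_q r0 p m k n * r0 n l m q *
    (csum w (fun c d => r1 i p c * bichar d [:: (q, j)] : K^o) : K)).
    apply: eq_bigr => m _; rewrite csum_cons; apply: eq_bigr => n _.
    under [RHS]eq_bigr => p _ do (under eq_bigr => q _ do rewrite -csumMl; rewrite csum_sumK).
    rewrite csum_sumK; apply: (@eq_csum K f K^o) => c d /=.
    rewrite csum_cons mulr_suml; apply: eq_bigr => p _.
    rewrite mulr_sumr; apply: eq_bigr => q _.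
    by rewrite csum0 /= sum_eqC; ring.
  rewrite exchange_big /=; under eq_bigr => n _ do rewrite exchange_big /=.
  rewrite exchange_big /=; apply: eq_bigr => p _.
  under eq_bigr => n _ do rewrite exchange_big /=.
  rewrite exchange_big /=; apply: eq_bigr => q _.
  rewrite mulr_suml; apply: eq_bigr => n _.
  by rewrite mulr_suml; apply: eq_bigr => m _.
under eq_bigr => p _ do under eq_bigr => q _ do rewrite exchange_big r0_unitary -mulrA.
under eq_bigr => p _ do rewrite sum_eqC.
by rewrite -mulr_sumr IH eps_cons /= mulrCA.
Qed.

Definition mon_sym (v : mon) := forall w,
  csum v (fun a b => csum w (fun c d => bichar a c * bichar d b : K^o)) = eps v * eps w.

(** With [w] split in four, the two middle factors carry the identity for [v']. They reduce to
    counits, which leaves the identity for [v]. *)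
Lemma mon_sym_cat v v' : mon_sym v -> mon_sym v' -> mon_sym (v ++ v').
Proof.
move=> hv hv' w; rewrite csum_cat eps_cat [eps v * _]mulrC -mulrA -hv -csumMl.
apply: eq_csum => a b; rewrite -csumMl.
transitivity (csum v' (fun a' b' => csum w (fun c d => csum c (fun c1 c2 =>
  csum d (fun d1 d2 => bichar a c1 * bichar a' c2 * (bichar d1 b' * bichar d2 b) : K^o))))).
  apply: eq_csum => a' b'; apply: eq_csum => c d.
  rewrite bichar_catl bichar_catr -csumMr; apply: eq_csum => c1 c2.
  by rewrite -csumMl.
under eq_csum => a' b' do rewrite csumA.
rewrite csumC; apply: eq_csum => c g.
under eq_csum => a' b' do rewrite -(csumA g (fun x y z =>
   bichar a c * bichar a' x * (bichar y b' * bichar z b) : K^o)).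
rewrite csumC.
transitivity (csum g (fun h d => eps h *: (eps v' * (bichar a c * bichar d b) : K^o))); last first.
  exact: (csum_eps1 g (fun d => eps v' * (bichar a c * bichar d b) : K^o)).
apply: eq_csum => h d; rewrite -[RHS]/(_ * _) mulrA [eps h * _]mulrC -hv' -csumMr.
apply: eq_csum => a' b'; rewrite -csumMr; apply: eq_csum => c2 d1; ring.
Qed.

Lemma mon_sym_all v : mon_sym v.
Proof.
elim: v => [|[i j] v IH].
  move=> w; rewrite csum0 {1}/eps big_nil mul1r /=.
  rewrite -[RHS](csum_eps1 w (fun d => eps d : K^o)); apply: eq_csum => c d.
  by rewrite bichar_nil.
rewrite -cat1s; apply: mon_sym_cat => // w; rewrite csum_cons.
rewrite eps_cons {1}/eps big_nil mulr1 -letter_sym.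
by apply: eq_bigr => m _; rewrite csum0; apply: eq_csum => c d; rewrite bichar1.
Qed.

Definition fform (x y : H) : K^o := hlift (fun v => hlift (bichar v : mon -> K^o) y) x.

Lemma fform_nat (y : H) : natural (fun v : mon => hlift (bichar v : mon -> K^o) y).
Proof.
apply: natural_sum => p; apply: naturalZ; exact: bichar_natl.
Qed.

Lemma fform_linl y : linear (fform^~ y).
Proof. exact: hlift_linear (fform_nat y). Qed.

Lemma fform_linr x : linear (fform x).
Proof.
move=> a y z; rewrite /fform /hlift /mon_eval scaler_sumr -big_split.
apply: eq_bigr => p _ /=; rewrite scaleC -scalerDr; congr (_ *: _).
exact: (hlift_linear (bichar_natr p.2)).
Qed.

Lemma fform_mon v w : fform (hmon v) (hmon w) = bichar v w.
Proof.
rewrite /fform hlift_mon; last exact: fform_nat.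
by rewrite hlift_mon //; exact: bichar_natr.
Qed.

Lemma fform_bilinear : bilinear_for *:%R *:%R fform.
Proof. by split=> [y|x]; [exact: fform_linl|exact: fform_linr]. Qed.

HB.instance Definition _ := bilinear_isBilinear.Build K H H K^o
  (GRing.Scale.Law.clone _ _ *:%R _) (GRing.Scale.Law.clone _ _ *:%R _) fform fform_bilinear.

Lemma lin_fforml (U : lmodType K) (g : U -> H) y : linear g -> linear (fun u => fform (g u) y).
Proof. by move=> hg a u v; rewrite hg fform_linl. Qed.

Lemma lin_fformr (U : lmodType K) (g : U -> H) x : linear g -> linear (fun u => fform x (g u)).
Proof. by move=> hg a u v; rewrite hg fform_linr. Qed.

Ltac flin := repeat first
  [ exact: lin_id | apply: lin_fforml | apply: lin_fformr
  | apply: lin_tensl | apply: lin_tensr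
  | apply: lin_mull | apply: lin_mulr | apply: lin_scalel | apply: lin_scaler
  | apply: lin_tsuml | apply: lin_tsumr | exact: linearP
  | lazymatch goal with
    | |- GRing.linear_for _ _ => fail
    | |- bilinear_for _ _ _ => split
    | |- forall _, _ => move=> ?
    end ].

Lemma fform_mull x y z :
  fform (x * y) z = \sw_(z1, z2 <- fcomul z) fform x z1 * fform y z2 :> K^o.
Proof.
apply: (fhopf_lin_ext (g := fun x => fform (x * y) z)
  (g' := fun x => \sw_(z1, z2 <- fcomul z) (fform x z1 * fform y z2 : K^o))) x;
  [by flin|by flin|move=> u].
apply: (fhopf_lin_ext (g := fun y => fform (hmon u * y) z)
  (g' := fun y => \sw_(z1, z2 <- fcomul z) (fform (hmon u) z1 * fform y z2 : K^o))) y;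
  [by flin|by flin|move=> v].
apply: (fhopf_lin_ext (g := fun z => fform (hmon u * hmon v) z)
  (g' := fun z => \sw_(z1, z2 <- fcomul z) (fform (hmon u) z1 * fform (hmon v) z2 : K^o))) z;
  [by flin|by flin|move=> w].
rewrite -hmon_cat fform_mon tsum_fcomul; last by flin.
by rewrite bichar_catl; apply: eq_csum => a b; rewrite !fform_mon.
Qed.

Lemma fform_mulr x y z :
  fform x (y * z) = \sw_(x1, x2 <- fcomul x) fform x1 z * fform x2 y :> K^o.
Proof.
apply: (fhopf_lin_ext (g := fun x => fform x (y * z))
  (g' := fun x => \sw_(x1, x2 <- fcomul x) (fform x1 z * fform x2 y : K^o))) x;
  [by flin|by flin|move=> u].
apply: (fhopf_lin_ext (g := fun y => fform (hmon u) (y * z))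
  (g' := fun y => \sw_(x1, x2 <- fcomul (hmon u)) (fform x1 z * fform x2 y : K^o))) y;
  [by flin|by flin|move=> v].
apply: (fhopf_lin_ext (g := fun z => fform (hmon u) (hmon v * z))
  (g' := fun z => \sw_(x1, x2 <- fcomul (hmon u)) (fform x1 z * fform x2 (hmon v) : K^o))) z;
  [by flin|by flin|move=> w].
rewrite -hmon_cat fform_mon tsum_fcomul; last by flin.
by rewrite bichar_catr; apply: eq_csum => a b; rewrite !fform_mon.
Qed.

Lemma fform_comm x y :
  \sw_(x1, x2 <- fcomul x) \sw_(y1, y2 <- fcomul y) fform x2 y2 *: (y1 * x1) =
  \sw_(x1, x2 <- fcomul x) \sw_(y1, y2 <- fcomul y) fform x1 y1 *: (x2 * y2).
Proof.
apply: (fhopf_lin_ext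
  (g := fun x => \sw_(x1, x2 <- fcomul x) \sw_(y1, y2 <- fcomul y)
    fform x2 y2 *: (y1 * x1))
  (g' := fun x => \sw_(x1, x2 <- fcomul x) \sw_(y1, y2 <- fcomul y)
    fform x1 y1 *: (x2 * y2))) x; [by flin|by flin|move=> v].
apply: (fhopf_lin_ext
  (g := fun y => \sw_(x1, x2 <- fcomul (hmon v)) \sw_(y1, y2 <- fcomul y)
    fform x2 y2 *: (y1 * x1))
  (g' := fun y => \sw_(x1, x2 <- fcomul (hmon v)) \sw_(y1, y2 <- fcomul y)
    fform x1 y1 *: (x2 * y2))) y; [by flin|by flin|move=> w].
rewrite [LHS]tsum_fcomul; last by flin.
rewrite [RHS]tsum_fcomul; last by flin.
transitivity (csum v (fun a b => csum w (fun c d => (bichar b d : K) *: (hmon (c ++ a) : H)))).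
  apply: eq_csum => a b; rewrite tsum_fcomul; last by flin.
  by apply: eq_csum => c d; rewrite fform_mon hmon_cat.
rewrite mon_comm_all; apply: eq_csum => a b; rewrite tsum_fcomul; last by flin.
by apply: eq_csum => c d; rewrite fform_mon hmon_cat.
Qed.

Lemma fform_sym x y :
  \sw_(x1, x2 <- fcomul x) \sw_(y1, y2 <- fcomul y)
     (fform x1 y1 * fform y2 x2 : K^o) = fcounit x * fcounit y.
Proof.
apply: (fhopf_lin_ext
  (g := fun x => \sw_(x1, x2 <- fcomul x) \sw_(y1, y2 <- fcomul y)
    (fform x1 y1 * fform y2 x2 : K^o))
  (g' := fun x => fcounit x * fcounit y : K^o)) x; [by flin|by flin|move=> v].
apply: (fhopf_lin_ext
  (g := fun y => \sw_(x1, x2 <- fcomul (hmon v)) \sw_(y1, y2 <- fcomul y)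
    (fform x1 y1 * fform y2 x2 : K^o))
  (g' := fun y => fcounit (hmon v) * fcounit y : K^o)) y; [by flin|by flin|move=> w].
rewrite tsum_fcomul; last by flin.
rewrite !fcounit_mon -mon_sym_all; apply: eq_csum => a b.
rewrite tsum_fcomul; last by flin.
by apply: eq_csum => c d; rewrite !fform_mon.
Qed.

Definition form_cotriangular : cotriangular_structure (formHopf f) :=
  @Cotriangular K (formHopf f) fform fform_mull fform_mulr fform_comm fform_sym.

End Symmetry.

(** * The fundamental comodule and its tensor powers *)

Definition colinear (K : fieldType) (H : hopfAlgebra K) (W : lmodType K)
    (rho : coaction H W) (p : W -> W) : Prop :=
  linear p /\ forall w, rho (p w) = \sw_(a, h <- rho w) p a \ot h.

Section FormComodule.
Variables (K : fieldType) (f : tlForm K).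
Notation mon := (seq (f * f)).
Notation H := (fhopf f).

Definition fvec : vectType K := {ffun f -> K^o}.

Lemma dim_fvec : \dim {: fvec} = #|f|.
Proof. by rewrite dimvf /dim /= muln1. Qed.

Definition bvec (i : f) : fvec := [ffun k => (k == i)%:R].

Lemma bvec_sum (v : fvec) : v = \sum_i (v i : K) *: bvec i.
Proof.
apply/ffunP => k; rewrite sum_ffunE.
rewrite (bigD1 k) //= big1 => [|i /negPf hi]; last first.
  by rewrite !ffunE eq_sym hi scaler0.
by rewrite addr0 !ffunE eqxx [RHS]mulr1.
Qed.

Lemma coord_linear i : linear (fun v : fvec => v i : K^o).
Proof. by move=> a u v; rewrite !ffunE. Qed.

Lemma fvec_ext (U : lmodType K) (g g' : fvec -> U) : linear g -> linear g' ->
  (forall i, g (bvec i) = g' (bvec i)) -> forall v, g v = g' v.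
Proof.
move=> L L' e v; rewrite [v]bvec_sum !lin_sum //; apply: eq_bigr => i _.
by rewrite [LHS](scalable_linear L) [RHS](scalable_linear L') /= e.
Qed.

Lemma lin_bigsum (U V : lmodType K) (T : Type) (r : seq T) (F : T -> U -> V) :
  (forall t, linear (F t)) -> linear (fun u => \sum_(t <- r) F t u).
Proof.
by move=> L a u v; rewrite scaler_sumr -big_split; apply: eq_bigr => t _; rewrite L.
Qed.

Definition bcoact (j : f) : fvec \ox H := \sum_i bvec i \ot hmon [:: (i, j)].

Definition fcoact (v : fvec) : fvec \ox H := \sum_j (v j : K) *: bcoact j.

Lemma fcoact_linear : linear fcoact.
Proof.
move=> a u v; rewrite /fcoact scaler_sumr -big_split; apply: eq_bigr => j _ /=.
by rewrite !ffunE scalerDl scalerA.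
Qed.

HB.instance Definition _ :=
  GRing.isLinear.Build K fvec (fvec \ox H) *:%R fcoact fcoact_linear.

Lemma fcoact_bvec j : fcoact (bvec j) = bcoact j.
Proof.
rewrite /fcoact (bigD1 j) //= big1 => [|i /negPf hi]; last by rewrite ffunE hi scale0r.
by rewrite addr0 ffunE eqxx scale1r.
Qed.

Lemma tsum_sum (V W U : lmodType K) (T : Type) (r : seq T) (G : V -> W -> U)
    (x : T -> V) (y : T -> W) : bilinear_for *:%R *:%R G ->
  tsum (\sum_(t <- r) x t \ot y t) G = \sum_(t <- r) G (x t) (y t).
Proof.
move=> hG; rewrite (lin_sum _ _ (tsum_is_linear hG)).
by apply: eq_bigr => t _; rewrite tsum_pure.
Qed.

Lemma fcoactA v :
  \sw_(v0, v1 <- fcoact v) \sw_(w0, w1 <- fcoact v0) w0 \ot (w1 \ot v1) =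
  \sw_(v0, v1 <- fcoact v) v0 \ot comul (formHopf f) v1.
Proof.
apply: (fvec_ext
  (g := fun v => \sw_(v0, v1 <- fcoact v) \sw_(w0, w1 <- fcoact v0) w0 \ot (w1 \ot v1))
  (g' := fun v => \sw_(v0, v1 <- fcoact v) v0 \ot comul (formHopf f) v1)) v;
  [by lin|by lin|move=> j].
rewrite !fcoact_bvec [LHS]tsum_sum; last by lin.
rewrite [RHS]tsum_sum; last by lin.
under eq_bigr => i _ do (rewrite fcoact_bvec tsum_sum; last by lin).
rewrite exchange_big; apply: eq_bigr => i _ /=.
rewrite fcomul_mon csum_cons.
have L : linear (fun y : H \ox H => bvec i \ot y) by lin.
rewrite (lin_sum _ _ L); apply: eq_bigr => k _.
by rewrite csum0.
Qed.

Lemma fcoact_counit v : \sw_(v0, v1 <- fcoact v) counit (formHopf f) v1 *: v0 = v.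
Proof.
apply: (fvec_ext
  (g := fun v => \sw_(v0, v1 <- fcoact v) counit (formHopf f) v1 *: v0)
  (g' := fun v => v)) v; [by lin|by lin|move=> j].
rewrite fcoact_bvec tsum_sum; last by lin.
rewrite (bigD1 j) //= big1 => [|i /negPf hi].
  by rewrite addr0 fcounit_mon eps_cons /eps big_nil eqxx mulr1 scale1r.
by rewrite fcounit_mon eps_cons /= hi mul0r scale0r.
Qed.

Definition fcoaction : coaction (formHopf f) fvec :=
  @Coaction K (formHopf f) fvec fcoact fcoactA fcoact_counit.

Fixpoint tb (n : nat) (s : seq f) : tpow fvec n :=
  match n with
  | 0 => (1 : K^o)
  | m.+1 => if s is i :: s' then tb m s' \ot bvec i else 0
  end.

Fixpoint tc (n : nat) : tpow fvec n -> seq f -> K :=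
  match n with
  | 0 => fun w _ => w
  | m.+1 => fun w s =>
      if s is i :: s' then \sw_(a, b <- w) (tc a s' * b i : K^o) else 0
  end.

Lemma tc_linear n s : linear (fun w : tpow fvec n => tc w s : K^o).
Proof.
elim: n s => [|n IH] [|i s] //=; first by move=> a u v; rewrite scaler0 addr0.
apply: tsum_is_linear; split=> [b|w] a u v.
  by rewrite (IH s) mulrDl -[in LHS]mulrA.
by rewrite (coord_linear i) mulrDr mulrCA.
Qed.

Lemma tc_tb n s t : size s = n -> size t = n -> tc (tb n t) s = (s == t)%:R.
Proof.
elim: n s t => [|n IH] [|i s] [|j t] //= [hs] [ht].
rewrite tsum_pure; last first.
  split=> [b|w] a u v; first by rewrite (tc_linear s) mulrDl -[in LHS]mulrA.
  by rewrite (coord_linear i) mulrDr mulrCA.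
by rewrite IH // ffunE eqseq_cons; do 2 case: eqP => _ //=; rewrite ?mulr1 ?mulr0.
Qed.

Lemma tb_span n (w : tpow fvec n) : w = \sum_(s <- words f n) tc w s *: tb n s.
Proof.
elim: n w => [|n IH] w; first by rewrite big_words0 /= [RHS]mulr1.
have L : linear (fun w : tpow fvec n.+1 => \sum_(s <- words f n.+1) tc w s *: tb n.+1 s).
  by apply: lin_bigsum => s; apply: lin_scalel; exact: (@tc_linear n.+1 s).
apply: (lin_ext (@lin_id _ _) L) w => v w.
have [b1 b2] := @tens_bilinear K (tpow fvec n) fvec.
rewrite {1}[w]bvec_sum (lin_sum _ _ (b2 v)) big_wordsS; apply: eq_bigr => i _.
rewrite [LHS](scalable_linear (b2 v)) /= {1}[v]IH (lin_sum _ _ (b1 (bvec i))) scaler_sumr.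
apply: eq_bigr => s _; rewrite [X in _ *: X](scalable_linear (b1 (bvec i))) /= scalerA.
rewrite tsum_pure; last first.
  split=> [b|c] a u u'; first by rewrite (tc_linear s) mulrDl -[in LHS]mulrA.
  by rewrite (coord_linear i) mulrDr mulrCA.
by rewrite mulrC.
Qed.

Lemma tb_ext n (U : lmodType K) (g g' : tpow fvec n -> U) : linear g -> linear g' ->
  (forall s, size s = n -> g (tb n s) = g' (tb n s)) -> forall w, g w = g' w.
Proof.
move=> L L' e w; rewrite [w]tb_span !lin_sum //; apply: eq_big_words => s hs.
by rewrite [LHS](scalable_linear L) [RHS](scalable_linear L') /= e.
Qed.

Lemma tpow_coaction_tb n t : size t = n ->
  tpow_coaction fcoaction n (tb n t) =
  \sum_(s <- words f n) tb n s \ot hmon (rev (zip s t)).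
Proof.
elim: n t => [|n IH] [|j t] //; first by rewrite big_words0.
move=> [ht]; rewrite -[LHS]/(tens_coact (tpow_coaction fcoaction n) fcoaction (tb n t \ot bvec j)).
rewrite tens_coact_pure IH // -[fcoaction (bvec j)]/(fcoact (bvec j)) fcoact_bvec.
rewrite tsum_sum; last by lin.
rewrite big_wordsS [RHS]exchange_big /=; apply: eq_big_words => s hs.
rewrite tsum_sum; last by lin.
by apply: eq_bigr => i _; rewrite -hmon_cat /= rev_cons cats1.
Qed.

(* [tb] lists the letters of a word from the last tensor factor to the first. *)
Definition te n (s : seq f) : tpow fvec n := tb n (rev s).
Definition tcr n (w : tpow fvec n) (s : seq f) : K := tc w (rev s).

Lemma big_words_rev (U : nmodType) n (G : seq f -> U) :
  \sum_(w <- words f n) G (rev w) = \sum_(w <- words f n) G w.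
Proof.
rewrite -(big_map (@rev f) xpredT); apply: perm_big; apply: uniq_perm.
- by rewrite map_inj_uniq ?words_uniq //; exact: (can_inj (@revK f)).
- exact: words_uniq.
move=> w; rewrite mem_words; apply/mapP/eqP => [[v]|hw].
  by rewrite mem_words => /eqP <- ->; rewrite size_rev.
by exists (rev w); rewrite ?revK // mem_words size_rev hw.
Qed.

Lemma tcr_linear n s : linear (fun w : tpow fvec n => tcr w s : K^o).
Proof. exact: tc_linear. Qed.

Lemma tcr_te n s t : size s = n -> size t = n -> tcr (te n t) s = (s == t)%:R.
Proof.
by move=> hs ht; rewrite /tcr tc_tb ?size_rev // (can_eq (@revK f)).
Qed.

Lemma te_span n (w : tpow fvec n) : w = \sum_(s <- words f n) tcr w s *: te n s.
Proof. by rewrite (big_words_rev n (fun s => tc w s *: tb n s)) -tb_span. Qed.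

Lemma te_ext n (U : lmodType K) (g g' : tpow fvec n -> U) : linear g -> linear g' ->
  (forall s, size s = n -> g (te n s) = g' (te n s)) -> forall w, g w = g' w.
Proof.
move=> L L' e; apply: tb_ext => // s hs; rewrite -(revK s); apply: e.
by rewrite size_rev.
Qed.

Lemma tpow_coaction_te n t : size t = n ->
  tpow_coaction fcoaction n (te n t) =
  \sum_(s <- words f n) te n s \ot hmon (zip s t).
Proof.
move=> ht; rewrite tpow_coaction_tb ?size_rev //.
rewrite -(big_words_rev n (fun s => tb n s \ot hmon (rev (zip s (rev t))))).
by apply: eq_big_words => s hs; rewrite -rev_zip ?revK // hs.
Qed.

Section Colinear.
Variable n : nat.
Notation W := (tpow fvec n).
Notation rho := (tpow_coaction fcoaction n).

Definition mx_of (p : W -> W) (s t : seq f) : K := tcr (p (te n t)) s.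

Definition of_mx (g : seq f -> seq f -> K) (w : W) : W :=
  \sum_(t <- words f n) \sum_(s <- words f n) (tcr w t * g s t) *: te n s.

Lemma of_mx_linear g : linear (of_mx g).
Proof.
apply: lin_bigsum => t; apply: lin_bigsum => s; apply: lin_scalel.
by move=> a u v; rewrite (tcr_linear t) mulrDl -[in LHS]mulrA.
Qed.

Lemma of_mx_te g t : size t = n ->
  of_mx g (te n t) = \sum_(s <- words f n) g s t *: te n s.
Proof.
move=> ht; rewrite -[RHS](@big_words_delta _ _ n (fun t => \sum_(s <- words f n) g s t *: te n s)) //.
apply: eq_big_words => u hu; rewrite /=.
under eq_bigr => s _ do rewrite tcr_te //.
by case: eqP => _; [apply: eq_bigr|rewrite big1] => // s _;
  rewrite ?mul1r // mul0r scale0r.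
Qed.

Lemma mx_ofE p t : linear p -> size t = n ->
  p (te n t) = \sum_(s <- words f n) mx_of p s t *: te n s.
Proof. by move=> _ _; rewrite -te_span. Qed.

Lemma mx_of_ext p p' : linear p -> linear p' ->
  (forall s t, size s = n -> size t = n -> mx_of p s t = mx_of p' s t) ->
  forall w, p w = p' w.
Proof.
move=> L L' e; apply: te_ext => // t ht; rewrite !mx_ofE //.
by apply: eq_big_words => s hs; rewrite e.
Qed.

Lemma mx_of_of_mx g s t : size s = n -> size t = n -> mx_of (of_mx g) s t = g s t.
Proof.
move=> hs ht; rewrite /mx_of of_mx_te //.
rewrite (lin_sum _ _ (tcr_linear s)).
rewrite -[RHS](@big_words_delta _ _ n (fun u => g u t)) //; apply: eq_big_words => u hu.
rewrite (scalable_linear (tcr_linear s)) /= tcr_te // eq_sym.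
by case: eqP => _; rewrite ?scaler0 // [LHS]mulr1.
Qed.

Lemma mx_of_comp p p' s t : linear p -> linear p' -> size s = n -> size t = n ->
  mx_of (fun w => p (p' w)) s t = \sum_(u <- words f n) mx_of p s u * mx_of p' u t.
Proof.
move=> L L' hs ht; rewrite /mx_of {1}(mx_ofE L' ht) (lin_sum _ _ L).
rewrite (lin_sum _ _ (tcr_linear s)); apply: eq_bigr => u _.
by rewrite (scalable_linear L) /= [LHS](scalable_linear (tcr_linear s)) /= mulrC.
Qed.

(** Colinearity at the basis vector [te n t], read through the coordinate [s] on the comodule and
    the functional of [x] on the Hopf algebra. *)
Lemma colinear_comm p : colinear rho p -> comm n (mx_of p).
Proof.
case=> L hp x hx s t hs ht.
have Lx := hlift_linear hx.
pose G (a : W) (h : H) : K^o := (tcr a s : K^o) * hlift x h.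
have bG : bilinear_for *:%R *:%R G.
  split=> [h|w] a u v; rewrite /G; first by rewrite (tcr_linear s) mulrDl -[in LHS]mulrA.
  by rewrite Lx mulrDr mulrCA.
have EL := tsum_is_linear bG.
have bp : bilinear_for *:%R *:%R (fun (a : W) (h : H) => p a \ot h).
  split=> [h|w] a u v; first by rewrite L (@tens_bilinear K W H).1.
  by rewrite (@tens_bilinear K W H).2.
have := congr1 (fun y => tsum y G) (hp (te n t)).
rewrite (tpow_coaction_te ht) (tsum_sum _ _ _ bp) (tsum_sum _ _ _ bG) (mx_ofE L ht).
rewrite linear_sum (lin_sum _ _ EL) /= => e.
transitivity (\sum_(v <- words f n) G (p (te n v)) (hmon (zip v t))); last first.
  by apply: eq_bigr => v _; rewrite /G hlift_mon.
rewrite -e; apply: eq_big_words => v hv.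
rewrite linearZ /= [RHS](scalable_linear EL) /= tpow_coaction_te // (tsum_sum _ _ _ bG).
congr (_ * _); rewrite -[LHS](@big_words_delta _ _ n (fun u => x (zip u v))) //.
apply: eq_big_words => u hu; rewrite /G tcr_te // hlift_mon // eq_sym.
by case: eqP => _; rewrite ?mul1r // mul0r.
Qed.

(** The naturality of diagrams for the map [hmon] itself, with values in the Hopf algebra. *)
Lemma kspan_colinear c : colinear rho (of_mx (kspan n c)).
Proof.
split=> [|w]; first exact: of_mx_linear.
have L := @of_mx_linear (kspan n c).
have bp : bilinear_for *:%R *:%R (fun (a : W) (h : H) => of_mx (kspan n c) a \ot h).
  split=> [h|v] a u u'; first by rewrite L (@tens_bilinear K W H).1.
  by rewrite (@tens_bilinear K W H).2.
apply: (te_ext (g := fun w => rho (of_mx (kspan n c) w))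
  (g' := fun w => \sw_(a, h <- rho w) of_mx (kspan n c) a \ot h)) w.
- by move=> a u v; rewrite L linearP.
- by move=> a u v; rewrite linearP (tsum_is_linear bp).
move=> t ht; rewrite (tpow_coaction_te ht) (tsum_sum _ _ _ bp) of_mx_te // linear_sum /=.
transitivity (\sum_(v <- words f n) te n v \ot
  \sum_(s <- words f n) kspan n c s t *: hmon (zip v s)).
  transitivity (\sum_(s <- words f n) \sum_(v <- words f n)
    te n v \ot (kspan n c s t *: hmon (zip v s))).
    apply: eq_big_words => s hs; rewrite linearZ /= tpow_coaction_te // scaler_sumr.
    apply: eq_bigr => v _; exact/esym/(scalable_linear ((@tens_bilinear K W H).2 _)).
  rewrite exchange_big; apply: eq_bigr => v _ /=.
  by rewrite (lin_sum _ _ ((@tens_bilinear K W H).2 _)).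
transitivity (\sum_(v <- words f n) te n v \ot
  \sum_(s <- words f n) kspan n c v s *: hmon (zip s t)).
  apply: eq_big_words => v hv; congr (_ \ot _).
  exact: (kspan_natural _ (hmon_natural f)).
transitivity (\sum_(v <- words f n) \sum_(s <- words f n)
    te n v \ot (kspan n c v s *: hmon (zip s t))).
  by apply: eq_bigr => v _; rewrite (lin_sum _ _ ((@tens_bilinear K W H).2 _)).
rewrite exchange_big; apply: eq_big_words => u hu /=; rewrite of_mx_te //.
rewrite (lin_sum _ _ ((@tens_bilinear K W H).1 _)); apply: eq_bigr => v _.
rewrite [LHS](scalable_linear ((@tens_bilinear K W H).2 _)) /=.
by rewrite [RHS](scalable_linear ((@tens_bilinear K W H).1 _)).
Qed.

End Colinear.

End FormComodule.

(** * Decompositions and idempotents *)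

Section Decompositions.
Variables (K : fieldType) (H : hopfAlgebra K) (W : lmodType K) (rho : coaction H W).

Lemma lin0 (U V : lmodType K) (g : U -> V) : linear g -> g 0 = 0.
Proof. by move=> L; rewrite -[in LHS](scale0r (0 : U)) [LHS](scalable_linear L) /= scale0r. Qed.

Lemma linB (U V : lmodType K) (g : U -> V) u v : linear g -> g (u - v) = g u - g v.
Proof. by move=> L; rewrite -[u - v]addrC -scaleN1r L scaleN1r addrC. Qed.

Lemma subspace0 (U : set W) : Defs.subspace U -> U 0. Proof. by case. Qed.

Lemma subspaceD (U : set W) u v : Defs.subspace U -> U u -> U v -> U (u + v).
Proof. by case=> _ h hu hv; rewrite -[u]scale1r; exact: h. Qed.

Lemma subspaceZ (U : set W) a u : Defs.subspace U -> U u -> U (a *: u).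
Proof. by case=> h0 h hu; rewrite -[_ *: _]addr0; exact: h. Qed.

Lemma subspaceB (U : set W) u v : Defs.subspace U -> U u -> U v -> U (u - v).
Proof. by move=> h hu hv; rewrite -scaleN1r; apply: subspaceD => //; apply: subspaceZ. Qed.

(** The summands are only required to be nonzero: such families can be refined, and one of maximal
    length consists of indecomposables. *)
Definition direct_family k (U : 'I_k -> set W) : Prop :=
  (forall i, subcomodule rho (U i) /\ U i <> [set 0]) /\
  forall w : W, exists! u : {ffun 'I_k -> W}, (forall i, U i (u i)) /\ w = \sum_i u i.

Lemma colinear_bilinear (p : W -> W) : linear p ->
  bilinear_for *:%R *:%R (fun (a : W) (h : H) => p a \ot h).
Proof.
move=> L; split=> [h|w] a u v; first by rewrite L (@tens_bilinear K W H).1.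
by rewrite (@tens_bilinear K W H).2.
Qed.

Lemma colinear_image (p : W -> W) : colinear rho p -> (forall w, p (p w) = p w) ->
  subcomodule rho [set w | p w = w].
Proof.
case=> L hp pp; split.
  split=> [|a u v hu hv] /=; first exact: lin0.
  by rewrite L hu hv.
move=> u hu; exists [seq (p q.1, q.2) | q <- repr (rho u)].
  by move=> q /mapP[q' _ ->] /=; exact: pp.
by rewrite -[in LHS]hu hp big_map.
Qed.

Lemma colinearB (p q : W -> W) : colinear rho p -> colinear rho q -> colinear rho (fun w => p w - q w).
Proof.
move=> [L hp] [M hq]; split=> [a u v|w].
  by rewrite L M scalerBr opprD addrACA.
rewrite linearB hp hq /tsum /seq_eval -sumrB; apply: eq_bigr => t _.
have b1 := (@tens_bilinear K W H).1 t.2.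
exact/esym/(linB _ _ b1).
Qed.

Lemma decomposition_projections k (U : 'I_k -> set W) : direct_family U ->
  exists p : 'I_k -> W -> W,
  [/\ forall i, colinear rho (p i), forall i w, U i (p i w),
      forall w, w = \sum_i p i w, forall i w, U i w -> p i w = w &
      forall i j w, i != j -> p i (p j w) = 0].
Proof.
case=> hU dec.
have /choice[P hP] : forall w, exists u : {ffun 'I_k -> W},
    (forall i, U i (u i)) /\ w = \sum_i u i.
  by move=> w; have [u [hu _]] := dec w; exists u.
have uniq w (u : {ffun 'I_k -> W}) : (forall i, U i (u i)) -> w = \sum_i u i -> P w = u.
  move=> h1 h2; have [u0 [_ e]] := dec w.
  by rewrite -(e _ (hP w)) -(e u).
have sub i : Defs.subspace (U i) by have [[[]]] := hU i.
have Plin i : linear (fun w => P w i).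
  move=> a u v; rewrite (uniq _ [ffun j => a *: P u j + P v j]) ?ffunE //.
    by move=> j; rewrite ffunE; apply: (sub j).2; [exact: (hP u).1|exact: (hP v).1].
  under eq_bigr => j _ do rewrite ffunE.
  by rewrite big_split -scaler_sumr -(hP u).2 -(hP v).2.
have PU i j w : U i w -> P w j = if j == i then w else 0.
  move=> hw; rewrite (uniq _ [ffun l => if l == i then w else 0]) ?ffunE //.
    by move=> l; rewrite ffunE; case: eqP => [->|_] //; exact: subspace0.
  by under eq_bigr => l _ do rewrite ffunE; rewrite sum_delta.
(* On [U i] the coaction only involves vectors of [U i], where the component [j] is the identity or
   zero. *)
have Pcol j i w : U i w -> rho (P w j) = \sw_(a, h <- rho w) P a j \ot h.
  move=> hw; have [[_ hs] _] := hU i; have [s hs1 hs2] := hs w hw.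
  rewrite hs2 (tsum_sum _ _ _ (colinear_bilinear (Plin j))) (PU i) //.
  have [-> |ji] := eqVneq j i.
    by rewrite hs2; apply: eq_big_seq => q /hs1 hq; rewrite (PU i) ?eqxx.
  rewrite linear0 big1_seq // => q /andP[_ /hs1 hq]; rewrite (PU i) // (negPf ji).
  exact: (lin0 ((@tens_bilinear K W H).1 _)).
exists (fun i w => P w i); split.
- move=> i; split=> [|w]; first exact: Plin.
  have EL := tsum_is_linear (colinear_bilinear (Plin i)).
  rewrite {2}(hP w).2 linear_sum (lin_sum _ _ EL) {1}(hP w).2 (lin_sum _ _ (Plin i)).
  rewrite linear_sum; apply: eq_bigr => j _ /=.
  exact: (Pcol i j _ ((hP w).1 j)).
- by move=> i w; exact: (hP w).1.
- by move=> w; exact: (hP w).2.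
- by move=> i w /(PU i i) ->; rewrite eqxx.
- by move=> i j w /negPf ij; rewrite (PU j) ?ij //; exact: (hP w).1.
Qed.

Lemma direct_family_split k (U : 'I_k -> set W) i : direct_family U ->
  ~ indecomposable rho (U i) -> exists U' : 'I_k.+1 -> set W, direct_family U'.
Proof.
case=> hU dec; have [_ Ui0] := hU i; rewrite /indecomposable not_andE => -[|] //.
move=> /existsNP[U1 /existsNP[U2]].
rewrite !not_implyE => -[s1 [s2 [I12 [S12 /not_orP[n1 n2]]]]].
(* The new index [ord0] carries [U1]; the place of [U i] is reused for [U2]. *)
pose U' (j : 'I_k.+1) := if unlift ord0 j is Some l then (if l == i then U2 else U l) else U1.
have U'0 : U' ord0 = U1 by rewrite /U' unlift_none.
have U'S l : U' (lift ord0 l) = if l == i then U2 else U l by rewrite /U' liftK.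
exists U'; split.
  move=> j; rewrite /U'; case: (unlift ord0 j) => [l|] //.
  by case: eqP.
move=> w; have [u [[hu wu] uu]] := dec w.
have := hu i; rewrite -S12 => -[a ha [b hb eab]].
pose v : {ffun 'I_k.+1 -> W} :=
  [ffun j => if unlift ord0 j is Some l then (if l == i then b else u l) else a].
have v0 : v ord0 = a by rewrite ffunE unlift_none.
have vS l : v (lift ord0 l) = if l == i then b else u l by rewrite ffunE liftK.
have sumE (x : 'I_k -> W) y : \sum_l (if l == i then y else x l) = y + \sum_(l | l != i) x l.
  rewrite (bigD1 i) //= eqxx; congr (_ + _).
  by apply: eq_bigr => l /negPf ->.
exists v; split.
  split=> [j|].
    by rewrite /U' ffunE; case: (unlift ord0 j) => [l|] //; case: eqP.
  rewrite wu big_ord_recl v0; under [in RHS]eq_bigr => l _ do rewrite vS.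
  by rewrite sumE addrA eab [LHS](bigD1 i).
move=> x [hx wx].
have x0 : U1 (x ord0) by rewrite -U'0; exact: hx.
have xi : U2 (x (lift ord0 i)) by have := hx (lift ord0 i); rewrite U'S eqxx.
pose y : {ffun 'I_k -> W} :=
  [ffun l => if l == i then x ord0 + x (lift ord0 i) else x (lift ord0 l)].
have uy : u = y.
  apply: uu; split=> [l|].
    rewrite ffunE; case: eqP => [->|/eqP/negPf li].
      by rewrite -S12; exists (x ord0) => //; exists (x (lift ord0 i)).
    by have := hx (lift ord0 l); rewrite U'S li.
  under eq_bigr => l _ do rewrite ffunE.
  by rewrite sumE wx big_ord_recl -addrA (bigD1 i).
have eq1 : a + b = x ord0 + x (lift ord0 i) by rewrite eab uy ffunE eqxx.
have sub1 : Defs.subspace U1 by case: s1.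
have sub2 : Defs.subspace U2 by case: s2.
have d : a - x ord0 = x (lift ord0 i) - b.
  apply/eqP; rewrite subr_eq addrAC eq_sym subr_eq eq1 addrC //.
have : (U1 `&` U2) (a - x ord0).
  by split; [exact: subspaceB|rewrite d; exact: subspaceB].
rewrite I12 => /= d0; have ea : a = x ord0 by apply/eqP; rewrite -subr_eq0 d0.
have eb : x (lift ord0 i) = b by apply/eqP; rewrite -subr_eq0 -d d0.
apply/ffunP => j; case: (unliftP ord0 j) => [l|] ->; last by rewrite v0.
rewrite vS; case: eqP => [->|/eqP/negPf li]; first by rewrite eb.
by rewrite uy ffunE li.
Qed.

(** A direct family of maximal length cannot be split further. The vector [w0] makes the whole space
    a family of length 1, and [N] bounds the lengths. *)
Lemma indec_decomposition_exists N (w0 : W) : w0 <> 0 ->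
  (forall k (U : 'I_k -> set W), direct_family U -> (k <= N)%N) ->
  exists k (U : 'I_k -> set W), indec_decomposition rho U.
Proof.
move=> hw0 hN.
pose P k := `[< exists U : 'I_k -> set W, direct_family U >].
have exP : exists k, P k.
  exists 1%N; apply/asboolP; exists (fun _ => setT); split.
    move=> _; split.
      split=> // u _; exists (repr (rho u)) => //.
      by rewrite -[LHS]tsum_tens.
    by move=> e; apply: hw0; have : [set: W] w0 by []; rewrite e.
  move=> w; exists [ffun=> w]; split=> [|u [_ ->]].
    by split=> //; rewrite big_ord1 ffunE.
  by apply/ffunP => i; rewrite ffunE (ord1 i) big_ord1.
have bP k : P k -> (k <= N)%N by move/asboolP => [U]; exact: hN.
case: (ex_maxnP exP bP) => k /asboolP[U hU] max.
exists k, U; split; last by case: hU.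
move=> i; split; first by case: hU => h _; case: (h i).
apply: contrapT => ni; have [U' hU'] := direct_family_split hU ni.
suff : (k.+1 <= k)%N by rewrite ltnn.
by apply: max; apply/asboolP; exists U'.
Qed.

(** [U i] is the direct sum of the images of [q] and [p i - q], both subcomodules, so one of them is
    zero. *)
Lemma indec_primitive k (U : 'I_k -> set W) (p : 'I_k -> W -> W) i (q : W -> W) :
  indecomposable rho (U i) -> (forall w, U i (p i w)) ->
  (forall w, U i w -> p i w = w) -> colinear rho (p i) -> colinear rho q ->
  (forall w, q (q w) = q w) -> (forall w, p i (q w) = q w) -> (forall w, q (p i w) = q w) ->
  (forall w, q w = 0) \/ (forall w, q w = p i w).
Proof.
move=> [_ ind] pU Up cp cq qq pq qp.
pose r w := p i w - q w.
have cr : colinear rho r by exact: colinearB.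
have pp w : p i (p i w) = p i w by exact: Up.
have [Lp _] := cp; have [Lq _] := cq.
have pB u v := linB u v Lp; have qB u v := linB u v Lq.
have q0 := lin0 Lq; have p0 := lin0 Lp.
have rr w : r (r w) = r w by rewrite /r pB qB pp pq qp qq subrr subr0.
have := ind _ _ (colinear_image cq qq) (colinear_image cr rr).
case.
- apply/seteqP; split=> [w [/= h1 h2]|w /= ->].
    by rewrite -h2 /r -{1}h1 pq subrr.
  by split; rewrite /= ?/r ?q0 ?p0 ?subr0.
- apply/seteqP; split=> [w [a /= ha [b /= hb <-]]|w hw].
    suff -> : a + b = p i (a + b) by exact: pU.
    have pa : p i a = a by rewrite -ha pq.
    have pb : p i b = b by rewrite -hb /r pB pp pq.
    by rewrite -{2}[a]scale1r Lp scale1r pa pb.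
  exists (q w) => /=; first exact: qq.
  exists (r w) => /=; first exact: rr.
  by rewrite /r Up // addrC subrK.
- move=> e; left=> w; have : [set w | q w = w] (q w) by exact: qq.
  by rewrite e.
- move=> e; right=> w; have : [set w | r w = w] (r w) by exact: rr.
  by rewrite e /= => /eqP; rewrite subr_eq0 => /eqP.
Qed.

End Decompositions.

(** * Primitive idempotents in an algebra of matrices closed under adjoints *)

Section StarAlgebra.
Variables (K : numClosedFieldType) (N' : nat).
Local Notation N := N'.+1.
Implicit Types x y z : 'M[K]_N.

Definition adj m n (A : 'M[K]_(m, n)) : 'M[K]_(n, m) := (map_mx Num.conj A)^T.

Lemma adjE m n (A : 'M[K]_(m, n)) i j : adj A i j = (A j i)^*.
Proof. by rewrite !mxE. Qed.

Lemma adjM m n p (A : 'M[K]_(m, n)) (B : 'M[K]_(n, p)) : adj (A *m B) = adj B *m adj A.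
Proof. by rewrite /adj map_mxM trmx_mul. Qed.

Lemma adjK m n (A : 'M[K]_(m, n)) : adj (adj A) = A.
Proof. by apply/matrixP => i j; rewrite !adjE conjCK. Qed.

Lemma adj0 m n : adj (0 : 'M[K]_(m, n)) = 0.
Proof. by apply/matrixP => i j; rewrite adjE !mxE conjC0. Qed.

Lemma adjB m n (A B : 'M[K]_(m, n)) : adj (A - B) = adj A - adj B.
Proof. by apply/matrixP => i j; rewrite !mxE rmorphB. Qed.

Lemma adj_mul_eq0 m n (A : 'M[K]_(m, n)) : adj A *m A = 0 -> A = 0.
Proof.
move=> h; apply/matrixP => i j; rewrite mxE.
have /eqP := congr1 (fun M : 'M[K]_n => M j j) h; rewrite !mxE.
rewrite psumr_eq0 => [|l _]; last by rewrite adjE mulrC mul_conjC_ge0.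
move/allP => /(_ i); rewrite mem_index_enum => /(_ isT) /=.
by rewrite adjE mulf_eq0 conjC_eq0 orbb => /eqP.
Qed.

Variable B : 'M[K]_N -> Prop.
Hypothesis B1 : B 1.
Hypothesis BZD : forall a x y, B x -> B y -> B (a *: x + y).
Hypothesis BM : forall x y, B x -> B y -> B (x * y).
Hypothesis Badj : forall x, B x -> B (adj x).

Lemma alg_zero : B 0.
Proof. by have := BZD (-1) B1 B1; rewrite scaleN1r addNr. Qed.

Lemma alg_scale a x : B x -> B (a *: x).
Proof. by move=> h; rewrite -[_ *: _]addr0; apply: BZD => //; exact: alg_zero. Qed.

Lemma alg_add x y : B x -> B y -> B (x + y).
Proof. by move=> hx hy; rewrite -[x]scale1r; exact: BZD. Qed.

Lemma alg_horner z p : B z -> B (horner_mx z p).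
Proof.
move=> hz; elim/poly_ind: p => [|p c IH]; first by rewrite rmorph0; exact: alg_zero.
rewrite rmorphD rmorphM /= horner_mx_X horner_mx_C; apply: alg_add; first exact: BM.
by rewrite -scalemx1; exact: alg_scale.
Qed.

(** Write the characteristic polynomial as p1 times a power of X, with p1(0) nonzero, and let u =
    p1(z). If z^(k+2) u = 0, then z^(k+1) u multiplied on the left by its adjoint is 0, so z^(k+1) u
    = 0; descending, z u = 0. Dividing by p1(0) expresses z through z^2. *)
Lemma hermitian_regular z : adj z = z -> exists q, z = z * z * horner_mx z q.
Proof.
move=> hz; set p := char_poly z.
have p0 : p != 0 by rewrite monic_neq0 // char_poly_monic.
have := Cayley_Hamilton z; rewrite -/p.
have [a [p1 np1 ->]] := multiplicity_XsubC p 0; rewrite p0 /= in np1.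
rewrite subr0 rmorphM rmorphXn /= horner_mx_X; set u := horner_mx z p1 => uz.
have zu (q : {poly K}) : z * horner_mx z q = horner_mx z q * z by exact: comm_mx_horner.
have adjX k : adj (z ^+ k) = z ^+ k.
  elim: k => [|k IH]; last first.
    by rewrite [in LHS]exprS [RHS]exprSr -[LHS]/(adj (z *m z ^+ k)) adjM IH hz.
  by apply/matrixP => i j; rewrite expr0 adjE !mxE conjC_nat eq_sym.
have desc k : z ^+ k.+2 * u = 0 -> z ^+ k.+1 * u = 0.
  move=> h; apply: adj_mul_eq0.
  rewrite -[X in adj X]/(z ^+ k.+1 *m u) adjM adjX -mulmxA -[X in adj u *m X]/(z ^+ k.+1 * (z ^+ k.+1 * u)).
  by rewrite mulrA -exprD addSnnS exprD -mulrA h mulr0 mulmx0.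
have zu0 : z * u = 0.
  have : z ^+ a.+1 * u = 0.
    have -> : z ^+ a.+1 * u = z * (u * z ^+ a).
      by rewrite exprS -mulrA; congr (_ * _); elim: (a) => [|k IH];
        rewrite ?mul1r ?mulr1 // exprS -mulrA IH mulrA zu mulrA.
    by rewrite uz mulr0.
  by elim: (a) => [|k IH] // /desc.
have [q hq] : exists q, p1 - p1.[0]%:P = q * ('X - 0%:P).
  by apply/factor_theorem; rewrite /root !hornerE subrr.
have c0 : p1.[0] != 0 by [].
have ue : u = horner_mx z q * z + p1.[0]%:M.
  have e : p1 = q * ('X - 0%:P) + p1.[0]%:P by rewrite -hq subrK.
  by rewrite /u {1}e subr0 rmorphD rmorphM /= horner_mx_X horner_mx_C.
exists (- (p1.[0])^-1 *: q).
rewrite horner_mxZ -scalerAr scaleNr.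
move: zu0; rewrite ue mulrDr -zu mulrA => /eqP.
rewrite addrC addr_eq0 => /eqP e.
have -> : z * z * horner_mx z q = - (p1.[0] *: z).
  by rewrite -[LHS]opprK -e -[z * _]/(z *m _) mul_mx_scalar.
by rewrite scalerN opprK scalerA mulVf // scale1r.
Qed.

(* With [z = y y^*], the kernel of [z] is that of [y^*], so [z q(z)] is the
   orthogonal projection onto the image of [y]. *)
Lemma star_regular y : B y -> exists2 h, B h & y * h * y = y.
Proof.
move=> By; have Bz := BM By (Badj By).
have [|q hq] := @hermitian_regular (y * adj y); first by rewrite -[LHS]/(adj (_ *m _)) adjM adjK.
set z := y * adj y in Bz hq *.
exists (adj y * horner_mx z q); first by apply: BM; [exact: Badj|exact: alg_horner].
rewrite mulrA -/z; apply/eqP; rewrite -subr_eq0.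
have zq : z * horner_mx z q = horner_mx z q * z by exact: comm_mx_horner.
have e0 : (z * horner_mx z q * y - y) *m adj y = 0.
  rewrite mulmxBl; apply/eqP; rewrite subr_eq0; apply/eqP.
  rewrite -[LHS]/(z * horner_mx z q * y * adj y) -mulrA -/z -[RHS]/z.
  by rewrite -mulrA -zq mulrA -hq.
set t := _ - y in e0 *.
apply/eqP; rewrite -[t]adjK (_ : adj t = 0) ?adj0 //; apply: adj_mul_eq0.
have et : adj t = adj y *m adj (z * horner_mx z q) - adj y by rewrite /t adjB adjM.
by rewrite adjK et mulmxBr mulmxA e0 mul0mx subr0.
Qed.

Section Primitive.
Variables (k : nat) (e : 'I_k -> 'M[K]_N).
Hypothesis Be : forall i, B (e i).
Hypothesis e_neq0 : forall i, e i != 0.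
Hypothesis ee : forall i j, e i * e j = if i == j then e i else 0.
Hypothesis e_sum : \sum_i e i = 1.
Hypothesis e_prim : forall i a, B a -> a * a = a -> a * e i = a -> e i * a = a ->
  a = 0 \/ a = e i.

Lemma e_idem i : e i * e i = e i. Proof. by rewrite ee eqxx. Qed.

(** With [y * h * y = y], the element [y * h * e i] is an idempotent of the corner that fixes [y]
    from the left. It is not 0, so primitivity makes it [e i]. *)
Lemma corner_right_inverse i y : B y -> e i * y = y -> y * e i = y -> y != 0 ->
  exists2 h, B h & y * h = e i.
Proof.
move=> By ey ye y0; have [h Bh yhy] := star_regular By.
have := @e_prim i (y * h * e i).
case.
- by apply: BM => //; exact: BM.
- by rewrite -!mulrA (mulrA (e i) y) ey (mulrA h) !mulrA yhy.
- by rewrite -mulrA e_idem.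
- by rewrite !mulrA ey.
- move=> g0; case/eqP: y0; rewrite -yhy -[in RHS](mul0r y) -[in RHS]g0.
  by rewrite -!mulrA ey.
- by move=> g1; exists (h * e i); [exact: BM|rewrite mulrA].
Qed.

(** Were [x] not a multiple of [e i], every [x - r *: e i] would be right invertible in the corner,
    and so would their product over the eigenvalues; Cayley-Hamilton makes that product 0. *)
Lemma corner_scalar i x : B x -> e i * x = x -> x * e i = x -> exists c, x = c *: e i.
Proof.
move=> Bx ex xe.
have [rs hrs] := closed_field_poly_normal (char_poly x).
have hp : \prod_(r <- rs) (x - r%:M) = 0.
  have := Cayley_Hamilton x; rewrite hrs (monicP (char_poly_monic x)) scale1r rmorph_prod.
  by move=> <-; apply: eq_bigr => r _; rewrite rmorphB /= horner_mx_X horner_mx_C.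
apply: contrapT => nc.
have nz r : x - r *: e i != 0.
  by apply/eqP => /eqP; rewrite subr_eq0 => /eqP h; apply: nc; exists r.
have : exists H, e i * \prod_(r <- rs) (x - r%:M) * H = e i.
  elim: rs {hrs hp} => [|r rs [H IH]]; first by exists 1; rewrite big_nil !mulr1.
  have [||| h _ hh] := @corner_right_inverse i (x - r *: e i) _ _ _ (nz r).
  - by rewrite addrC -scaleNr; exact: BZD.
  - by rewrite mulrBr ex -scalerAr e_idem.
  - by rewrite mulrBl xe -scalerAl e_idem.
  exists (H * h); rewrite big_cons (mulrA (e i)).
  have -> : e i * (x - r%:M) = (x - r *: e i) * e i.
    rewrite mulrBr mulrBl ex xe -scalerAl e_idem -[e i * r%:M]/(e i *m r%:M) mul_mx_scalar //.
  by rewrite !mulrA -(mulrA _ (e i)) -(mulrA _ _ H) IH mulrBl xe -scalerAl e_idem.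
case=> H; rewrite hp mulr0 mul0r => e0.
by have := e_neq0 i; rewrite -e0 eqxx.
Qed.

(** Schur's lemma. A nonzero [X] of this component has a right inverse [e j * h * e i], and left
    multiplication by that element sends the component into the corner at [j], which consists of
    scalars. *)
Lemma corner_line i j : exists b, forall x, B x -> exists c : K, e i * x * e j = c *: b.
Proof.
have [[x0 [Bx0 X0]]|none] := pselect (exists x0, B x0 /\ e i * x0 * e j != 0); last first.
  exists 0 => x Bx; exists 0; rewrite scaler0; apply/eqP/negP => /negP h.
  by apply: none; exists x.
have [X [BX nX eX Xe]] : exists X, [/\ B X, X != 0, e i * X = X & X * e j = X].
  exists (e i * x0 * e j); split=> //; first by apply: BM => //; apply: BM.
    by rewrite !mulrA e_idem.
  by rewrite -mulrA e_idem.
exists X => x Bx.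
have [h Bh XhX] := star_regular BX.
have [c hc] : exists c, X * (e j * h * e i) = c *: e i.
  apply: corner_scalar; first by do !apply: BM => //.
    by rewrite mulrA eX.
  by rewrite -!mulrA e_idem.
have c1 : c *: X = X.
  by rewrite -[in LHS]eX scalerAl -hc !mulrA Xe -(mulrA _ (e i)) eX XhX.
have {}c1 : c = 1.
  apply/eqP; rewrite -subr_eq0; apply/negP => /negP c0.
  have : (c - 1) *: X = 0 by rewrite scalerBl c1 scale1r subrr.
  by move/eqP; rewrite scaler_eq0 (negPf c0) /= (negPf nX).
rewrite c1 scale1r in hc.
have [d hd] : exists d, (e j * h * e i) * (e i * x * e j) = d *: e j.
  apply: corner_scalar; first by do !apply: BM => //.
    by rewrite !mulrA e_idem.
  by rewrite -!mulrA e_idem.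
exists d.
have -> : e i * x * e j = e i * (e i * x * e j) by rewrite !mulrA e_idem.
by rewrite -{1}hc -mulrA hd -scalerAr Xe.
Qed.

(** The k^2 Peirce components e_i B e_j are at most lines, so the coordinates [lam] embed the span
    of [F] into matrices of size k. *)
Lemma free_card m (F : 'I_m -> 'M[K]_N) : (forall t, B (F t)) ->
  (forall c : 'I_m -> K, \sum_t c t *: F t = 0 -> forall t, c t = 0) ->
  (m <= k * k)%N.
Proof.
move=> BF free.
have /choice[b0 hb0] : forall ij : 'I_k * 'I_k, exists b, forall x, B x ->
    exists c : K, e ij.1 * x * e ij.2 = c *: b by move=> [i j]; exact: corner_line.
have /choice[lam hlam] : forall tij : 'I_m * ('I_k * 'I_k), exists c : K,
    e tij.2.1 * F tij.1 * e tij.2.2 = c *: b0 tij.2.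
  by move=> [t ij] /=; exact: hb0.
pose L := \matrix_(t < m) mxvec (\matrix_(i < k, j < k) lam (t, (i, j))).
suff : row_free L by rewrite /row_free => /eqP <-; exact: rank_leq_col.
apply: inj_row_free => v hv; apply/rowP => t; rewrite mxE.
apply: (free (fun t => v 0 t)).
have FE s : F s = \sum_i \sum_j lam (s, (i, j)) *: b0 (i, j).
  rewrite -[F s]mul1r -[1 * _]mulr1 -e_sum mulr_suml mulr_suml.
  apply: eq_bigr => i _; rewrite mulr_sumr; apply: eq_bigr => j _.
  exact: (hlam (s, (i, j))).
under eq_bigr => s _.
  rewrite FE scaler_sumr; under eq_bigr => i _ do rewrite scaler_sumr.
  over.
rewrite exchange_big big1 // => i _; rewrite exchange_big big1 // => j _ /=.
under eq_bigr => s _ do rewrite scalerA.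
rewrite -scaler_suml.
have := congr1 (fun A : 'rV[K]__ => A 0 (mxvec_index i j)) hv.
rewrite !mxE; under eq_bigr => s _ do rewrite mxE mxvecE mxE.
by move=> ->; rewrite scale0r.
Qed.

(** Choose a nonzero row of each [e i]. In a linear relation between these rows, right
    multiplication by [e j] leaves only the row of [e j]. *)
Lemma primitive_card : (k <= N)%N.
Proof.
have /choice[r hr] : forall i, exists r, row r (e i) != 0.
  move=> i; apply: contrapT => h; have := e_neq0 i; rewrite (_ : e i = 0) ?eqxx //.
  apply/row_matrixP => r; rewrite row0; apply/eqP/negP => /negP hr.
  by apply: h; exists r.
pose M := \matrix_(i < k) row (r i) (e i).
suff : row_free M by rewrite /row_free => /eqP <-; exact: rank_leq_col.
apply: inj_row_free => v hv; apply/rowP => j; rewrite mxE.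
have := congr1 (fun A => A *m e j) hv; rewrite mul0mx (mulmx_sum_row v M).
rewrite mulmx_suml (bigD1 j) //= big1 ?addr0 => [|i /negPf ij].
  rewrite rowK -scalemxAl -row_mul -[e j *m e j]/(e j * e j) e_idem => /eqP.
  by rewrite scaler_eq0 (negPf (hr j)) orbF => /eqP.
by rewrite rowK -scalemxAl -row_mul -[e i *m e j]/(e i * e j) ee ij row0 scaler0.
Qed.

End Primitive.

End StarAlgebra.

(** * Carrying identities between diagrams from one form to another *)

Section Transfer.
Variable K : numClosedFieldType.
Implicit Types f : tlForm K.

(** Unbending the last n strands gives back the vectors of the diagrams; pairing with the dual
    diagrams then yields the Gram matrix, which is nondegenerate and common to all forms. *)
Lemma kspan_inj f n c c' :
  (forall s t : seq f, size s = n -> size t = n -> kspan n c s t = kspan n c' s t) ->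
  forall D, D \in dycks (n + n) -> c D = c' D.
Proof.
move=> h D hD; apply/eqP; rewrite -subr_eq0; apply/eqP.
apply: (@tlgram_nondeg K (n + n) (fun D => c D - c' D)) hD => E hE.
under eq_big_seq => D' hD' do rewrite -(tlgramE f hE hD') mulr_suml.
rewrite exchange_big big1_seq //= => w; rewrite mem_words => /eqP hw.
under eq_bigr => D' _ do rewrite -mulrA.
rewrite -mulr_sumr (_ : \sum_(D' <- _) _ = 0) ?mulr0 //.
have := h (take n w) (taurev (drop n w)).
rewrite size_takel ?hw ?leq_addr // size_taurev size_drop hw addnK => /(_ erefl erefl).
rewrite /kspan /kf taurevK cat_take_drop => e.
have : \sum_(D' <- dycks (n + n)) (c D' - c' D') * (ev D' [::] w * sgnw (drop n w)) = 0.
  by under eq_bigr => D' _ do rewrite mulrBl; rewrite sumrB e subrr.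
move/(congr1 (fun x => x * sgnw (drop n w))); rewrite mul0r mulr_suml => e0.
rewrite -[RHS]e0; apply: eq_bigr => D' _.
by rewrite -!mulrA sgnw_sqr mulr1 mulrC.
Qed.

Lemma eq_kspan f n c c' (s t : seq f) : (forall D, D \in dycks (n + n) -> c D = c' D) ->
  kspan n c s t = kspan n c' s t.
Proof. by move=> h; apply: eq_big_seq => D hD; rewrite h. Qed.

(** An equality of combinations for one form is an equality of coefficients, hence holds for every
    form. *)
Lemma kspan_transfer f f' n c c' :
  (forall s t : seq f, size s = n -> size t = n -> kspan n c s t = kspan n c' s t) ->
  forall s t : seq f', kspan n c s t = kspan n c' s t.
Proof. by move=> h s t; apply: eq_kspan; exact: kspan_inj h. Qed.

Lemma kspan_mul n c c' : exists c'', forall f (s t : seq f), size s = n -> size t = n ->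
  \sum_(u <- words f n) kspan n c s u * kspan n c' u t = kspan n c'' s t.
Proof.
have /choice[g hg] : forall DD : seq bool * seq bool, exists zD : K * seq bool,
    DD.1 \in dycks (n + n) -> DD.2 \in dycks (n + n) ->
    zD.2 \in dycks (n + n) /\ forall f (s t : seq f), size s = n -> size t = n ->
      \sum_(u <- words f n) kf DD.1 s u * kf DD.2 u t = zD.1 * kf zD.2 s t.
  move=> [D1 D2] /=.
  case h1: (D1 \in dycks (n + n)); last by exists (0, [::]).
  case h2: (D2 \in dycks (n + n)); last by exists (0, [::]).
  by have [z [D3 h3]] := kf_mul K h1 h2; exists (z, D3).
exists (fun E => \sum_(D1 <- dycks (n + n)) \sum_(D2 <- dycks (n + n))
  (c D1 * c' D2 * (g (D1, D2)).1) * ((g (D1, D2)).2 == E)%:R).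
move=> f s t hs ht; rewrite /kspan.
under eq_bigr => u _ do rewrite mulr_suml.
rewrite exchange_big; under [RHS]eq_bigr => E _ do rewrite mulr_suml.
rewrite [RHS]exchange_big; apply: eq_big_seq => D1 h1 /=.
under eq_bigr => u _ do rewrite mulr_sumr.
rewrite exchange_big; under [RHS]eq_bigr => E _ do rewrite mulr_suml.
rewrite [RHS]exchange_big; apply: eq_big_seq => D2 h2 /=.
have [h3 h4] := hg (D1, D2) h1 h2.
transitivity (c D1 * c' D2 * ((g (D1, D2)).1 * kf (g (D1, D2)).2 s t)).
  by rewrite -h4 // mulr_sumr; apply: eq_bigr => u _ /=; ring.
rewrite -(big_dycks_delta (fun E => kf E s t) h3) mulrA mulr_sumr.
by apply: eq_bigr => E _; rewrite mulrA.
Qed.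

Lemma kspan_id n : exists c, forall f (s t : seq f), size s = n -> size t = n ->
  kspan n c s t = (s == t)%:R.
Proof.
exists (fun D => (nest n == D)%:R) => f s t hs ht.
rewrite /kspan (big_dycks_delta (fun D => kf D s t)) ?kf_nest //.
by rewrite mem_dycks nest_dyck size_nest eqxx.
Qed.

(** Conjugating a natural map and transposing its letters gives a natural map [x'] again, since the
    signs of the plane are real and its dual form is its negative. Commuting with [x'] is, after
    conjugation, the claim for [x]. *)
Lemma comm_plane_adj n (g : seq bool -> seq bool -> K) :
  comm (f := plane K) n g -> comm (f := plane K) n (fun s t => (g t s)^*).
Proof.
move=> hg x hx s u hs hu.
pose x' (w : seq (plane K * plane K)) : K^o := (x [seq (p.2, p.1) | p <- w] : K)^*.
have sgnC (b : plane K) : (sgn b)^* = sgn b by rewrite /= /plane_sgn rmorphXn rmorphN1.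
have sgnN (b : plane K) : sgn (tau b) = - sgn b :> K.
  by case: b; rewrite /= /plane_sgn ?expr0 ?expr1 ?opprK.
have cupN (i j : plane K) : cup (f := dual (plane K)) i j = - cup i j.
  by rewrite cup_dual /cup; case: eqP => [->|_]; rewrite ?sgnN ?opprK // oppr0.
have cupC (i j : plane K) : (cup i j)^* = cup i j.
  by rewrite /cup; case: ifP; rewrite ?conjC0 ?sgnC.
have hx' : natural x'.
  case: hx => h1 h2; split=> p q i j; rewrite /x' map_cat.
    have := h2 [seq (p.2, p.1) | p <- p] [seq (p.2, p.1) | p <- q] i j.
    move/(congr1 (fun z : K => - z^*)); rewrite rmorph_sum /= -sumrN cupN.
    rewrite -[X in _ = - (X)^* -> _]/(_ * _) rmorphM rmorphN /= cupC mulNr opprK.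
    rewrite -[X in _ -> _ = X]/(_ * _) => <-.
    apply: eq_bigr => k _; rewrite map_cat /= -[LHS]/(_ * _) -[X in - X^*]/(_ * _).
    by rewrite rmorphM /= sgnC -mulNr -sgnN.
  have := h1 [seq (p.2, p.1) | p <- p] [seq (p.2, p.1) | p <- q] i j.
  move/(congr1 (fun z : K => - z^*)); rewrite rmorph_sum /= -sumrN.
  rewrite -[X in _ = - (X)^* -> _]/(_ * _) rmorphM /= cupC -mulNr -cupN.
  rewrite -[X in _ -> _ = X]/(_ * _) => <-.
  apply: eq_bigr => k _; rewrite map_cat /= -[LHS]/(_ * _) -[X in - X^*]/(_ * _).
  by rewrite rmorphM /= sgnC -mulNr sgnN opprK.
have zipC (a b : seq (plane K)) : [seq (p.2, p.1) | p <- zip a b] = zip b a.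
  by elim: a b => [|i a IH] [|j b] //=; rewrite IH.
have := hg x' hx' u s hu hs => /(congr1 Num.conj).
rewrite !rmorph_sum /= => e; rewrite -[LHS]/(\sum_(v <- _) (_ : K)).
transitivity (\sum_(v <- words bool n) (g u v * x' (zip v s))^*).
  by apply: eq_bigr => v _; rewrite rmorphM /= /x' conjCK zipC.
rewrite -e; apply: eq_bigr => v _.
by rewrite rmorphM /= /x' conjCK zipC.
Qed.

End Transfer.

(** * Bounds for the number of summands of a tensor power *)

Section SummandBounds.
Variables (K : numClosedFieldType) (f : tlForm K) (n : nat).
Local Notation N' := (2 ^ n).-1.
Local Notation W := (tpow (fvec f) n).
Local Notation rho := (tpow_coaction (fcoaction f) n).
Local Notation pl := (plane K).

Lemma predn_exp2 : N'.+1 = (2 ^ n)%N.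
Proof. by rewrite prednK // expn_gt0. Qed.

Definition pword (i : 'I_N'.+1) : seq bool := nth [::] (words bool n) i.

Lemma size_words_plane : size (words bool n) = N'.+1.
Proof. by rewrite size_words card_bool predn_exp2. Qed.

Lemma size_pword i : size (pword i) = n.
Proof.
by apply/eqP; rewrite -mem_words mem_nth // size_words_plane.
Qed.

Lemma pword_surj s : size s = n -> exists i, pword i = s.
Proof.
move/eqP; rewrite -mem_words => hs; have hi := hs; rewrite -index_mem size_words_plane in hi.
by exists (Ordinal hi); rewrite /pword nth_index.
Qed.

Definition plane_mx (g : seq bool -> seq bool -> K) : 'M[K]_N'.+1 :=
  \matrix_(i, j) g (pword i) (pword j).

Lemma plane_mxP g h : plane_mx g = plane_mx h <->
  forall s t, size s = n -> size t = n -> g s t = h s t.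
Proof.
split=> [e s t|e].
  move=> /pword_surj[i <-] /pword_surj[j <-].
  by have := congr1 (fun M : 'M[K]_N'.+1 => M i j) e; rewrite !mxE.
by apply/matrixP => i j; rewrite !mxE e // size_pword.
Qed.

Lemma plane_mxM g h : plane_mx g * plane_mx h =
  plane_mx (fun s t => \sum_(u <- words bool n) g s u * h u t).
Proof.
apply/matrixP => i j; rewrite !mxE (big_nth [::]) size_words_plane big_mkord.
by apply: eq_bigr => l _; rewrite !mxE.
Qed.

Lemma plane_mx1 : plane_mx (fun s t => (s == t)%:R) = 1.
Proof.
apply/matrixP => i j; rewrite !mxE nth_uniq ?words_uniq // size_words_plane //.
Qed.

Definition tl_alg (A : 'M[K]_N'.+1) : Prop :=
  exists c, A = plane_mx (kspan (f := pl) n c).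

Lemma tl_alg1 : tl_alg 1.
Proof.
have [c hc] := kspan_id K n; exists c; rewrite -plane_mx1; apply/plane_mxP => s t hs ht.
by rewrite hc.
Qed.

Lemma tl_algZD a A B : tl_alg A -> tl_alg B -> tl_alg (a *: A + B).
Proof.
move=> [c ->] [d ->]; exists (fun D => a * c D + d D).
apply/matrixP => i j; rewrite !mxE /kspan mulr_sumr -big_split; apply: eq_bigr => D _ /=.
by rewrite mulrDl mulrA.
Qed.

Lemma tl_algM A B : tl_alg A -> tl_alg B -> tl_alg (A * B).
Proof.
move=> [c ->] [d ->]; have [e he] := kspan_mul n c d; exists e.
by rewrite plane_mxM; apply/plane_mxP => s t hs ht; rewrite -he.
Qed.

Lemma comm_kspan_form (h : tlForm K) (g : seq h -> seq h -> K) : comm n g ->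
  exists c, forall s u, size s = n -> size u = n -> g s u = kspan n c s u.
Proof.
have [gi [gil gir]] := tlgram_inverse K.
exact: (comm_kspan (@tlgramE K h) gil gir).
Qed.

Lemma tl_alg_adj A : tl_alg A -> tl_alg (adj A).
Proof.
move=> [c ->]; have [d hd] := comm_kspan_form (comm_plane_adj (@kspan_comm K pl n c)).
exists d; apply/matrixP => i j; rewrite adjE !mxE -hd ?size_pword //.
Qed.

Lemma tl_alg_free m (D : 'I_m -> seq bool) : injective D ->
  (forall t, D t \in dycks (n + n)) ->
  forall c : 'I_m -> K, \sum_t c t *: plane_mx (kf (f := pl) (D t)) = 0 ->
  forall t, c t = 0.
Proof.
move=> injD hD c e t.
pose c' E := \sum_s c s * (D s == E)%:R.
have : c' (D t) = 0.
  apply: (@kspan_inj K pl n c' (fun _ => 0)) => // s u hs hu.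
  have [i <-] := pword_surj hs; have [j <-] := pword_surj hu.
  have := congr1 (fun M : 'M[K]_N'.+1 => M i j) e; rewrite mxE summxE => e0.
  rewrite /kspan [RHS]big1 => [|E _]; last by rewrite mul0r.
  rewrite -[RHS]e0; under eq_bigr => E _ do rewrite mulr_suml.
  rewrite exchange_big; apply: eq_bigr => l _ /=; rewrite !mxE.
  rewrite -(big_dycks_delta (fun E => kf (f := pl) E (pword i) (pword j)) (hD l)) mulr_sumr.
  by apply: eq_bigr => E _; rewrite -mulrA.
rewrite /c' (bigD1 t) //= eqxx mulr1 big1 ?addr0 // => s /negPf hs.
by rewrite (inj_eq injD) hs mulr0.
Qed.

Section Idempotents.
Variables (k : nat) (U : 'I_k -> set W).
Hypothesis hU : direct_family rho U.

(** The projections of the decomposition commute with the coaction, so they are combinations of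
    diagrams. The same coefficients read in the plane keep all identities between them, while the
    matrices shrink to size 2^n. *)
Lemma plane_idempotents : exists (p : 'I_k -> W -> W) (c : 'I_k -> seq bool -> K),
  [/\ forall i, colinear rho (p i), forall i w, U i (p i w),
      forall i w, U i w -> p i w = w,
      forall i s t, size s = n -> size t = n -> mx_of (p i) s t = kspan n (c i) s t &
  [/\ forall i, plane_mx (kspan (f := pl) n (c i)) != 0,
      forall i j, plane_mx (kspan (f := pl) n (c i)) * plane_mx (kspan (f := pl) n (c j)) =
        if i == j then plane_mx (kspan (f := pl) n (c i)) else 0 &
      \sum_i plane_mx (kspan (f := pl) n (c i)) = 1]].
Proof.
have [p [cp pU sp Up pp]] := decomposition_projections hU.
have Lp i : linear (p i) by case: (cp i).
have /choice[c hc] : forall i, exists c, forall s u, size s = n -> size u = n ->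
    mx_of (p i) s u = kspan n c s u.
  by move=> i; exact: comm_kspan_form (colinear_comm (cp i)).
exists p, c; split=> //; split.
- move=> i; apply/eqP => e0; have [_ []] := hU.1 i.
  apply/seteqP; split=> [w hw|w /= ->]; last by apply: subspace0; have [[]] := hU.1 i.
  rewrite /= -(Up _ _ hw); apply: (mx_of_ext (p' := fun _ => 0)) => //.
    by move=> a u v; rewrite scaler0 addr0.
  move=> s t hs ht; rewrite hc // /mx_of.
  have -> : tcr (0 : W) s = 0 by exact: (lin0 (tcr_linear s)).
  have -> : 0 = kspan (f := f) n (fun _ => 0) s t.
    by rewrite /kspan big1 // => D _; rewrite mul0r.
  apply: (@kspan_transfer K pl f) => s' t' hs' ht'.
  transitivity (0 : K); last by rewrite /kspan big1 // => D _; rewrite mul0r.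
  have [i' <-] := pword_surj hs'; have [j' <-] := pword_surj ht'.
  by have := congr1 (fun M : 'M[K]_N'.+1 => M i' j') e0; rewrite !mxE.
- move=> i j.
  have [d hd] := kspan_mul n (c i) (c j).
  have -> : (if i == j then plane_mx (kspan (f := pl) n (c i)) else 0) =
      plane_mx (kspan (f := pl) n (fun D => if i == j then c i D else 0)).
    case: eqP => // _; apply/matrixP => a b; rewrite !mxE /kspan big1 // => D _.
    by rewrite mul0r.
  rewrite plane_mxM; apply/plane_mxP => s t hs ht.
  transitivity (kspan (f := pl) n d s t); first exact: (hd pl s t hs ht).
  apply: (@kspan_transfer K f pl) => s' t' hs' ht'; rewrite -hd //.
  under eq_big_words => u hu do rewrite -!hc //.
  rewrite -mx_of_comp //; have [<-|ij] := eqVneq i j.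
    rewrite -hc //; congr tcr; exact: Up.
  rewrite /mx_of pp // (lin0 (tcr_linear s')) /kspan big1 // => D _.
  by rewrite mul0r.
- have [d hd] := kspan_id K n.
  transitivity (plane_mx (kspan (f := pl) n (fun D => \sum_i c i D))).
    apply/matrixP => a b; rewrite summxE mxE /kspan.
    under [RHS]eq_bigr => D _ do rewrite mulr_suml.
    by rewrite exchange_big; apply: eq_bigr => i _; rewrite mxE.
  rewrite -plane_mx1; apply/plane_mxP => s t hs ht; rewrite -(hd pl) //.
  apply: (@kspan_transfer K f pl) => s' t' hs' ht'; rewrite hd // /kspan.
  under eq_bigr => D _ do rewrite mulr_suml.
  rewrite exchange_big /= -(tcr_te hs' ht') [in RHS](sp (te n t')).
  rewrite (lin_sum _ _ (tcr_linear s')); apply: eq_bigr => i _.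
  by rewrite -[LHS]/(kspan n (c i) s' t') -hc.
Qed.

Lemma direct_family_card : (k <= 2 ^ n)%N.
Proof.
have [p [c [_ _ _ _ [e0 ee _]]]] := plane_idempotents.
by rewrite -predn_exp2; exact: primitive_card e0 ee.
Qed.

(** An idempotent below the i-th one in the algebra of the plane is carried back, with its
    coefficients, to a colinear idempotent below [p i]. As [U i] is indecomposable this is 0 or
    [p i], so the idempotents in the plane are primitive. *)
Lemma indec_card : (forall i, indecomposable rho (U i)) ->
  (size (dycks (n + n)) <= k * k)%N.
Proof.
move=> ind.
have [p [c [cp pU Up hc [e0 ee e1]]]] := plane_idempotents.
have prim i a : tl_alg a -> a * a = a -> a * plane_mx (kspan (f := pl) n (c i)) = a ->
    plane_mx (kspan (f := pl) n (c i)) * a = a ->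
    a = 0 \/ a = plane_mx (kspan (f := pl) n (c i)).
  move=> [d ->{a}] dd dc cd.
  have Lp : linear (p i) by case: (cp i).
  pose q : W -> W := of_mx (kspan (f := f) n d).
  have cq : colinear rho q by exact: kspan_colinear.
  have Lq : linear q by case: cq.
  have qE s t : size s = n -> size t = n -> mx_of q s t = kspan n d s t by exact: mx_of_of_mx.
  have mulE (g h : seq bool -> K) : plane_mx (kspan (f := pl) n g) * plane_mx (kspan (f := pl) n h) =
      plane_mx (kspan (f := pl) n d) -> forall s t : seq f, size s = n -> size t = n ->
      \sum_(u <- words f n) kspan n g s u * kspan n h u t = kspan n d s t.
    have [m hm] := kspan_mul n g h; rewrite plane_mxM => /plane_mxP e s t hs ht.
    rewrite hm //; apply: (@kspan_transfer K pl f) => s' t' hs' ht'.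
    exact: (etrans (esym (hm pl s' t' hs' ht')) (e s' t' hs' ht')).
  have [qq|qp] : (forall w, q w = 0) \/ (forall w, q w = p i w).
  + apply: (indec_primitive (ind i) (pU i) (Up i) (cp i) cq) => w.
    * apply: (mx_of_ext (p := fun w => q (q w))) => // [x u v|s t hs ht]; first by rewrite !Lq.
      rewrite mx_of_comp // qE // -(mulE _ _ dd) //.
      by apply: eq_big_words => u hu; rewrite !qE.
    * apply: (mx_of_ext (p := fun w => p i (q w))) => // [x u v|s t hs ht]; first by rewrite Lq Lp.
      rewrite mx_of_comp // qE // -(mulE _ _ cd) //.
      by apply: eq_big_words => u hu; rewrite hc // qE.
    * apply: (mx_of_ext (p := fun w => q (p i w))) => // [x u v|s t hs ht]; first by rewrite Lp Lq.
      rewrite mx_of_comp // qE // -(mulE _ _ dc) //.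
      by apply: eq_big_words => u hu; rewrite hc // qE.
  + left; have -> : 0 = plane_mx (kspan (f := pl) n (fun _ => 0)).
      by apply/matrixP => a b; rewrite !mxE /kspan big1 // => D _; rewrite mul0r.
    apply/plane_mxP => s t _ _; apply: (@kspan_transfer K f pl) => s' t' hs' ht'.
    rewrite -qE // /mx_of qq (lin0 (tcr_linear s')) /kspan big1 // => D _.
    by rewrite mul0r.
  + right; apply/plane_mxP => s t _ _; apply: (@kspan_transfer K f pl) => s' t' hs' ht'.
    by rewrite -qE // -hc // /mx_of qp.
set m := size _; pose D (t : 'I_m) := nth [::] (dycks (n + n)) t.
have injD : injective D.
  by move=> a b /eqP; rewrite nth_uniq ?dycks_uniq // => /eqP/val_inj.
have hD t : D t \in dycks (n + n) by exact: mem_nth.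
have BF t : tl_alg (plane_mx (kf (f := pl) (D t))).
  exists (fun E => (D t == E)%:R); apply/matrixP => a b; rewrite !mxE /kspan.
  by rewrite (big_dycks_delta (fun E => kf (f := pl) E (pword a) (pword b)) (hD t)).
apply: (@free_card K N' tl_alg tl_alg1 tl_algZD tl_algM tl_alg_adj k
  (fun i => plane_mx (kspan (f := pl) n (c i))) _ e0 ee e1 prim m
  (fun t => plane_mx (kf (f := pl) (D t))) BF).
  by move=> i; exists (c i).
exact: tl_alg_free.
Qed.

End Idempotents.

(** The letter [i0] makes the tensor power nonzero, so that decompositions exist; the bounds then
    hold for the one behind [num_summands]. *)
Lemma num_summands_bounds (i0 : f) (b := num_summands (fcoaction f) n) :
  (size (dycks (n + n)) <= b * b)%N && (b <= 2 ^ n)%N.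
Proof.
have te0 : te n (nseq n i0) <> 0 :> W.
  move=> e; have := @tcr_te K f n (nseq n i0) (nseq n i0).
  rewrite size_nseq e (lin0 (tcr_linear _)) eqxx => /(_ erefl erefl)/eqP.
  by rewrite eq_sym oner_eq0.
have [k [U hU]] := indec_decomposition_exists te0 direct_family_card.
(* Since some decomposition exists, [xget] does not fall back on its default 0. *)
have [V hV] : exists V : 'I_b -> set W, indec_decomposition rho V.
  rewrite /b /num_summands /num_indec; case: xgetP => [l -> //|/(_ k)]; case.
  by exists U.
have dV : direct_family rho V.
  by case: hV => h dec; split=> // i; have [h1 [h2 _]] := h i.
rewrite (direct_family_card dV) andbT; apply: (indec_card dV) => i.
by case: hV => h _; case: (h i).
Qed.

End SummandBounds.

(** * Growth *)

Section BallotNumbers.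

Definition ballot h m := count (dyck h) (words bool m).

Lemma ballotS h m :
  ballot h m.+1 = (ballot h.+1 m + (if h is h'.+1 then ballot h' m else 0))%N.
Proof.
have eb : enum {: bool} = [:: true; false] by rewrite enumT unlock.
rewrite /ballot -[words bool m.+1]/[seq i :: w | i <- enum {: bool}, w <- words bool m].
rewrite eb /= cats0 count_cat !count_map; congr (_ + _)%N.
case: h => [|h]; last exact: eq_count.
by rewrite (@eq_count _ _ pred0) ?count_pred0.
Qed.

Lemma ballot0 h m : (m < h)%N -> ballot h m = 0%N.
Proof.
elim: m h => [|m IH] [|h] // hm; rewrite ballotS !IH //.
exact: leq_trans (ltnW hm) _.
Qed.

(** The reflection formula for ballot numbers, with the subtracted binomial moved to the left; [j]
    counts the openings. *)
Lemma ballotE h j :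
  (ballot h (h + j.*2) + (if j is j'.+1 then 'C(h + j.*2, j') else 0))%N =
  'C(h + j.*2, j).
Proof.
have [m hm] : exists m, m = (h + j.*2)%N by exists (h + j.*2)%N.
rewrite -hm; elim: m h j hm => [|m IH] [|h] [|j] // hm.
- rewrite ballotS addn0.
  have m1 : m = (1 + j.*2)%N by move: hm; lia.
  have := IH 1%N j m1.
  have e : 'C(m, j.+1) = 'C(m, j).
    by rewrite -bin_sub; [congr 'C(_, _)|]; rewrite m1; lia.
  by case: j {IH hm} m1 e => [|j] m1; rewrite !binS ?bin0; lia.
- have mh : m = h by move: hm; lia.
  rewrite ballotS ballot0 ?mh // add0n.
  have := IH h 0%N; rewrite double0 addn0 mh => /(_ erefl).
  by rewrite !bin0.
- have m1 : m = (h.+2 + j.*2)%N by move: hm; rewrite doubleS; lia.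
  have m2 : m = (h + j.+1.*2)%N by move: hm; rewrite doubleS; lia.
  rewrite ballotS; have := IH _ _ m1; have := IH _ _ m2.
  case: j {IH hm m1 m2} => [|j]; rewrite !binS ?bin0; lia.
Qed.

(** The induction step rests on (n+1) C(2n+2, n+1) = 2 (2n+1) C(2n, n). *)
Lemma central_binomial n : (4 ^ n <= n.*2.+1 * 'C(n.*2, n))%N.
Proof.
elim: n => // n IH.
have e1 : (n.+1 * 'C(n.+1.*2, n.+1) = n.+1.*2 * 'C(n.*2.+1, n))%N.
  by rewrite -mul_bin_diag doubleS.
have e2 : (n.*2.+1 * 'C(n.*2, n) = n.+1 * 'C(n.*2.+1, n))%N.
  by rewrite (mul_bin_down n.*2.+1 n) //=; congr (_ * _)%N; lia.
rewrite expnS; nia.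
Qed.

(** By the reflection formula the number of diagrams is C(2n, n) / (n+1). *)
Lemma size_dycks_lower n : (4 ^ n <= (n.*2.+1 * n.+1) * size (dycks (n + n)))%N.
Proof.
have -> : size (dycks (n + n)) = ballot 0 n.*2 by rewrite /dycks size_filter addnn.
have := central_binomial n; have := ballotE 0 n; rewrite add0n.
case: n => [|n]; first by rewrite addn0 => ->.
have := mul_bin_left n.+1.*2 n.
have -> : (n.+1.*2 - n)%N = n.+2 by rewrite doubleS; lia.
move=> h1 h2 h3; apply: leq_trans h3 _; rewrite -mulnA leq_mul2l; apply/orP; right; nia.
Qed.

End BallotNumbers.

(** * The limit of the roots *)

Section Limit.
Variable R : realType.

(** The linear factor is lost under the n-th root: if n >= 4 / d^2, Bernoulli's inequality gives
    2(n+1) <= 4n <= (nd)^2 <= (1+d)^(2n), so the root lies between 2 / (1+d)^2 and 2. *)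
Lemma root_cvg (b : nat -> nat) :
  (forall n, (2 ^ n <= n.+1.*2 * b n)%N) -> (forall n, (b n <= 2 ^ n)%N) ->
  (fun n => ((b n)%:R : R) `^ (n%:R)^-1) @ \oo --> (2 : R).
Proof.
move=> lo up; apply/cvgrPdist_le => e e0.
(* The 4 comes from [2 - 4 * d <= 2 / (1 + d) ^+ 2], which makes the error at most [4 * d <= e]. *)
pose d := Num.min (e / 4) 1.
have d0 : 0 < d by rewrite lt_min divr_gt0 //= ltr01.
have de : d <= e / 4 by rewrite ge_min lexx.
have d1 : 0 < (1 + d) ^+ 2 by rewrite exprn_gt0 // addr_gt0.
have pow_root (x : R) n : 0 <= x -> (0 < n)%N -> (x ^+ n) `^ (n%:R)^-1 = x.
  move=> x0 n0; rewrite -powR_mulrn // -powRrM divff ?powRr1 //.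
  by rewrite pnatr_eq0 -lt0n.
have root_le (x y : R) n : 0 <= x -> x <= y -> x `^ (n%:R)^-1 <= y `^ (n%:R)^-1.
  move=> x0 xy; apply: ge0_ler_powR => //; rewrite ?invr_ge0 ?ler0n // nnegrE //.
  exact: le_trans xy.
have bernoulli n : 1 + n%:R * d <= (1 + d) ^+ n.
  elim: n => [|n IH]; first by rewrite mul0r addr0 expr0.
  rewrite exprS; apply: le_trans (ler_wpM2l _ IH); last by rewrite addr_ge0 // ltW.
  rewrite -natr1; have : 0 <= n%:R * d * d by rewrite !mulr_ge0 // ltW.
  lra.
near=> n.
have n0 : (0 < n)%N by near: n; exists 1%N.
have nd : 4 / d ^+ 2 <= n%:R.
  near: n; exists (Num.bound (4 / d ^+ 2)) => // m /= hm.
  apply: le_trans (ltW (archi_boundP _)) _; last by rewrite ler_nat.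
  by rewrite divr_ge0 // exprn_ge0 // ltW.
have big : (n.+1.*2)%:R <= ((1 + d) ^+ 2) ^+ n :> R.
  rewrite exprAC; apply: (@le_trans _ _ ((n%:R * d) ^+ 2)); last first.
    have h1 : 0 <= n%:R * d by rewrite mulr_ge0 // ltW.
    have h2 : n%:R * d <= (1 + d) ^+ n by apply: le_trans (bernoulli n); rewrite lerDr.
    by rewrite lerXn2r // nnegrE //; exact: le_trans h2.
  have : 4 <= n%:R * d ^+ 2 by rewrite -ler_pdivrMr // exprn_gt0.
  rewrite exprMn -mul2n natrM -[n.+1%:R]natr1 => h4.
  have n1 : 1 <= n%:R :> R by rewrite ler1n.
  have : n%:R * 4 <= n%:R * (n%:R * d ^+ 2) by apply: ler_wpM2l; rewrite ?ler0n.
  rewrite expr2; lra.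
have le2 : ((b n)%:R : R) `^ (n%:R)^-1 <= 2.
  rewrite -[leRHS](pow_root 2 n) //; apply: root_le => //.
  by rewrite -natrX ler_nat.
have ge2 : 2 / (1 + d) ^+ 2 <= ((b n)%:R : R) `^ (n%:R)^-1.
  have x0 : 0 <= 2 / (1 + d) ^+ 2 by rewrite divr_ge0 // ltW.
  rewrite -[leLHS](pow_root _ n) //; apply: root_le; first exact: exprn_ge0.
  rewrite expr_div_n ler_pdivrMr ?exprn_gt0 ?addr_gt0 //.
  apply: (@le_trans _ _ ((b n)%:R * (n.+1.*2)%:R)); last by rewrite ler_wpM2l.
  by rewrite -natrM -natrX ler_nat mulnC.
rewrite ger0_norm ?subr_ge0 //.
have : 2 - 4 * d <= 2 / (1 + d) ^+ 2.
  rewrite ler_pdivlMr // expr2; nra.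
lra.
Unshelve. all: by end_near.
Qed.

End Limit.

(** * Forms of large dimension with loop value -2 *)

Section LargeForm.
Variables (K : fieldType) (m : nat).

Local Notation idx := (bool * 'I_(m.*2.+1))%type.

(* An orthogonal sum of [m] hyperbolic and [m.+1] symplectic planes. *)
Definition large_tau (i : idx) : idx := (~~ i.1, i.2).
Definition large_sgn (i : idx) : K := if odd i.2 then 1 else (-1) ^+ i.1.

Lemma large_tauK : involutive large_tau.
Proof. by case=> c i; rewrite /large_tau /= negbK. Qed.

Lemma large_sgn_sqr i : large_sgn i * large_sgn i = 1.
Proof. by rewrite /large_sgn; case: ifP => _; rewrite ?mulr1 // -expr2 sqrr_sign. Qed.

Lemma large_loop : \sum_i large_sgn i * large_sgn (large_tau i) = - 2%:R.
Proof.
rewrite -(pair_bigA _ (fun c i => large_sgn (c, i) * large_sgn (large_tau (c, i)))) /=.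
rewrite exchange_big /=.
transitivity (\sum_(i < m.*2.+1) (if odd i then 2%:R else - 2%:R : K)).
  apply: eq_bigr => i _; rewrite big_bool /large_sgn /=.
  by case: ifP => _; rewrite ?expr0 ?expr1 ?mulr1 ?mul1r -?opprD.
elim: m => [|l IH]; first by rewrite big_ord1.
by rewrite doubleS 2!big_ord_recr /= IH odd_double /= addrK.
Qed.

Definition largeForm : tlForm K := TLForm large_tauK large_sgn_sqr large_loop.

Lemma card_largeForm : #|largeForm| = m.*2.+1.*2.
Proof. by rewrite card_prod card_bool card_ord mul2n. Qed.

End LargeForm.

Lemma num_summands_cvg (R : realType) (f : tlForm R[i]) (i0 : f) :
  root_summands R (fcoaction f) @ \oo --> (2 : R).
Proof.
apply: root_cvg => n; have /andP[h1 h2] := num_summands_bounds n i0; last by [].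
(* Comparing squares suffices: 4^n <= (2n+1)(n+1) b^2 <= (2(n+1) b)^2. *)
rewrite -(@leq_exp2r _ _ 2) // -expnM mulnC expnM.
apply: leq_trans (size_dycks_lower n) _; move: h1.
set b := num_summands _ _; set s := size _ => h1.
have : (n.*2.+1 * n.+1 * s <= n.*2.+1 * n.+1 * (b * b))%N by rewrite leq_mul2l h1 orbT.
rewrite -!muln2 expnMn; nia.
Qed.

Theorem theorem5p0p1 (R : realType) (A : R) (A_ge0 : 0 <= A) :
  exists (Gamma : hopfAlgebra R[i]) (r : cotriangular_structure Gamma)
         (V : vectType R[i]) (rho : coaction Gamma V),
    cvgn (root_summands R rho) /\
    growth_rate R rho + A < (\dim {:V})%:R.
Proof.
pose m := Num.bound A; pose f := largeForm R[i] m.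
exists (formHopf f), (form_cotriangular f), (fvec f), (fcoaction f).
have cvg2 := @num_summands_cvg R f (true, ord0).
split; first by apply/cvg_ex; exists 2.
rewrite /growth_rate (cvg_lim _ cvg2) //.
rewrite dim_fvec card_largeForm.
(* The dimension is 4m + 2, at least 2 + m, and A < m by the choice of [m]. *)
apply: (@lt_le_trans _ _ (2 + m%:R)); first by rewrite ltrD2l archi_boundP.
by rewrite -natrD ler_nat; lia.
Qed.
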